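(* Let $m>2$ be even and $\alpha,\beta\in[-\pi,\pi]$ with $\alpha\notin\{0,\pm\pi\}$. The kernel of the fractional Clifford-Fourier transform in dimension $m$ is given by $$K_{\alpha,\beta}(\underline x,\underline y)=e^{\frac i2(\cot\alpha)(|\underline x|^2+|\underline y|^2)}\,e^{i\beta\Gamma_{\underline y}}\left(e^{-i\langle\underline x,\underline y\rangle/\sin\alpha}\right)$$ $$=\left(\frac\pi2\right)^{\frac12}e^{i\beta(m-2)/2}(\cos\beta)^{(m-2)/2}e^{-is^*\cot\beta}e^{\frac i2(\cot\alpha)(|\underline x|^2+|\underline y|^2)}\left(A^{\alpha,\beta,*}_{(m-2)/2}(s^*,t^* )+B^{\alpha,\beta,*}_{(m-2)/2}(s^*,t^* )+(\underline x\wedge\underline y)\,C^{\alpha,\beta,*}_{(m-2)/2}(s^*,t^* )\right),$$ where $s^*=\frac{\sin\beta}{\sin\alpha}\langle\underline x,\underline y\rangle$, $t^*=\frac{\sin\beta}{\sin\alpha}|\underline x\wedge\underline y|$, and $$A^{\alpha,\beta,*}_{(m-2)/2}(s^*,t^* )=i\left(\frac{m-2}{2}\right)\tan\beta\sum_{\ell=0}^{\frac m2-2}\binom{\frac m2-2}{\ell}(i\tan\beta)^\ell\,C_\ell^*(s^*,t^* ),$$ $$B^{\alpha,\beta,*}_{(m-2)/2}(s^*,t^* )=-\sum_{\ell=0}^{\frac m2-1}\binom{\frac m2-1}{\ell}(i\tan\beta)^\ell\,B_\ell^*(s^*,t^* ),$$ $$C^{\alpha,\beta,*}_{(m-2)/2}(s^*,t^*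 )=-\frac{\sin\beta}{\sin\alpha}\sum_{\ell=0}^{\frac m2-1}\binom{\frac m2-1}{\ell}(i\tan\beta)^\ell\,C_\ell^*(s^*,t^* ),$$ with, for every integer $\ell\ge0$, $$B_\ell^*(s,t)=-\sum_{j=0}^{\lfloor\ell/2\rfloor}s^{\ell-2j}\,\frac{1}{2^jj!}\,\frac{\ell!}{(\ell-2j)!}\,\widetilde J_{\ell-j-\frac12}(t),\qquad C_\ell^*(s,t)=-\sum_{j=0}^{\lfloor\ell/2\rfloor}s^{\ell-2j}\,\frac{1}{2^jj!}\,\frac{\ell!}{(\ell-2j)!}\,\widetilde J_{\ell-j+\frac12}(t),$$ and $\widetilde J_\nu(t)=t^{-\nu}J_\nu(t)$.
   Context: $\mathcal{C}l_{0,m}$ is the Clifford algebra generated by $e_1,\dots,e_m$ with $e_ie_j+e_je_i=0$ ($i\ne j$) and $e_i^2=-1$, with complex coefficients allowed. Vectors are written $\underline x=\sum_jx_je_j$; $\langle\underline x,\underline y\rangle=\sum_jx_jy_j$, $\underline x\wedge\underline y=\sum_{j<k}e_je_k(x_jy_k-x_ky_j)$, $|\underline x\wedge\underline y|=\sqrt{|\underline x|^2|\underline y|^2-\langle\underline x,\underline y\rangle^2}$, and $\Gamma_{\underline y}=-\sum_{j<k}e_je_k(y_j\partial_{y_k}-y_k\partial_{y_j})$. The operator $e^{i\beta\Gamma_{\underline y}}$ acts in the variable $\underline y$ by the exponential series $\sum_{n\ge0}\frac{(i\beta)^n}{n!}\Gamma_{\underline y}^n$. $J_\nu$ is the Bessel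 function of the first kind; $\widetilde J_\nu$ is regarded as an even entire function. The fractional Clifford-Fourier transform is $\mathcal F_{\alpha,\beta}=e^{\frac{i\alpha m}{2}}e^{i\beta\Gamma}e^{\frac{i\alpha}{2}(\Delta-|\underline x|^2)}$, written as $\mathcal F_{\alpha,\beta}[f](\underline y)=(\pi(1-e^{-2i\alpha}))^{-m/2}\int_{\mathbb R^m}K_{\alpha,\beta}(\underline x,\underline y)f(\underline x)\,dx$; its kernel is $K_{\alpha,\beta}(\underline x,\underline y)=e^{\frac i2(\cot\alpha)(|\underline x|^2+|\underline y|^2)}e^{i\beta\Gamma_{\underline y}}(e^{-i\langle\underline x,\underline y\rangle/\sin\alpha})$. When $\cos\beta=0$ or $\sin\beta=0$, the formula is understood after multiplying out the factor $(\cos\beta)^{(m-2)/2}$ with the powers of $\tan\beta$ and writing $s^*\cot\beta=\frac{\cos\beta}{\sin\alpha}\langle\underline x,\underline y\rangle$, so that all singularities in $\beta$ are removed. *)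

(* Defs.v *)
From HB Require Import structures.
From mathcomp Require Import all_boot all_order all_algebra.
From mathcomp Require Import complex ring.
From mathcomp Require Import all_classical all_reals all_analysis.

Set Implicit Arguments.
Unset Strict Implicit.
Unset Printing Implicit Defensive.

Import Order.TTheory GRing.Theory Num.Theory.
Import numFieldNormedType.Exports.

Local Open Scope complex_scope.
Local Open Scope ring_scope.

(* The Clifford algebra Cl_{0,m} over K: an element is the family of its
   coordinates in the basis e_A = e_{a_1} ... e_{a_r} for A = {a_1 < ... < a_r}.
   e_A e_B = +/- e_{A symd B}: sorting the concatenated word costs one factor
   -1 for every pair (a, b) in A x B with b < a (a transposition), and one more
   for every b = a (as e_a ^ 2 = -1). *)
Definition symd (T : finType) (A B : {set T}) : {set T} :=
  (A :\: B) :|: (B :\: A).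

Definition clifford (K : comNzRingType) (m : nat) : Type :=
  {ffun {set 'I_m} -> K}.

HB.instance Definition _ (K : comNzRingType) (m : nat) :=
  GRing.Lmodule.copy (clifford K m) {ffun {set 'I_m} -> K^o}.

Section CliffordRing.
Variables (K : comNzRingType) (m : nat).
Implicit Types (a b c : clifford K m) (A B C : {set 'I_m}).

Definition clifford_sign A B : K :=
  \prod_(i in A) \prod_(j in B | (j <= i)%N) -1.

Definition clifford_one : clifford K m := [ffun A : {set 'I_m} => (A == finset.set0)%:R].

Definition clifford_mul a b : clifford K m :=
  [ffun C : {set 'I_m} =>
    \sum_(A : {set 'I_m}) clifford_sign A (symd A C) * a A * b (symd A C)].

Lemma in_symd A B i : (i \in symd A B) = (i \in A) (+) (i \in B).
Proof. by rewrite !inE; case: (i \in A); case: (i \in B). Qed.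

Lemma symdA A B C : symd A (symd B C) = symd (symd A B) C.
Proof. by apply/setP => i; rewrite !in_symd addbA. Qed.

Lemma symdC A B : symd A B = symd B A.
Proof. by apply/setP => i; rewrite !in_symd addbC. Qed.

Lemma symdK A : cancel (symd A) (symd A).
Proof. by move=> B; apply/setP => i; rewrite !in_symd addbA addbb. Qed.

Lemma symd0 A : symd A finset.set0 = A.
Proof. by apply/setP => i; rewrite in_symd inE addbF. Qed.

Lemma symdd A : symd A A = finset.set0.
Proof. by apply/setP => i; rewrite in_symd inE addbb. Qed.

Lemma prod_symd (F : 'I_m -> K) A B : (forall i, F i * F i = 1) ->
  \prod_(i in symd A B) F i = (\prod_(i in A) F i) * \prod_(i in B) F i.
Proof.
move=> FF; rewrite big_mkcond [in RHS]big_mkcond [X in _ = _ * X]big_mkcond.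
rewrite -big_split /=; apply: eq_bigr => i _; rewrite in_symd.
by case: (i \in A); case: (i \in B); rewrite /= ?FF ?mulr1 ?mul1r.
Qed.

Lemma clifford_signDl A B C :
  clifford_sign (symd A B) C = clifford_sign A C * clifford_sign B C.
Proof.
rewrite /clifford_sign prod_symd // => i.
by rewrite -big_split /=; apply: big1 => j _; rewrite mulrNN mulr1.
Qed.

Lemma clifford_signDr A B C :
  clifford_sign A (symd B C) = clifford_sign A B * clifford_sign A C.
Proof.
rewrite /clifford_sign -big_split /=; apply: eq_bigr => i _.
rewrite !big_mkcondr prod_symd // => j.
by case: ifP => _; rewrite ?mulrNN mulr1.
Qed.

Lemma clifford_sign0l A : clifford_sign finset.set0 A = 1.
Proof. by rewrite /clifford_sign big_set0. Qed.

Lemma clifford_sign0r A : clifford_sign A finset.set0 = 1.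
Proof.
by rewrite /clifford_sign big1 // => i _; rewrite big1 // => j; rewrite inE.
Qed.

Lemma clifford_mulA : associative clifford_mul.
Proof.
move=> a b c; apply/ffunP => D; rewrite !ffunE.
under eq_bigr do rewrite ffunE mulr_sumr.
under [RHS]eq_bigr do rewrite ffunE mulr_sumr mulr_suml.
rewrite [RHS]exchange_big /=; apply: eq_bigr => A _.
rewrite [RHS](reindex_inj (can_inj (symdK A))) /=; apply: eq_bigr => B _.
rewrite symdK -symdA; set X := symd B (symd A D).
have -> : symd A (symd B D) = X by rewrite /X !symdA [symd A B]symdC.
have -> : symd A D = symd B X by rewrite /X symdK.
rewrite clifford_signDl clifford_signDr.
by ring.
Qed.

Lemma clifford_mul1l : left_id clifford_one clifford_mul.
Proof.
move=> a; apply/ffunP => C; rewrite ffunE (bigD1 finset.set0) //= ffunE eqxx.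
rewrite big1 => [|A /negPf A0]; last by rewrite ffunE A0 mulr0 mul0r.
by rewrite clifford_sign0l symdC symd0 addr0 !mul1r.
Qed.

Lemma clifford_mul1r : right_id clifford_one clifford_mul.
Proof.
move=> a; apply/ffunP => C; rewrite ffunE (bigD1 C) //= ffunE symdd eqxx.
rewrite big1 => [|A AC]; first by rewrite clifford_sign0r mul1r mulr1 addr0.
rewrite ffunE; case: eqP => [E|]; last by rewrite mulr0.
by move: AC; rewrite -[C](symdK A) E symd0 eqxx.
Qed.

Lemma clifford_mulDl : left_distributive clifford_mul +%R.
Proof.
move=> a b c; apply/ffunP => C; rewrite !ffunE -big_split /=.
by apply: eq_bigr => A _; rewrite !ffunE mulrDr mulrDl.
Qed.

Lemma clifford_mulDr : right_distributive clifford_mul +%R.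
Proof.
move=> a b c; apply/ffunP => C; rewrite !ffunE -big_split /=.
by apply: eq_bigr => A _; rewrite !ffunE mulrDr.
Qed.

Lemma clifford_one_neq0 : clifford_one != 0.
Proof.
by apply/eqP => /ffunP/(_ finset.set0)/eqP; rewrite !ffunE eqxx oner_eq0.
Qed.

HB.instance Definition _ := GRing.Zmodule_isNzRing.Build (clifford K m)
  clifford_mulA clifford_mul1l clifford_mul1r clifford_mulDl clifford_mulDr
  clifford_one_neq0.

Lemma clifford_scaleAl (k : K) (a b : clifford K m) : k *: (a * b) = k *: a * b.
Proof.
apply/ffunP => C; rewrite !ffunE scaler_sumr; apply: eq_bigr => A _.
by rewrite !ffunE /GRing.scale /= !mulrA [_ * k]mulrC.
Qed.

HB.instance Definition _ :=
  GRing.Lmodule_isLalgebra.Build K (clifford K m) clifford_scaleAl.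

Lemma clifford_scaleAr (k : K) (a b : clifford K m) : k *: (a * b) = a * (k *: b).
Proof.
apply/ffunP => C; rewrite !ffunE scaler_sumr; apply: eq_bigr => A _.
by rewrite !ffunE /GRing.scale /= !mulrA [_ * k]mulrC !mulrA.
Qed.

HB.instance Definition _ :=
  GRing.Lalgebra_isAlgebra.Build K (clifford K m) clifford_scaleAr.

Definition cgen (j : 'I_m) : clifford K m :=
  [ffun A : {set 'I_m} => (A == [set j]%SET)%:R].

Lemma cgen_mulE (j k : 'I_m) C : (cgen j * cgen k) C =
  (C == symd [set j]%SET [set k]%SET)%:R * (if (k <= j)%N then -1 else 1).
Proof.
rewrite ffunE (bigD1 [set j]%SET) //= !ffunE eqxx mulr1.
rewrite big1 => [|A /negPf Aj]; last by rewrite ffunE Aj mulr0 mul0r.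
rewrite addr0 (can2_eq (symdK _) (symdK _)).
case: eqP => [->|_]; last by rewrite mulr0 mul0r.
rewrite symdK mulr1 mul1r /clifford_sign big_set1.
by rewrite big_mkcondr big_set1.
Qed.

Lemma cgen_sqr (j : 'I_m) : cgen j * cgen j = -1.
Proof.
by apply/ffunP => C; rewrite cgen_mulE leqnn symdd !ffunE mulrN1.
Qed.

Lemma cgen_anticomm (j k : 'I_m) :
  j != k -> cgen j * cgen k + cgen k * cgen j = 0.
Proof.
move=> jk; apply/ffunP => C; rewrite [LHS]ffunE !cgen_mulE symdC -mulrDr ffunE.
case: ltngtP => [_|_|/val_inj/eqP E]; last by rewrite eq_sym E in jk.
all: by rewrite /= ?subrr ?addNr mulr0.
Qed.

End CliffordRing.

Section CliffordFourier.
Variable R : realType.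
Implicit Types (alpha beta nu s t u : R).

Definition cot t : R := cos t / sin t.

(* e^{it} for real t *)
Definition expi t : R[i] := (cos t +i* sin t)%C.

Definition euler_gamma u : R :=
  \int[lebesgue_measure]_(t in `]0, +oo[%classic) (t `^ (u - 1) * expR (- t)).

Definition bessel_series nu t : R :=
  limn (series (fun k : nat =>
    (-1) ^+ k * (t ^+ 2 / 4) ^+ k / (k`!%:R * euler_gamma (nu + k%:R + 1)))).

(* Only used for t > 0 and nu > -1, where the integral defining euler_gamma
   converges. *)
Definition besselJ nu t : R := (t / 2) `^ nu * bessel_series nu t.

(* t^{-nu} J_nu(t), extended to all real t as an even entire function. *)
Definition tbesselJ nu t : R := 2 `^ (- nu) * bessel_series nu t.

Lemma tbesselJE nu t : 0 < t -> tbesselJ nu t = t `^ (- nu) * besselJ nu t.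
Proof.
move=> t0; rewrite /tbesselJ /besselJ mulrA; congr (_ * _).
rewrite powRM ?ltW // mulrA -powRD; last by rewrite (gt_eqF t0) implybT.
by rewrite addNr powRr0 mul1r -powR_inv1 // -powRrM mulN1r.
Qed.

Section Vectors.
Variable m : nat.
Implicit Types (x y : 'rV[R]_m).

Definition cliffordC := clifford R[i] m.

Definition dot x y : R := \sum_j x 0 j * y 0 j.

Definition wedge x y : cliffordC :=
  \sum_(j < m) \sum_(k < m | (j < k)%N)
    (x 0 j * y 0 k - x 0 k * y 0 j)%:C *: (cgen R[i] j * cgen R[i] k).

Definition wedge_norm x y : R := Num.sqrt (dot x x * dot y y - dot x y ^+ 2).

(* Limits and derivatives of Clifford-valued maps are taken in each of the
   2^m complex coordinates, on real and imaginary parts. *)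
Definition cl_cvg (u : nat -> cliffordC) : Prop :=
  forall A : {set 'I_m},
    cvgn (fun n => complex.Re (u n A)) /\ cvgn (fun n => complex.Im (u n A)).

Definition cl_lim (u : nat -> cliffordC) : cliffordC :=
  [ffun A : {set 'I_m} =>
    (limn (fun n => complex.Re (u n A)) +i* limn (fun n => complex.Im (u n A)))%C].

Definition cl_partial (k : 'I_m) (f : 'rV[R]_m -> cliffordC) (y : 'rV[R]_m)
  : cliffordC :=
  [ffun A : {set 'I_m} =>
    ('D_(delta_mx 0 k) (fun z => complex.Re (f z A)) y +i*
     'D_(delta_mx 0 k) (fun z => complex.Im (f z A)) y)%C].

Definition Gamma_op (f : 'rV[R]_m -> cliffordC) (y : 'rV[R]_m) : cliffordC :=
  - \sum_(j < m) \sum_(k < m | (j < k)%N)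
      cgen R[i] j * cgen R[i] k *
      ((y 0 j)%:C *: cl_partial k f y - (y 0 k)%:C *: cl_partial j f y).

Definition exp_Gamma_series beta (f : 'rV[R]_m -> cliffordC) (y : 'rV[R]_m)
  : nat -> cliffordC :=
  series (fun n : nat =>
    (('i%C * beta%:C) ^+ n / n`!%:R) *: iter n Gamma_op f y).

Definition exp_Gamma beta (f : 'rV[R]_m -> cliffordC) (y : 'rV[R]_m)
  : cliffordC := cl_lim (exp_Gamma_series beta f y).

Definition plane_wave alpha x (y : 'rV[R]_m) : cliffordC :=
  (expi (- dot x y / sin alpha))%:A.

Definition fcft_kernel alpha beta x y : cliffordC :=
  expi (cot alpha / 2 * (dot x x + dot y y)) *:
    exp_Gamma beta (plane_wave alpha x) y.

Definition s_star alpha beta x y : R := sin beta / sin alpha * dot x y.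

Definition t_star alpha beta x y : R := sin beta / sin alpha * wedge_norm x y.
End Vectors.

Definition Bstar (l : nat) s t : R :=
  - \sum_(0 <= j < (l./2).+1)
      s ^+ (l - j.*2) * (2 ^+ j * j`!%:R)^-1 * (l`!%:R / (l - j.*2)`!%:R) *
      tbesselJ (l%:R - j%:R - 2^-1) t.

Definition Cstar (l : nat) s t : R :=
  - \sum_(0 <= j < (l./2).+1)
      s ^+ (l - j.*2) * (2 ^+ j * j`!%:R)^-1 * (l`!%:R / (l - j.*2)`!%:R) *
      tbesselJ (l%:R - j%:R + 2^-1) t.

Definition Asum (m : nat) beta s t : R[i] :=
  'i%C * ((m - 2)%:R / 2) * (tan beta)%:C *
  \sum_(0 <= l < (m./2 - 2).+1)
    'C(m./2 - 2, l)%:R * ('i%C * (tan beta)%:C) ^+ l * (Cstar l s t)%:C.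

Definition Bsum (m : nat) beta s t : R[i] :=
  - \sum_(0 <= l < (m./2 - 1).+1)
      'C(m./2 - 1, l)%:R * ('i%C * (tan beta)%:C) ^+ l * (Bstar l s t)%:C.

Definition Csum (m : nat) alpha beta s t : R[i] :=
  - (sin beta / sin alpha)%:C *
  \sum_(0 <= l < (m./2 - 1).+1)
    'C(m./2 - 1, l)%:R * ('i%C * (tan beta)%:C) ^+ l * (Cstar l s t)%:C.

Definition kernel_formula (m : nat) alpha beta (x y : 'rV[R]_m)
  : cliffordC m :=
  let s := s_star alpha beta x y in
  let t := t_star alpha beta x y in
  ((Num.sqrt (pi / 2))%:C * expi (beta * (m - 2)%:R / 2) *
   (cos beta ^+ (m - 2)./2)%:C * expi (- (s * cot beta)) *
   expi (cot alpha / 2 * (dot x x + dot y y))) *: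
  ((Asum m beta s t + Bsum m beta s t)%:A + Csum m alpha beta s t *: wedge x y).

(* The three sums multiplied by (cos beta)^{(m-2)/2}, with
   cos beta * tan beta = sin beta used to remove the poles of tan. *)
Definition Asum_reg (m : nat) beta s t : R[i] :=
  'i%C * ((m - 2)%:R / 2) * (sin beta)%:C *
  \sum_(0 <= l < (m./2 - 2).+1)
    'C(m./2 - 2, l)%:R * ('i%C * (sin beta)%:C) ^+ l *
    (cos beta ^+ (m./2 - 2 - l))%:C * (Cstar l s t)%:C.

Definition Bsum_reg (m : nat) beta s t : R[i] :=
  - \sum_(0 <= l < (m./2 - 1).+1)
      'C(m./2 - 1, l)%:R * ('i%C * (sin beta)%:C) ^+ l *
      (cos beta ^+ (m./2 - 1 - l))%:C * (Bstar l s t)%:C.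

Definition Csum_reg (m : nat) alpha beta s t : R[i] :=
  - (sin beta / sin alpha)%:C *
  \sum_(0 <= l < (m./2 - 1).+1)
    'C(m./2 - 1, l)%:R * ('i%C * (sin beta)%:C) ^+ l *
    (cos beta ^+ (m./2 - 1 - l))%:C * (Cstar l s t)%:C.

(* kernel_formula with s* cot beta written as cos beta / sin alpha * <x, y>;
   it makes sense for every beta. *)
Definition kernel_formula_reg (m : nat) alpha beta (x y : 'rV[R]_m)
  : cliffordC m :=
  let s := s_star alpha beta x y in
  let t := t_star alpha beta x y in
  ((Num.sqrt (pi / 2))%:C * expi (beta * (m - 2)%:R / 2) *
   expi (- (cos beta / sin alpha * dot x y)) *
   expi (cot alpha / 2 * (dot x x + dot y y))) *:
  ((Asum_reg m beta s t + Bsum_reg m beta s t)%:A +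
   Csum_reg m alpha beta s t *: wedge x y).

End CliffordFourier.

(* Main.v *)
Require Import Defs.
From mathcomp Require Import all_boot all_order all_algebra complex ring lra.
From mathcomp Require Import all_classical all_reals all_analysis.
From mathcomp Require Import measurable_realfun.

(** Write N = (m - 2) / 2, u = <x, y>, w = |x|^2 |y|^2 and X = x /\ y, so that
    X^2 = u^2 - w, and let del = - i / sin alpha, eps = 1 / del.

    The operator Gamma_y differentiates only along the spheres |y| = const, so
    on functions f + X h, with f and h depending on u and w, it acts as a first
    order operator in u alone (Gamma_radial):
      f + X h |-> ((m - 1) u h + (u^2 - w) h') + X (f' + (m - 2) h).
    Hence the iterates of Gamma_y on the plane wave e^{del u} are e^{del u}
    times a pair of polynomials in u, and these pairs are the iterates on (1, 0)
    of the algebraic operator Gamma_pair N, where N stands for the dimension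
    2 N + 2 (Gamma_iter_wave).

    Raising the dimension by two is implemented by an intertwining operator:
    raise_dim, built from 1 + eps d/du, satisfies
      Gamma_pair (nu + 1) o raise_dim = raise_dim o (Gamma_pair nu + 1)
    and fixes (1, 0).  So
      (Gamma_pair N)^n (1, 0) = raise_dim^N ((Gamma_pair 0 + N)^n (1, 0)),
    and everything reduces to dimension two (iter_Gamma_pair_raise).

    In dimension two Gamma is an infinitesimal rotation exchanging u and X, and
      sum_n (i beta)^n / n! (Gamma_pair 0 + N)^n (1, 0)
        = e^{i beta N} e^{kappa1 u} e^{kappa2 X},
      kappa1 = del (cos beta - 1),  kappa2 = i del sin beta.
    This is made precise coefficient by coefficient: the coefficient of u^i X^j
    in (Gamma_pair 0 + N)^n (1, 0) is the value at z = 1 of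
    (z d/dz)^n (z^{N - i - j} q_{ij}(z)) for an explicit polynomial q_{ij}
    (moment_coefS), so its exponential generating function in n is read off at
    z = e^{i beta} (cvg_moment_coef), with bounds of size rate^{i+j} / (i! j!).
    Since raise_dim^N enlarges the value of u^i X^j at most geometrically in
    i + j, dominated convergence for double series (Tannery's theorem) lets one
    apply raise_dim^N term by term (double_series_limit).

    It remains to apply raise_dim^N to e^{kappa1 u} e^{kappa2 X}.  As
    (kappa2 X)^2 = - t^2, t = t^*, the even and odd parts of e^{kappa2 X} in X
    are cos t and kappa2 X sin t / t.  The u-derivatives of order l of cos t and
    sin t / t are combinations of Bessel functions of half-integer order, because
    Gamma(n + 1/2) = (2n)! sqrt pi / (4^n n!) (half_bessel, trig_poly_jet); up to
    constants these combinations are B_l^* and C_l^* (trig_jetE).  Conjugating by e^{kappa1 u}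
    turns 1 + eps d/du into (1 + eps kappa1) + eps d/du with
    1 + eps kappa1 = cos beta, and the binomial expansion of its powers gives
    the sums over l in the formula (jet_limit, radial_limit1, radial_limit2). *)

Set Implicit Arguments.
Unset Strict Implicit.
Unset Printing Implicit Defensive.

Import Order.TTheory GRing.Theory Num.Theory.
Import numFieldNormedType.Exports.
Import ComplexField.Normc.

Local Open Scope classical_set_scope.
Local Open Scope ring_scope.

(** * Gaussian moments and the Gamma function at half-integers *)

Section Moments.
Variable R : realType.
Notation mu := (@lebesgue_measure R).

Definition gauss_fun (k : nat) (x : R) : R := x ^+ k * expR (- x ^+ 2).

Lemma continuous_gauss_fun k : continuous (gauss_fun k).
Proof.
move=> x; apply: cvgM; first exact: exprn_continuous.
apply: continuous_comp; last exact: continuous_expR.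
by apply: cvgN; exact: exprn_continuous.
Qed.

Lemma measurable_gauss_fun k : measurable_fun setT (gauss_fun k).
Proof.
by apply: measurable_funM => //; apply: measurableT_comp => //; exact: measurableT_comp.
Qed.

Lemma gauss_fun_ge0 k x : 0 <= x -> 0 <= gauss_fun k x.
Proof. by move=> x0; rewrite mulr_ge0 ?expR_ge0 ?exprn_ge0. Qed.

Lemma gauss_fun_even_ge0 k x : 0 <= gauss_fun k.*2 x.
Proof. by rewrite mulr_ge0 ?expR_ge0 // exprn_even_ge0 // odd_double. Qed.

Lemma cvg_gauss_fun k : gauss_fun k n%:R @[n --> \oo] --> (0 : R).
Proof.
apply: (@squeeze_cvgr _ _ _ _ (fun=> 0) (fun n => k.+1`!%:R / n%:R)).
- near=> n; rewrite gauss_fun_ge0 //=.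
  have n0 : 0 < n%:R :> R by rewrite ltr0n; near: n; exists 1%N.
  rewrite ler_pdivlMr // /gauss_fun expRN mulrAC ler_pdivrMr ?expR_gt0 //.
  rewrite -exprSr.
  have /le_trans H : n%:R ^+ k.+1 / k.+1`!%:R <= expR (n%:R : R).
    by apply: le_trans (expR_ge1Dxn k (ltW n0)); rewrite lerDr.
  rewrite -ler_pdivrMl ?ltr0n ?fact_gt0 // mulrC; apply: H.
  by rewrite ler_expR expr2 ler_peMl ?(ltW n0) // ler1n -(ltr0n R).
- exact: cvg_cst.
- rewrite -[X in _ --> X](mulr0 (k.+1`!%:R : R)); apply: cvgM; first exact: cvg_cst.
  apply/gtr0_cvgV0; last exact: cvgr_idn.
  by near=> n; rewrite ltr0n; near: n; exists 1%N.
Unshelve. all: by end_near. Qed.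

(** Integration by parts with x e^{-x^2} = (- e^{-x^2} / 2)'; the boundary
    term vanishes as b tends to infinity. *)
Lemma gauss_moment_parts k (b : R) : 0 < b ->
  (\int[mu]_(x in `[0%R, b]) (gauss_fun k.+2 x)%:E =
  (- (gauss_fun k.+1 b / 2))%:E + (k.+1%:R / 2)%:E * \int[mu]_(x in `[0%R, b]) (gauss_fun k x)%:E)%E.
Proof.
move=> b0.
pose F := fun x : R => x ^+ k.+1; pose f := fun x : R => k.+1%:R * x ^+ k.
pose G := fun x : R => - (expR (- x ^+ 2) / 2); pose g := fun x : R => x * expR (- x ^+ 2).
have dG (x : R) : is_derive x 1 G (g x).
  have -> : g x = - (2^-1 *: (expR (- x ^+ 2) * - (2 * x))) by rewrite /g scalerAl /GRing.scale /=; field.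
  have d1 : is_derive x 1 (fun x : R => - x ^+ 2) (- (2 * x)).
    by apply: is_derive_eq; rewrite /GRing.scale /= mulr1 mulr_natl mulr2n.
  have d2 : is_derive x 1 (fun x : R => expR (- x ^+ 2)) (expR (- x ^+ 2) * - (2 * x)).
    exact: is_derive1_comp.
  have -> : G = - (2^-1 \*: (fun x : R => expR (- x ^+ 2))).
    by apply/funext => z; rewrite /G fctE /= mulrC.
  by apply: is_deriveN.
have cG : continuous G.
  by move=> x; apply: differentiable_continuous; apply/derivable1_diffP; have [] := dG x.
have dF (x : R) : is_derive x 1 F (f x).
  by apply: DeriveDef; [exact: exprn_derivable|rewrite exp_derive /GRing.scale /= mulr1].
have cF : continuous F by move=> x; exact: exprn_continuous.
have E := @integration_by_parts R F G f g 0 b b0.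
transitivity (\int[mu]_(x in `[0%R, b]) (F x * g x)%:E)%E.
  by apply: eq_integral => x _; rewrite /F /g /gauss_fun mulrA -exprSr.
rewrite E; last first.
- by move=> x _; rewrite derive1E; apply: derive_val; exact: dG.
- split.
  + by move=> x _; have [] := dG x.
  + by apply: cvg_at_right_filter; exact: cG.
  + by apply: cvg_at_left_filter; exact: cG.
- apply: continuous_subspaceT => x; apply: cvgM => //.
  apply: continuous_comp; last exact: continuous_expR.
  by apply: cvgN; exact: exprn_continuous.
- by move=> x _; rewrite derive1E; apply: derive_val; exact: dF.
- split.
  + by move=> x _; have [] := dF x.
  + by apply: cvg_at_right_filter; exact: cF.
  + by apply: cvg_at_left_filter; exact: cF.
- by apply: continuous_subspaceT => x; apply: cvgM; [exact: cvg_cst|exact: exprn_continuous].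
have -> : F b * G b - F 0 * G 0 = - (gauss_fun k.+1 b / 2).
  by rewrite /F /G /gauss_fun expr0n /= mul0r subr0 mulrN mulrA.
have -> : (\int[mu]_(x in `[0%R, b]) (f x * G x)%:E =
  \int[mu]_(x in `[0%R, b]) ((- (k.+1%:R / 2))%:E * (gauss_fun k x)%:E))%E.
  by apply: eq_integral => x _; rewrite -EFinM /f /G /gauss_fun; congr EFin; field.
rewrite integralZl //=; last first.
  apply: continuous_compact_integrable; first exact: segment_compact.
  by apply: continuous_subspaceT; exact: continuous_gauss_fun.
by rewrite (EFinN (k.+1%:R / 2)) mulNe oppeK.
Qed.

Lemma gauss_moment k :
  (\int[mu]_(x in `[0%R, +oo[) (gauss_fun k.*2 x)%:E =
   ((k.*2)`!%:R / (4 ^+ k * k`!%:R) * (Num.sqrt pi / 2))%:E)%E.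
Proof.
elim: k => [|k IH].
  rewrite fact0 expr0 mulr1 divr1 mul1r -integral0y_gauss.
  by apply: eq_integral => x _; rewrite /gauss_fun mul1r.
have C j := @ge0_cvgn_integral R mu _ (gauss_fun_even_ge0 j) (measurable_gauss_fun _).
have := C k.+1 => /cvg_lim <- //.
apply/cvg_lim => //.
rewrite (_ : (_ * _)%:E = (- (0 / 2))%:E + (k.*2.+1%:R / 2)%:E *
   ((k.*2)`!%:R / (4 ^+ k * k`!%:R) * (Num.sqrt pi / 2))%:E)%E; last first.
  rewrite -EFinM -EFinD; congr EFin; rewrite doubleS !factS exprS !natrM.
  have -> : k.*2.+2%:R = 2 * k.+1%:R :> R by rewrite -natrM mul2n doubleS.
  have h1 : k`!%:R != 0 :> R by rewrite pnatr_eq0 -lt0n fact_gt0.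
  have h2 : 4 ^+ k != 0 :> R by rewrite expf_neq0 // pnatr_eq0.
  have h3 : k.+1%:R != 0 :> R by rewrite pnatr_eq0.
  by field; rewrite h1 h2 addrC natr1 h3.
rewrite -IH -cvg_shiftS /=.
under eq_fun do rewrite doubleS gauss_moment_parts ?ltr0n //.
apply: cvgeD.
- by rewrite IH.
- apply: cvg_EFin; first by near=> n.
  apply: cvgN; apply: cvgM; last exact: cvg_cst.
  by rewrite (cvg_shiftS (fun n => gauss_fun k.*2.+1 n%:R)); exact: cvg_gauss_fun.
- apply: cvgeZl => //.
  by rewrite (cvg_shiftS (fun n => (\int[mu]_(x in `[0%R, n%:R]) (gauss_fun k.*2 x)%:E)%E)); exact: C.
Unshelve. all: by end_near. Qed.

End Moments.

Section HalfInteger.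
Variable R : realType.
Notation mu := (@lebesgue_measure R).

Lemma itv0y_bigcup (j : nat) :
  \bigcup_n `[(n.+1%:R^-1 : R) ^+ j.+1, +oo[%classic = `]0, +oo[%classic.
Proof.
apply/seteqP; split => [x [n _]|x] /=; rewrite !in_itv /= !andbT.
  by apply: lt_le_trans; rewrite exprn_gt0 // invr_gt0 ltr0n.
move=> x0; exists (Num.truncn x^-1) => //=; rewrite in_itv /= andbT.
have h0 : 0 < (Num.truncn x^-1).+1%:R :> R by rewrite ltr0n.
apply: (@le_trans _ _ (Num.truncn x^-1).+1%:R^-1); last first.
  by rewrite invf_ple // ltW // truncnS_gt.
rewrite exprS ler_piMr ?invr_ge0 ?ler0n // exprn_ile1 ?invr_ge0 ?ler0n //.
by rewrite invf_le1 // ler1n.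
Qed.

Lemma cvg_itv0y_integral j (f : R -> R) :
  measurable_fun setT f -> (forall x, 0 < x -> 0 <= f x) ->
  (\int[mu]_(x in `[((n.+1%:R^-1 : R) ^+ j.+1)%R, +oo[) (f x)%:E @[n --> \oo] -->
   \int[mu]_(x in `]0%R, +oo[) (f x)%:E)%E.
Proof.
move=> mf f0; rewrite -(itv0y_bigcup j).
have := @ge0_nondecreasing_set_cvg_integral _ (measurableTypeR R) R
  (fun n => `[(n.+1%:R^-1 : R) ^+ j.+1, +oo[%classic) (fun x => (f x)%:E) mu.
apply => //.
- apply/nondecreasing_seqP => n; apply/subsetPset; apply: subset_itvr.
  rewrite bnd_simp lerXn2r ?nnegrE ?invr_ge0 ?ler0n //.
  by rewrite lef_pV2 ?posrE ?ltr0n // ler_nat.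
- by move=> n; apply: measurableT_comp => //; exact: measurable_funTS.
- move=> n x /=; rewrite in_itv /= andbT => /(lt_le_trans _) x0.
  by rewrite lee_fin f0 // x0 // exprn_gt0 // invr_gt0 ltr0n.
Qed.

(** The substitution x = sqrt t takes Gaussian moments to Gamma integrals; it
    is made on half-lines away from 0, where sqrt is differentiable. *)
Lemma gamma_integral_subst k (c : R) : 0 < c ->
  (\int[mu]_(x in `[c, +oo[) (2 * gauss_fun k.*2 x)%:E =
   \int[mu]_(t in `[(c ^+ 2)%R, +oo[) (t `^ (k%:R - 2^-1) * expR (- t))%:E)%E.
Proof.
move=> c0.
have c20 : 0 < c ^+ 2 by rewrite exprn_gt0.
have sc : Num.sqrt (c ^+ 2) = c by rewrite sqrtr_sqr gtr0_norm.
have dS (x : R) : 0 < x -> is_derive x 1 Num.sqrt (2 * Num.sqrt x)^-1.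
  by move=> x0; exact: is_derive1_sqrt.
have dSE (x : R) : 0 < x -> derive1 (@Num.sqrt R) x = (2 * Num.sqrt x)^-1.
  by move=> x0; rewrite derive1E; apply: derive_val; exact: dS.
have cS : continuous (@Num.sqrt R) by exact: sqrt_continuous.
have cI (x : R) : 0 < x -> (fun x : R => (2 * Num.sqrt x)^-1) @ x --> (2 * Num.sqrt x)^-1.
  move=> x0; apply: cvgV; first by rewrite mulf_neq0 // gt_eqF // sqrtr_gt0.
  by apply: cvgM; [exact: cvg_cst|exact: cS].
have cD (x : R) : 0 < x -> derive1 (@Num.sqrt R) @ x --> (2 * Num.sqrt x)^-1.
  move=> x0; apply: cvg_trans (cI _ x0); apply: near_eq_cvg.
  near=> y; rewrite dSE //; near: y; exact: lt_nbhsr.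
have H := @increasing_ge0_integration_by_substitutiony R (@Num.sqrt R)
  (fun x => 2 * gauss_fun k.*2 x) (c ^+ 2).
rewrite sc in H; rewrite H.
- apply: eq_integral => x; rewrite inE /= in_itv /= andbT => /(lt_le_trans c20) x0.
  congr EFin; rewrite !fctE dSE // /gauss_fun -muln2 mulnC exprM sqr_sqrtr ?ltW //.
  have sx : 0 < Num.sqrt x by rewrite sqrtr_gt0.
  rewrite powRD ?(gt_eqF x0) ?implybT // powR_mulrn ?ltW // -powR12_sqrt ?ltW //.
  rewrite powRN; field; rewrite gt_eqF // powR12_sqrt ?ltW //.
- move=> x y; rewrite !in_itv /= !andbT => cx cy xy.
  by rewrite ltr_sqrt // (lt_le_trans c20).
- move=> x; rewrite in_itv /= andbT => cx.
  have x0 := lt_trans c20 cx.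
  by rewrite /continuous_at dSE //; exact: cD.
- by apply/cvg_ex; exists (2 * Num.sqrt (c ^+ 2))^-1; apply: cvg_at_right_filter; exact: cD.
- apply/cvg_ex; exists 0 => /=.
  have : (2 * Num.sqrt x)^-1 @[x --> +oo] --> (0 : R).
    apply/gtr0_cvgV0.
      by near=> x; rewrite mulr_gt0 // sqrtr_gt0; near: x; exact: nbhs_pinfty_gt.
    apply/cvgryPge => A; near=> x.
    have x0 : 0 < x by near: x; exact: nbhs_pinfty_gt.
    have A1 : `|A| ^+ 2 <= x by near: x; apply: nbhs_pinfty_ge; rewrite num_real.
    apply: (le_trans (ler_norm _)); rewrite -[X in X <= _]sqrtr_sqr.
    by rewrite real_normK ?num_real // in A1; rewrite (le_trans (ler_wsqrtr A1)) // ler_peMl ?sqrtr_ge0 // ler1n.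
  apply: cvg_trans; apply: near_eq_cvg.
  by near=> x; rewrite dSE //; near: x; exact: nbhs_pinfty_gt.
- split.
    move=> x; rewrite in_itv /= andbT => cx.
    by have [] := dS x (lt_trans c20 cx).
  by apply: cvg_at_right_filter; exact: cS.
- apply/cvgryPge => A; near=> x.
  have A1 : `|A| ^+ 2 <= x by near: x; apply: nbhs_pinfty_ge; rewrite num_real.
  apply: (le_trans (ler_norm _)); rewrite -[X in X <= _]sqrtr_sqr.
  by rewrite real_normK ?num_real // in A1; rewrite (le_trans (ler_wsqrtr A1)).
- apply: continuous_subspaceT => x; apply: cvgM; first exact: cvg_cst.
  exact: continuous_gauss_fun.
- by move=> x _; rewrite mulr_ge0 // gauss_fun_even_ge0.
Unshelve. all: by end_near. Qed.

(** Both half-lines of the substitution increase to ]0, +oo[ when their left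
    endpoint tends to 0. *)
Lemma euler_gamma_half k :
  euler_gamma (k%:R + 2^-1 : R) = (k.*2)`!%:R / (4 ^+ k * k`!%:R) * Num.sqrt pi.
Proof.
rewrite /euler_gamma /Rintegral.
rewrite (_ : (\int[mu]_(t in _) _)%E = (\int[mu]_(x in `]0%R, +oo[) (2 * gauss_fun k.*2 x)%:E)%E).
  rewrite integral_itv_obnd_cbnd; last first.
    by apply/measurable_EFinP; apply: measurable_funTS; apply: measurable_funM => //; exact: measurable_gauss_fun.
  under eq_integral do rewrite EFinM.
  rewrite ge0_integralZl //=.
  - by rewrite gauss_moment -EFinM /=; field; rewrite expf_neq0 ?pnatr_eq0 //= -lt0n fact_gt0.
  - by apply/measurable_EFinP; apply: measurable_funTS; exact: measurable_gauss_fun.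
  - by move=> x _; rewrite lee_fin gauss_fun_even_ge0.
have mG : measurable_fun setT (fun t : R => t `^ (k%:R + 2^-1 - 1) * expR (- t)).
  by apply: measurable_funM; [exact: measurable_powR|exact: measurableT_comp].
have mQ : measurable_fun setT (fun x : R => 2 * gauss_fun k.*2 x).
  by apply: measurable_funM => //; exact: measurable_gauss_fun.
have /cvg_lim := @cvg_itv0y_integral 1 _ mG (fun x _ => mulr_ge0 (powR_ge0 _ _) (expR_ge0 _)).
move=> <- //; apply/cvg_lim => //.
have := @cvg_itv0y_integral 0 _ mQ (fun x _ => mulr_ge0 (ler0n _ _) (gauss_fun_even_ge0 _ _)).
apply: cvg_trans; apply: near_eq_cvg; near=> n.
rewrite expr1 gamma_integral_subst ?invr_gt0 ?ltr0n //.
by rewrite (_ : k%:R + 2^-1 - 1 = k%:R - 2^-1 :> R) //; field.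
Unshelve. all: by end_near. Qed.

End HalfInteger.

(** * Complex sequences and the exponential series *)

Section ComplexSequences.
Variable R : realType.
Local Notation C := R[i].
Implicit Types (u v : nat -> C) (a b z : C).

(** Convergence is taken on real and imaginary parts, as for the coordinates
    of Clifford-valued sequences. *)
Definition ccvg u a :=
  (fun n => complex.Re (u n)) @ \oo --> complex.Re a /\
  (fun n => complex.Im (u n)) @ \oo --> complex.Im a.

Lemma ReD a b : complex.Re (a + b) = complex.Re a + complex.Re b.
Proof. by case: a b => [? ?] [? ?]. Qed.
Lemma ImD a b : complex.Im (a + b) = complex.Im a + complex.Im b.
Proof. by case: a b => [? ?] [? ?]. Qed.
Lemma ReM a b : complex.Re (a * b) =
  complex.Re a * complex.Re b - complex.Im a * complex.Im b.
Proof. by case: a b => [? ?] [? ?]. Qed.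
Lemma ImM a b : complex.Im (a * b) =
  complex.Re a * complex.Im b + complex.Im a * complex.Re b.
Proof. by case: a b => [? ?] [? ?]. Qed.

Lemma Re_sum I (r : seq I) (P : pred I) (F : I -> C) :
  complex.Re (\sum_(i <- r | P i) F i) = \sum_(i <- r | P i) complex.Re (F i).
Proof. by elim/big_rec2: _ => // i x y _ <-; rewrite ReD. Qed.
Lemma Im_sum I (r : seq I) (P : pred I) (F : I -> C) :
  complex.Im (\sum_(i <- r | P i) F i) = \sum_(i <- r | P i) complex.Im (F i).
Proof. by elim/big_rec2: _ => // i x y _ <-; rewrite ImD. Qed.

Lemma ccvg_cst a : ccvg (fun=> a) a.
Proof. by split; exact: cvg_cst. Qed.

Lemma ccvgD u v a b : ccvg u a -> ccvg v b -> ccvg (fun n => u n + v n) (a + b).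
Proof.
by move=> [? ?] [? ?]; split; under eq_fun do rewrite ?ReD ?ImD;
  rewrite ?ReD ?ImD; apply: cvgD.
Qed.

Lemma ccvgM u v a b : ccvg u a -> ccvg v b -> ccvg (fun n => u n * v n) (a * b).
Proof.
move=> [? ?] [? ?]; split; under eq_fun do rewrite ?ReM ?ImM; rewrite ?ReM ?ImM.
  by apply: cvgB; apply: cvgM.
by apply: cvgD; apply: cvgM.
Qed.

Lemma ccvgMl a v b : ccvg v b -> ccvg (fun n => a * v n) (a * b).
Proof. by apply: ccvgM; exact: ccvg_cst. Qed.

Lemma ccvg_sum I (r : seq I) (P : pred I) (F : I -> nat -> C) (l : I -> C) :
  (forall i, P i -> ccvg (F i) (l i)) ->
  ccvg (fun n => \sum_(i <- r | P i) F i n) (\sum_(i <- r | P i) l i).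
Proof.
move=> H; elim: r => [|i r IH].
  by under eq_fun do rewrite big_nil; rewrite big_nil; exact: ccvg_cst.
under eq_fun do rewrite big_cons; rewrite big_cons.
by case: ifP => // Pi; apply: ccvgD => //; exact: H.
Qed.

Lemma ccvg_real (u : nat -> R) (l : R) : u @ \oo --> l ->
  ccvg (fun n => (u n)%:C%C) l%:C%C.
Proof. by move=> ul; split => //=; exact: cvg_cst. Qed.

Lemma ccvg_subseq u a (f : nat -> nat) : (f n @[n --> \oo] --> \oo) ->
  ccvg u a -> ccvg (u \o f) a.
Proof.
move=> f_oo [h1 h2].
by split; [apply: (cvg_comp f _ f_oo h1)|apply: (cvg_comp f _ f_oo h2)].
Qed.

Lemma ccvg_eq u a b : ccvg u a -> a = b -> ccvg u b.
Proof. by move=> ua <-. Qed.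

Lemma eq_ccvg u v a : u =1 v -> ccvg u a -> ccvg v a.
Proof. by move=> /funext ->. Qed.

Lemma normc_ge0 z : 0 <= normc z.
Proof. by case: z => x y; rewrite sqrtr_ge0. Qed.

Lemma normc_real (x : R) : normc x%:C%C = `|x|.
Proof. by rewrite /= expr0n addr0 sqrtr_sqr. Qed.

Lemma normc_nat n : normc (n%:R : C) = n%:R.
Proof. by rewrite -(rmorph_nat (real_complex R)) normc_real ger0_norm ?ler0n. Qed.

Lemma normc_i : normc ('i%C : C) = 1.
Proof. by rewrite /= expr0n expr1n add0r sqrtr1. Qed.

Lemma normcX z n : normc (z ^+ n) = normc z ^+ n.
Proof.
elim: n => [|n IH]; first by rewrite !expr0 (normc_nat 1).
by rewrite !exprS normcM IH.
Qed.

Lemma normc_sum I (r : seq I) (P : pred I) (F : I -> C) :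
  normc (\sum_(i <- r | P i) F i) <= \sum_(i <- r | P i) normc (F i).
Proof.
elim/big_rec2: _ => [|i x y _ H]; first by rewrite (normc_nat 0).
by apply: le_trans (le_normcD _ _) _; rewrite lerD2l.
Qed.

Lemma Re_le_normc z : `|complex.Re z| <= normc z.
Proof. by case: z => x y /=; rewrite -sqrtr_sqr ler_wsqrtr // lerDl sqr_ge0. Qed.
Lemma Im_le_normc z : `|complex.Im z| <= normc z.
Proof. by case: z => x y /=; rewrite -sqrtr_sqr ler_wsqrtr // lerDr sqr_ge0. Qed.

Lemma exp_term_complex (t : R) n :
  (('i%C * t%:C%C : C) ^+ n) / n`!%:R = Complex (cos_coeff t n) (sin_coeff t n).
Proof.
rewrite /cos_coeff /sin_coeff /=.
have E : ('i%C * t%:C%C : C) ^+ n =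
    Complex ((~~ odd n)%:R * (-1) ^+ n./2 * t ^+ n) ((odd n)%:R * (-1) ^+ n.-1./2 * t ^+ n).
  rewrite exprMn -rmorphXn /=.
  have -> : ('i%C : C) ^+ n =
     Complex ((~~ odd n)%:R * (-1) ^+ n./2) ((odd n)%:R * (-1) ^+ n.-1./2).
    rewrite -{1}(odd_double_half n) exprD -mul2n exprM sqr_i.
    have -> : (-1 : C) ^+ n./2 = ((-1) ^+ n./2 : R)%:C%C.
      by rewrite rmorphXn rmorphN1.
    case: (boolP (odd n)) => on /=.
      rewrite expr1 (_ : n.-1./2 = n./2); last first.
        by rewrite -{1}(odd_double_half n) on add1n /= doubleK.
      by apply/eqP; rewrite eq_complex /= ?(mul0r,mul1r,mulr0,subr0,sub0r,oppr0,addr0,add0r) !eqxx.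
    by rewrite expr0 !mul1r mul0r.
  by apply/eqP; rewrite eq_complex /= !mulr0 ?subr0 ?oppr0 ?addr0 ?add0r !eqxx.
rewrite E -(rmorph_nat (real_complex R)) -fmorphV.
by apply/eqP; rewrite eq_complex /= !mulr0 ?subr0 ?oppr0 ?addr0 ?add0r !eqxx.
Qed.

Lemma cvg_expi (t : R) :
  ccvg (fun M => \sum_(0 <= n < M) ('i%C * t%:C%C) ^+ n / n`!%:R) (expi t).
Proof.
split.
  have -> : (fun M => complex.Re (\sum_(0 <= n < M) ('i%C * t%:C%C) ^+ n / n`!%:R))
      = series (cos_coeff t).
    by apply/funext => M; rewrite Re_sum; apply: eq_bigr => n _; rewrite exp_term_complex.
  by rewrite /expi /= trigo.cos.unlock; exact: is_cvg_series_cos_coeff.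
have -> : (fun M => complex.Im (\sum_(0 <= n < M) ('i%C * t%:C%C) ^+ n / n`!%:R))
    = series (sin_coeff t).
  by apply/funext => M; rewrite Im_sum; apply: eq_bigr => n _; rewrite exp_term_complex.
by rewrite /expi /= trigo.sin.unlock; exact: is_cvg_series_sin_coeff.
Qed.

Lemma expR_partial_le (x : R) M : 0 <= x ->
  \sum_(0 <= n < M) x ^+ n / n`!%:R <= expR x.
Proof.
move=> x0; apply: (nondecreasing_cvgn_le _ (is_cvg_series_exp_coeff x) M).
apply: nondecreasing_series => n _ _; exact: exp_coeff_ge0.
Qed.

Lemma normc_exp_partial (t : R) M :
  normc (\sum_(0 <= n < M) ('i%C * t%:C%C) ^+ n / n`!%:R : C) <= expR `|t|.
Proof.
apply: le_trans (normc_sum _ _ _) _.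
apply: le_trans (expR_partial_le M (normr_ge0 t)).
apply: ler_sum => n _.
by rewrite normcM normcX normcM normc_i mul1r normc_real normcV normc_nat.
Qed.

Lemma expiD (s t : R) : expi (s + t) = expi s * expi t.
Proof.
by apply/eqP; rewrite /expi eq_complex /= cosD sinD; apply/andP; split; apply/eqP; ring.
Qed.

End ComplexSequences.

(** * Dominated convergence for double series *)

Section Tannery.
Variable R : realType.

Lemma sum_indicator (F : nat -> R) L M : (L <= M)%N ->
  \sum_(0 <= i < M) (i < L)%N%:R * F i = \sum_(0 <= i < L) F i.
Proof.
move=> LM; rewrite (@big_cat_nat _ _ _ L) //= [X in _ + X]big1_seq ?addr0.
  by apply: eq_big_nat => i /andP[_ iL]; rewrite iL mul1r.
by move=> i; rewrite mem_index_iota => /andP[_ /andP[Li _]]; rewrite ltnNge Li mul0r.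
Qed.

Lemma sum_square_sub (x : nat -> nat -> R) L M : (L <= M)%N ->
  \sum_(0 <= i < M) \sum_(0 <= j < M) x i j - \sum_(0 <= i < L) \sum_(0 <= j < L) x i j =
  \sum_(0 <= i < M) \sum_(0 <= j < M) (~~ ((i < L) && (j < L))%N)%:R * x i j.
Proof.
move=> LM; rewrite -(sum_indicator (fun i => \sum_(0 <= j < L) x i j) LM).
rewrite -sumrB; apply: eq_bigr => i _.
rewrite -(sum_indicator (fun j => x i j) LM) mulr_sumr -sumrB; apply: eq_bigr => j _.
by case: (i < L)%N; case: (j < L)%N; rewrite /= ?mul1r ?mul0r ?subrr ?subr0.
Qed.

(** Outside a large square [0, L[ x [0, L[ both double sums are at most a tail
    of the convergent double series of bounds, and inside it there are finitely
    many terms. *)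
Lemma tannery (b : nat -> nat -> nat -> R) (A : nat -> nat -> R) (B B' : nat -> R) (S : R) :
  (forall i j, (fun M => b M i j) @ \oo --> A i j) ->
  (forall M i j, `|b M i j| <= B i * B' j) ->
  cvgn (series B) -> cvgn (series B') ->
  (fun L => \sum_(0 <= i < L) \sum_(0 <= j < L) A i j) @ \oo --> S ->
  (fun M => \sum_(0 <= i < M) \sum_(0 <= j < M) b M i j) @ \oo --> S.
Proof.
move=> bA bB cB cB' AS.
pose T L := \sum_(0 <= i < L) \sum_(0 <= j < L) (B i * B' j).
have TE : T = fun L => series B L * series B' L.
  by apply/funext => L; rewrite /T /series /= big_distrl /=; apply: eq_bigr => i _; rewrite big_distrr.
have cT : cvgn T.
  rewrite TE; apply/cvg_ex; exists (limn (series B) * limn (series B')).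
  by apply: cvgM.
apply/cvgrPdist_lt => e e0.
have e3 : 0 < e / 3 by rewrite divr_gt0.
have e6 : 0 < e / 6 by rewrite divr_gt0.
have /cvgrPdist_lt/(_ _ e3) [L1 _ HL1] := AS.
have /cvgrPdist_lt/(_ _ e6) [L2 _ HL2] := cT.
pose L := maxn L1 L2.
have HS := HL1 L (leq_maxl _ _).
have bL : (fun M => \sum_(0 <= i < L) \sum_(0 <= j < L) b M i j) @ \oo -->
    \sum_(0 <= i < L) \sum_(0 <= j < L) A i j.
  have cs (F : nat -> nat -> R) (l : nat -> R) : (forall i, F i @ \oo --> l i) ->
      (fun M => \sum_(0 <= i < L) F i M) @ \oo --> \sum_(0 <= i < L) l i.
    move=> Fl; elim: L {HS} => [|k IH].
      by under eq_fun do rewrite big_geq //; rewrite big_geq //; exact: cvg_cst.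
    under eq_fun do rewrite big_nat_recr //=; rewrite big_nat_recr //=.
    by apply: cvgD.
  by apply: (cs _ _ _) => i; apply: (cs _ _ _).
have /cvgrPdist_lt/(_ _ e3) [M1 _ HM1] := bL.
exists (maxn L M1) => // M; rewrite /= geq_max => /andP[LM M1M].
have HM := HM1 M M1M.
have D : `|\sum_(0 <= i < M) \sum_(0 <= j < M) b M i j -
           \sum_(0 <= i < L) \sum_(0 <= j < L) b M i j| <= T M - T L.
  rewrite /T !sum_square_sub //.
  apply: le_trans (ler_norm_sum _ _ _) _; apply: ler_sum => i _.
  apply: le_trans (ler_norm_sum _ _ _) _; apply: ler_sum => j _.
  by rewrite normrM normr_nat ler_wpM2l // ler0n.
have DM := HL2 M (leq_trans (leq_maxr _ _) LM).
have DL := HL2 L (leq_maxr _ _).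
rewrite /= in HS HM DM DL *.
move: HS HM DM DL D; rewrite !ltr_norml !ler_norml.
move=> /andP[? ?] /andP[? ?] /andP[? ?] /andP[? ?] /andP[? ?].
apply/andP; split; lra.
Qed.

Local Notation C := R[i].

Lemma ctannery (b : nat -> nat -> nat -> C) (A : nat -> nat -> C) (B B' : nat -> R) (S : C) :
  (forall i j, ccvg (fun M => b M i j) (A i j)) ->
  (forall M i j, normc (b M i j) <= B i * B' j) ->
  cvgn (series B) -> cvgn (series B') ->
  ccvg (fun L => \sum_(0 <= i < L) \sum_(0 <= j < L) A i j) S ->
  ccvg (fun M => \sum_(0 <= i < M) \sum_(0 <= j < M) b M i j) S.
Proof.
move=> bA bB cB cB' [S1 S2]; split.
  under eq_fun do rewrite Re_sum; under eq_fun do under eq_bigr do rewrite Re_sum.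
  apply: (@tannery _ (fun i j => complex.Re (A i j)) B B') => //.
  - by move=> i j; have [] := bA i j.
  - by move=> M i j; apply: le_trans (Re_le_normc _) (bB _ _ _).
  - move: S1; under eq_fun do rewrite Re_sum.
    by under eq_fun do under eq_bigr do rewrite Re_sum.
under eq_fun do rewrite Im_sum; under eq_fun do under eq_bigr do rewrite Im_sum.
apply: (@tannery _ (fun i j => complex.Im (A i j)) B B') => //.
- by move=> i j; have [] := bA i j.
- by move=> M i j; apply: le_trans (Im_le_normc _) (bB _ _ _).
- move: S2; under eq_fun do rewrite Im_sum.
  by under eq_fun do under eq_bigr do rewrite Im_sum.
Qed.

End Tannery.

(** * The action of Gamma on pairs of polynomials *)

Section RadialAlgebra.
Variable K : comNzRingType.
Variables (del eps r2 : K).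
Implicit Types (f h : {poly K}) (p : {poly K} * {poly K}).

(** When eps = 1 / del, this is eps times the derivative d/du conjugated by
    e^{del u}. *)
Definition id_plus_D f := f + eps%:P * f^`().

(** A pair (f, h) stands for the function e^{del u} (f(u) + X h(u)), where
    X^2 = u^2 - r2; the operator is Gamma in dimension 2 nu + 2, the factor
    e^{del u} replacing d/du by d/du + del. *)
Definition Gamma_pair (nu : nat) p : {poly K} * {poly K} :=
  (nu.*2.+1%:R * 'X * p.2 + ('X^2 - r2%:P) * (p.2^`() + del%:P * p.2),
   p.1^`() + del%:P * p.1 + nu.*2%:R * p.2).

(** The off-diagonal term - eps h is the one for which 1 + eps d/du exchanges
    the operators Gamma_pair of two consecutive even dimensions
    (Gamma_pair_raise). *)
Definition raise_dim p : {poly K} * {poly K} := (id_plus_D p.1 - eps%:P * p.2, id_plus_D p.2).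

Lemma id_plus_D_add : {morph id_plus_D : f h / f + h}.
Proof. by move=> f h; rewrite /id_plus_D derivD; ring. Qed.

Lemma id_plus_D_scale c : {morph id_plus_D : f / c%:P * f}.
Proof. by move=> f; rewrite /id_plus_D derivM derivC; ring. Qed.

Lemma id_plus_D1 : id_plus_D 1 = 1.
Proof. by rewrite /id_plus_D derivC mulr0 addr0. Qed.

Lemma raise_dim_add : {morph raise_dim : p q / p + q}.
Proof.
by move=> [f h] [f' h']; rewrite /raise_dim /= !id_plus_D_add; congr pair; rewrite /=; ring.
Qed.

(** Both sides are first order expressions in f, h and their derivatives, and
    the terms where eps is applied to del collapse by eps del = 1; this
    collapse is what makes the dimension go up by exactly two at the cost of
    the shift by 1. *)
Lemma Gamma_pair_raise nu p : eps * del = 1 -> Gamma_pair nu.+1 (raise_dim p) = raise_dim (Gamma_pair nu p + p).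
Proof.
move=> /(congr1 (@polyC K)); rewrite polyCM => E; case: p => f h.
rewrite /Gamma_pair /raise_dim /id_plus_D /=.
rewrite !(derivD, derivB, derivM, derivC, derivX, derivXn, derivN, deriv0) /=.
have H1 : nu.*2.+1%:R = nu.*2%:R + 1 :> {poly K} by rewrite natr1.
have H2 : nu.+1.*2.+1%:R = nu.*2%:R + 3 :> {poly K} by rewrite doubleS -addn3 natrD.
have H3 : nu.+1.*2%:R = nu.*2%:R + 2 :> {poly K} by rewrite doubleS -addn2 natrD.
have dn n : (n%:R : {poly K})^`() = 0 by rewrite -polyC_natr derivC.
rewrite H1 H2 H3 !derivD !dn !derivC.
congr pair; rewrite /= ?mulr2n ?expr1.
  apply/eqP; rewrite -subr_eq0; apply/eqP.
  by ring: E.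
by ring: E.
Qed.

Lemma Gamma_pair_iter_raise nu p : eps * del = 1 ->
  Gamma_pair nu (iter nu raise_dim p) = iter nu raise_dim (Gamma_pair 0 p + p *+ nu).
Proof.
move=> E; elim: nu => [|nu IH]; first by rewrite mulr0n addr0.
rewrite /= Gamma_pair_raise // IH; congr raise_dim; rewrite mulrSr addrA.
move: (Gamma_pair 0 p + _) => q; have D a b : iter nu raise_dim (a + b) = iter nu raise_dim a + iter nu raise_dim b.
  by elim: nu {IH} => //= nu ->; rewrite raise_dim_add.
by rewrite D.
Qed.

Lemma iter_Gamma_pair_raise nu n p : eps * del = 1 ->
  iter n (Gamma_pair nu) (iter nu raise_dim p) = iter nu raise_dim (iter n (fun q => Gamma_pair 0 q + q *+ nu) p).
Proof. by move=> E; elim: n => //= n ->; rewrite Gamma_pair_iter_raise. Qed.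

(** raise_dim is triangular with equal diagonal entries id_plus_D and
    nilpotent off-diagonal part - eps, so its powers contain the latter at
    most once; the resulting factor nu is the (m - 2) / 2 in front of the sum
    A of the kernel. *)
Lemma iter_raise_dim nu p : iter nu raise_dim p =
  (iter nu id_plus_D p.1 - nu%:R * eps%:P * iter nu.-1 id_plus_D p.2, iter nu id_plus_D p.2).
Proof.
elim: nu => [|nu IH]; first by case: p => f h; rewrite /= !mul0r subr0.
rewrite [LHS]/= IH /raise_dim /=; congr pair.
have DN f h : id_plus_D (f - h) = id_plus_D f - id_plus_D h by rewrite /id_plus_D derivB; ring.
rewrite DN -polyC_natr -polyCM id_plus_D_scale polyCM polyC_natr.
case: nu {IH} => [|nu] /=; first by rewrite mul1r !mul0r subr0.
by rewrite -[in RHS]natr1 /=; ring.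
Qed.

Lemma iter_id_plus_D1 nu : iter nu id_plus_D 1 = 1.
Proof. by elim: nu => //= nu ->; exact: id_plus_D1. Qed.

Lemma iter_id_plus_D0 nu : iter nu id_plus_D 0 = 0.
Proof. by elim: nu => //= nu ->; rewrite /id_plus_D deriv0 mulr0 addr0. Qed.

Lemma iter_raise_dim1 nu : iter nu raise_dim (1, 0) = (1, 0).
Proof. by rewrite iter_raise_dim /= iter_id_plus_D1 !iter_id_plus_D0 mulr0 subr0. Qed.

(** The binomial formula for (1 + eps d/du)^nu. *)
Lemma iter_id_plus_DE nu f :
  iter nu id_plus_D f = \sum_(l < nu.+1) ('C(nu, l)%:R * eps ^+ l)%:P * f^`(l).
Proof.
elim: nu => [|nu IH].
  by rewrite big_ord1 bin0 expr0 mulr1 polyC1 mul1r.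
rewrite [LHS]/= IH /id_plus_D linear_sum /= mulr_sumr.
rewrite big_ord_recl bin0 expr0 mulr1 polyC1 mul1r derivn0.
rewrite [RHS]big_ord_recl bin0 expr0 mulr1 polyC1 mul1r derivn0 -addrA; congr (_ + _).
under [RHS]eq_bigr do rewrite lift0 binS natrD mulrDl polyCD mulrDl.
rewrite [RHS]big_split /= [X in _ = X + _]big_ord_recr /= bin_small // mul0r polyC0 mul0r addr0.
congr (_ + _); apply: eq_bigr => l _.
by rewrite derivM derivC mul0r add0r exprS !polyCM -?derivnS; ring.
Qed.

(** The pair representing u^i X^j, as X^2 = u^2 - r2. *)
Definition pair_mon (i j : nat) : {poly K} * {poly K} :=
  let g : {poly K} := ('X^i * ('X^2 - r2%:P) ^+ j./2)%R in if odd j then (0, g) else (g, 0).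

Lemma deriv_quadratic_mon i k : ('X^i * ('X^2 - r2%:P) ^+ k : {poly K})^`() =
  i%:R * ('X^(i.-1) * ('X^2 - r2%:P) ^+ k) +
  k.*2%:R * ('X^(i.+1) * ('X^2 - r2%:P) ^+ k.-1).
Proof.
rewrite derivM derivXn.
have -> : (('X^2 - r2%:P) ^+ k)^`() = k.*2%:R * 'X * ('X^2 - r2%:P) ^+ k.-1 :> {poly K}.
  elim: k => [|k IH]; first by rewrite !mul0r; exact: derivC.
  rewrite [_ ^+ k.+1]exprS derivM IH derivB derivXn derivC subr0 mulr2n expr1.
  rewrite (_ : k.+1.*2%:R = k.*2%:R + 2); last by rewrite doubleS -addn2 natrD.
  set Q := 'X^2 - r2%:P; case: k {IH} => [|k] /=; first by rewrite ?mul0r ?double0 expr0; ring.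
  by rewrite [Q ^+ k.+1]exprS; ring.
by rewrite -mulr_natl ['X^(i.+1)]exprSr; ring.
Qed.

(** In dimension two Gamma is the derivation with u |-> X and X |-> u, and the
    factor e^{del u} adds the multiplication by del X. *)
Lemma Gamma_pair_mon i j : Gamma_pair 0 (pair_mon i j) =
  i%:R *: pair_mon i.-1 j.+1 + j%:R *: pair_mon i.+1 j.-1 + del *: pair_mon i j.+1.
Proof.
have natZ n f : (n%:R : K) *: f = n%:R * f by rewrite -mul_polyC polyC_natr.
have pairZ c p : c *: p = (c *: p.1, c *: p.2) by [].
have pairD p q : p + q = (p.1 + q.1, p.2 + q.2) by [].
rewrite -(odd_double_half j); set k := j./2; case: (odd j) => /=.
  rewrite /Gamma_pair /pair_mon double0 !add1n /= odd_double /= !uphalf_double !doubleK !pairZ !pairD /=.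
  rewrite !scaler0 deriv0 !natZ -!mul_polyC deriv_quadratic_mon; congr pair; last by ring.
  rewrite (_ : k.*2.+1%:R = k.*2%:R + 1); last by rewrite natr1.
  set Q := 'X^2 - r2%:P; case: k => [|k] /=.
    by rewrite double0 expr0 [Q ^+ 1]expr1 ['X^(i.+1)]exprS; ring.
  by rewrite [Q ^+ k.+2]exprS [Q ^+ k.+1]exprS ['X^(i.+1)]exprS; ring.
rewrite !add0n /Gamma_pair /pair_mon double0 /= odd_double /= !uphalf_double !doubleK !pairZ !pairD /=.
rewrite !scaler0 deriv0 !natZ -!mul_polyC deriv_quadratic_mon.
case: k => [|k] /=; first by rewrite double0 !mul0r ?scaler0; congr pair; rewrite /=; ring.
rewrite odd_double /= uphalf_double.
by congr pair; rewrite /= ?scaler0; ring.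
Qed.

Lemma sum_shift (V : nmodType) M (H : nat -> V) : H M = 0 ->
  \sum_(0 <= i < M.+1) (if i is i'.+1 then H i' else 0) = \sum_(0 <= i < M.+1) H i.
Proof.
by move=> H0; rewrite big_nat_recl // add0r big_nat_recr //= H0 addr0.
Qed.

(** The transpose of Gamma_pair 0 + N on the coefficients of the monomials
    u^i X^j. *)
Definition moment_step N (z : nat -> nat -> K) i j :=
  N%:R * z i j + (if j is j'.+1 then i.+1%:R * z i.+1 j' else 0) +
  (if i is i'.+1 then j.+1%:R * z i' j.+1 else 0) +
  (if j is j'.+1 then del * z i j' else 0).

Definition pair_sum M (z : nat -> nat -> K) :=
  \sum_(0 <= i < M) \sum_(0 <= j < M) z i j *: pair_mon i j.

Lemma Gamma_pair_add nu : {morph Gamma_pair nu : p q / p + q}.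
Proof.
by move=> [f h] [f' h']; rewrite /Gamma_pair /= !derivD; congr pair; rewrite /=; ring.
Qed.

Lemma Gamma_pair_scale nu c : {morph Gamma_pair nu : p / c *: p}.
Proof.
by move=> [f h]; rewrite /Gamma_pair /= !derivZ -!mul_polyC; congr pair; rewrite /= -!mul_polyC; ring.
Qed.

Lemma Gamma_pair_big nu I (r : seq I) (F : I -> {poly K} * {poly K}) :
  Gamma_pair nu (\sum_(i <- r) F i) = \sum_(i <- r) Gamma_pair nu (F i).
Proof.
elim/big_rec2: _ => [|i x y _ <-]; last by rewrite Gamma_pair_add.
by rewrite -[0 in LHS](scale0r (0 : {poly K} * {poly K})) Gamma_pair_scale scale0r.
Qed.

(** The three terms of Gamma_pair_mon are brought back to the monomial
    u^i X^j by index shifts; as the coefficients vanish for i + j > n, the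
    truncation at M > n + 1 loses nothing. *)
Lemma Gamma_pair_sum N n M z : (forall i j, (n < i + j)%N -> z i j = 0) -> (n.+1 < M)%N ->
  Gamma_pair 0 (pair_sum M z) + pair_sum M z *+ N = pair_sum M (moment_step N z).
Proof.
case: M => // M z0; rewrite ltnS => nM.
have zM i : z i M = 0 by apply: z0; rewrite (leq_trans nM) // leq_addl.
have zMl j : z M j = 0 by apply: z0; rewrite (leq_trans nM) // leq_addr.
rewrite Gamma_pair_big; under eq_bigr do rewrite Gamma_pair_big.
under eq_bigr do under eq_bigr do rewrite Gamma_pair_scale Gamma_pair_mon !scalerDr !scalerA.
pose T1 i j := (if j is j'.+1 then (i.+1%:R * z i.+1 j') *: pair_mon i j else 0).
pose T2 i j := (if i is i'.+1 then (j.+1%:R * z i' j.+1) *: pair_mon i j else 0).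
pose T3 i j := (if j is j'.+1 then (del * z i j') *: pair_mon i j else 0).
have E1 : \sum_(0 <= i < M.+1) \sum_(0 <= j < M.+1) (z i j * i%:R) *: pair_mon i.-1 j.+1 =
    \sum_(0 <= i < M.+1) \sum_(0 <= j < M.+1) T1 i j.
  pose H i := \sum_(0 <= j < M.+1) (z i.+1 j * i.+1%:R) *: pair_mon i j.+1.
  transitivity (\sum_(0 <= i < M.+1) if i is i'.+1 then H i' else 0).
    apply: eq_bigr => -[|i] _ //.
    by rewrite big1 // => j _; rewrite mulr0 scale0r.
  rewrite sum_shift; last first.
    rewrite /H big1 // => j _.
    by rewrite z0 ?mul0r ?scale0r // (leq_trans nM) // addSn ltnW // ltnS leq_addr.
  apply: eq_bigr => i _; rewrite /H.
  rewrite -(@sum_shift _ M (fun j => (z i.+1 j * i.+1%:R) *: pair_mon i j.+1)); last first.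
    by rewrite zM mul0r scale0r.
  by apply: eq_bigr => -[|j] _ //; rewrite /T1 mulrC.
have E2 : \sum_(0 <= i < M.+1) \sum_(0 <= j < M.+1) (z i j * j%:R) *: pair_mon i.+1 j.-1 =
    \sum_(0 <= i < M.+1) \sum_(0 <= j < M.+1) T2 i j.
  rewrite exchange_big [RHS]exchange_big /=.
  pose H j := \sum_(0 <= i < M.+1) (z i j.+1 * j.+1%:R) *: pair_mon i.+1 j.
  transitivity (\sum_(0 <= j < M.+1) if j is j'.+1 then H j' else 0).
    apply: eq_bigr => -[|j] _ //.
    by rewrite big1 // => i _; rewrite mulr0 scale0r.
  rewrite sum_shift; last first.
    rewrite /H big1 // => i _.
    by rewrite z0 ?mul0r ?scale0r // (leq_trans nM) // addnS ltnW // ltnS leq_addl.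
  apply: eq_bigr => j _; rewrite /H.
  rewrite -(@sum_shift _ M (fun i => (z i j.+1 * j.+1%:R) *: pair_mon i.+1 j)); last first.
    by rewrite zMl mul0r scale0r.
  by apply: eq_bigr => -[|i] _ //; rewrite /T2 mulrC.
have E3 : \sum_(0 <= i < M.+1) \sum_(0 <= j < M.+1) (z i j * del) *: pair_mon i j.+1 =
    \sum_(0 <= i < M.+1) \sum_(0 <= j < M.+1) T3 i j.
  apply: eq_bigr => i _.
  rewrite -(@sum_shift _ M (fun j => (z i j * del) *: pair_mon i j.+1)); last first.
    by rewrite zM mul0r scale0r.
  by apply: eq_bigr => -[|j] _ //; rewrite /T3 mulrC.
have E4 : pair_sum M.+1 z *+ N =
    \sum_(0 <= i < M.+1) \sum_(0 <= j < M.+1) (N%:R * z i j) *: pair_mon i j.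
  rewrite -sumrMnl; apply: eq_bigr => i _; rewrite -sumrMnl; apply: eq_bigr => j _.
  by rewrite scalerMnl mulr_natl.
under eq_bigr do rewrite !big_split /=; rewrite !big_split /= E1 E2 E3 E4.
rewrite -!big_split /=; apply: eq_bigr => i _; rewrite -!big_split /=.
apply: eq_bigr => j _; rewrite /moment_step !scalerDl /T1 /T2 /T3.
have -> : (if j is j'.+1 then (i.+1%:R * z i.+1 j') *: pair_mon i j else 0) =
  (if j is j'.+1 then i.+1%:R * z i.+1 j' else 0) *: pair_mon i j by case: j => [|j]; rewrite ?scale0r.
have -> : (if i is i'.+1 then (j.+1%:R * z i' j.+1) *: pair_mon i j else 0) =
  (if i is i'.+1 then j.+1%:R * z i' j.+1 else 0) *: pair_mon i j by case: i => [|i]; rewrite ?scale0r.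
have -> : (if j is j'.+1 then (del * z i j') *: pair_mon i j else 0) =
  (if j is j'.+1 then del * z i j' else 0) *: pair_mon i j by case: j => [|j]; rewrite ?scale0r.
by rewrite addrC !addrA.
Qed.

Lemma iter_Gamma_pair_sum N n M (z : nat -> nat -> nat -> K) :
  (forall i j, z 0%N i j = ((i == 0%N) && (j == 0%N))%:R) ->
  (forall n i j, z n.+1 i j = moment_step N (z n) i j) ->
  (forall n i j, (n < i + j)%N -> z n i j = 0) -> (n < M)%N ->
  iter n (fun q => Gamma_pair 0 q + q *+ N) (1, 0) = pair_sum M (z n).
Proof.
move=> zE zS z0; elim: n => [|n IH] nM.
  case: M nM => // M _; rewrite /pair_sum big_nat_recl // big_nat_recl //.
  rewrite big1 => [|j _]; last by rewrite zE scale0r.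
  rewrite big1 => [|i _]; last by rewrite big1 // => j _; rewrite zE scale0r.
  by rewrite zE scale1r /pair_mon /= !expr0 mul1r !addr0.
rewrite [LHS]/= IH ?(ltnW nM) // (@Gamma_pair_sum N n) //; last exact: z0.
by apply: eq_bigr => i _; apply: eq_bigr => j _; rewrite zS.
Qed.

End RadialAlgebra.

Section Specialization.
Variables (K L : comNzRingType) (f : {rmorphism K -> L}) (del eps r2 : K).

Definition map_pair (p : {poly K} * {poly K}) := (map_poly f p.1, map_poly f p.2).

Lemma map_Gamma_pair nu p : map_pair (Gamma_pair del r2 nu p) = Gamma_pair (f del) (f r2) nu (map_pair p).
Proof.
rewrite /Gamma_pair /map_pair /=.
congr pair; rewrite !(rmorphD, rmorphM, rmorphB, rmorph_nat) /= ?rmorphN /= ?map_polyX ?map_polyC ?deriv_map //.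
Qed.

Lemma map_iter_Gamma_pair nu n p :
  map_pair (iter n (Gamma_pair del r2 nu) p) = iter n (Gamma_pair (f del) (f r2) nu) (map_pair p).
Proof. by elim: n => //= n <-; rewrite map_Gamma_pair. Qed.

End Specialization.

Lemma map_pair_horner (K : comNzRingType) (w : K) (F : {poly {poly K}}) u :
  (map_poly (horner_eval w) F).[u] = F.[u%:P].[w].
Proof.
have -> : u = horner_eval w u%:P by rewrite /horner_eval hornerC.
by rewrite horner_map /horner_eval hornerC.
Qed.

(** The iterates can be computed with r2 = |x|^2 |y|^2 as an indeterminate,
    which is needed to differentiate them, or as a number, which is needed to
    sum the series; here the two computations are compared. *)
Lemma iter_Gamma_pair_horner (K : comNzRingType) (d w u : K) N n :
  let p := iter n (Gamma_pair d%:P 'X N) (1, 0) in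
  let q := iter n (Gamma_pair d w N) (1, 0) in
  p.1.[u%:P].[w] = q.1.[u] /\ p.2.[u%:P].[w] = q.2.[u].
Proof.
have := map_iter_Gamma_pair (horner_eval w) d%:P 'X N n (1, 0).
have -> : map_pair (horner_eval w) ((1, 0) : {poly {poly K}} * {poly {poly K}}) = (1, 0).
  by rewrite /map_pair /= rmorph1 rmorph0.
set d' := GRing.RMorphism.sort _ d%:P; have -> : d' = d by exact: hornerC.
set w' := GRing.RMorphism.sort _ 'X; have -> : w' = w by exact: hornerX.
move=> E p q.
by rewrite /q -E /map_pair /= !map_pair_horner.
Qed.

(** * Euler moments of polynomials *)

Local Arguments ComplexField.Normc.normc : simpl never.

Section EulerMoments.
Variable R : realType.
Local Notation C := R[i].
Implicit Types (q : {poly C}) (e : R).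

(** This is the value at z = 1 of (z d/dz)^n (z^e q(z)). *)
Definition euler_moment e n q : C := \sum_(k < size q) q`_k * ((k%:R + e) ^+ n)%:C%C.

Lemma euler_momentE m e n q : (size q <= m)%N ->
  euler_moment e n q = \sum_(k < m) q`_k * ((k%:R + e) ^+ n)%:C%C.
Proof.
move=> qm; rewrite /euler_moment (big_ord_widen m (fun k => q`_k * ((k%:R + e) ^+ n)%:C%C)) //.
rewrite big_mkcond; apply: eq_bigr => k _; case: ltnP => // ?.
by rewrite nth_default // mul0r.
Qed.

Lemma euler_momentD e n q q' : euler_moment e n (q + q') = euler_moment e n q + euler_moment e n q'.
Proof.
set m := maxn (size q) (size q').
rewrite !(@euler_momentE m) ?leq_maxl ?leq_maxr ?size_polyD // -big_split /=.
by apply: eq_bigr => k _; rewrite coefD mulrDl.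
Qed.

Lemma euler_momentZ e n c q : euler_moment e n (c *: q) = c * euler_moment e n q.
Proof.
rewrite (@euler_momentE (size q) _ _ (c *: q)) ?size_scale_leq // /euler_moment mulr_sumr.
by apply: eq_bigr => k _; rewrite coefZ mulrA.
Qed.

Lemma euler_moment0 e q : euler_moment e 0 q = q.[1].
Proof.
rewrite horner_coef; apply: eq_bigr => k _.
by rewrite !expr0 expr1n !mulr1.
Qed.

Lemma euler_momentS e n q : euler_moment e n.+1 q = euler_moment e n ('X * q^`() + e%:C%C *: q).
Proof.
have s : (size ('X * q^`() + e%:C%C *: q)%R <= size q)%N.
  apply: leq_trans (size_polyD _ _) _; rewrite geq_max size_scale_leq andbT.
  have [->|q0] := eqVneq q 0; first by rewrite deriv0 mulr0 size_poly0.
  rewrite mulrC; apply: leq_trans (size_polyMleq _ _) _; rewrite size_polyX addn2 /=.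
  by rewrite lt_size_deriv.
rewrite (euler_momentE _ _ s) /euler_moment; apply: eq_bigr => k _.
rewrite coefD coefZ ['X * _]mulrC coefMX coef_deriv exprSr rmorphM rmorphD /= rmorph_nat.
case: k => -[|k] _ /=; first by rewrite !add0r; ring.
by rewrite -[q`_k.+1 *+ k.+1]mulr_natr; ring.
Qed.

Lemma euler_momentX e n q : euler_moment e n ('X * q) = euler_moment (e + 1) n q.
Proof.
have s : (size ('X * q)%R <= (size q).+1)%N.
  by apply: leq_trans (size_polyMleq _ _) _; rewrite size_polyX.
rewrite (euler_momentE _ _ s) big_ord_recl ['X * _]mulrC coefMX /= mul0r add0r /euler_moment.
apply: eq_bigr => k _; rewrite /bump leq0n add1n coefMX /=.
by rewrite -natr1 -addrA (addrC 1 e).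
Qed.

Definition pnorm q : R := \sum_(k < size q) normc q`_k.

Lemma pnormE m q : (size q <= m)%N -> pnorm q = \sum_(k < m) normc q`_k.
Proof.
move=> qm; rewrite /pnorm (big_ord_widen m (fun k => normc q`_k)) //.
rewrite big_mkcond; apply: eq_bigr => k _; case: ltnP => // ?.
by rewrite nth_default // (normc_nat _ 0).
Qed.

Lemma pnorm_ge0 q : 0 <= pnorm q.
Proof. by apply: sumr_ge0 => k _; exact: normc_ge0. Qed.

Lemma pnormZ c q : pnorm (c *: q) = normc c * pnorm q.
Proof.
rewrite (@pnormE (size q) (c *: q)) ?size_scale_leq // /pnorm mulr_sumr.
by apply: eq_bigr => k _; rewrite coefZ normcM.
Qed.

Lemma pnormC c : pnorm c%:P = normc c.
Proof. by rewrite (@pnormE 1) ?size_polyC_leq1 // big_ord1 coefC. Qed.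

Lemma pnormD q q' : pnorm (q + q') <= pnorm q + pnorm q'.
Proof.
set m := maxn (size q) (size q').
rewrite !(@pnormE m) ?leq_maxl ?leq_maxr ?size_polyD // -big_split /=.
by apply: ler_sum => k _; rewrite coefD le_normcD.
Qed.

Lemma pnormX q : pnorm ('X * q) = pnorm q.
Proof.
have s : (size ('X * q)%R <= (size q).+1)%N.
  by apply: leq_trans (size_polyMleq _ _) _; rewrite size_polyX.
rewrite (pnormE s) big_ord_recl ['X * _]mulrC coefMX /= (normc_nat _ 0) add0r /pnorm.
by apply: eq_bigr => k _; rewrite coefMX.
Qed.

Lemma pnormM q q' : pnorm (q * q') <= pnorm q * pnorm q'.
Proof.
elim/poly_ind: q => [|q c IH].
  by rewrite !mul0r /pnorm size_poly0 big_ord0 mul0r.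
have -> : pnorm (q * 'X + c%:P) = pnorm q + normc c.
  have s : (size (q * 'X + c%:P)%R <= (size q).+1)%N.
    by rewrite size_MXaddC; case: ifP.
  rewrite (pnormE s) big_ord_recl addrC /pnorm; congr (_ + _).
    by apply: eq_bigr => k _; rewrite coefD coefMX coefC /= addr0.
  by rewrite coefD coefMX coefC /= add0r.
have -> : (q * 'X + c%:P) * q' = 'X * (q * q') + c *: q'.
  by rewrite -mul_polyC; ring.
apply: le_trans (pnormD _ _) _; rewrite pnormX pnormZ mulrDl.
by rewrite lerD2r.
Qed.

Lemma pnormXn q n B : pnorm q <= B -> pnorm (q ^+ n) <= B ^+ n.
Proof.
move=> qB; elim: n => [|n IH]; first by rewrite !expr0 pnormC (normc_nat _ 1).
rewrite !exprS; apply: le_trans (pnormM _ _) _.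
by apply: ler_pM => //; exact: pnorm_ge0.
Qed.

End EulerMoments.

Section MomentCoefficients.
Variable R : realType.
Local Notation C := R[i].
Variables (N : nat) (del : C).

(** For z = e^{i b}, cos_pol / z = cos b - 1 and sin_pol / z = i sin b. *)
Definition cos_pol : {poly C} := 2^-1 *: ('X - 1) ^+ 2.
Definition sin_pol : {poly C} := 2^-1 *: ('X^2 - 1).
(** With z = e^{i b}, moment_pol i j / z^{i+j} is the coefficient of u^i X^j in
    exp(del ((cos b - 1) u + i sin b X)). *)
Definition moment_pol i j : {poly C} :=
  (del ^+ (i + j) / (i`!%:R * j`!%:R)) *: (cos_pol ^+ i * sin_pol ^+ j).

Definition moment_coef n i j : C := euler_moment (N%:R - (i + j)%:R) n (moment_pol i j).

Lemma deriv_cos_pol : 'X * cos_pol^`() = cos_pol + sin_pol.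
Proof.
rewrite /cos_pol /sin_pol derivZ deriv_exp derivB derivX derivC /= -!mul_polyC.
have H : (2^-1 : C)%:P * 2 = 1 :> {poly C}.
  by rewrite -(polyC_natr _ 2) -polyCM mulVf ?pnatr_eq0.
by ring: H.
Qed.

Lemma deriv_sin_pol : 'X * sin_pol^`() = cos_pol + sin_pol + 'X.
Proof.
rewrite /cos_pol /sin_pol derivZ derivB derivXn derivC subr0 expr1 /= -!mul_polyC.
have H : (2^-1 : C)%:P * 2 = 1 :> {poly C}.
  by rewrite -(polyC_natr _ 2) -polyCM mulVf ?pnatr_eq0.
have E : 'X = (2^-1)%:P * 2 * 'X :> {poly C} by rewrite H mul1r.
rewrite [X in _ = _ + X]E; ring.
Qed.

Lemma deriv_expX (p : {poly C}) k : (p ^+ k)^`() = k%:R * (p^`() * p ^+ k.-1).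
Proof.
elim: k => [|k IH]; first by rewrite expr0 derivC mul0r.
rewrite exprS derivM IH -[in RHS]natr1 /=.
by case: k {IH} => [|k] /=; rewrite ?mul0r ?exprS; ring.
Qed.

(** The hypotheses say that z d/dz sends A / z to B / z and B / z to A / z + 1,
    as it does for cos b - 1 and i sin b when z = e^{i b}; the conclusion is
    the chain rule for monomials in A and B. *)
Lemma deriv_monomial (A B : {poly C}) :
  'X * A^`() = A + B -> 'X * B^`() = A + B + 'X -> forall i j,
  'X * (A ^+ i * B ^+ j)^`() = (i + j)%:R * (A ^+ i * B ^+ j) +
   i%:R * (A ^+ i.-1 * B ^+ j.+1) + j%:R * (A ^+ i.+1 * B ^+ j.-1) +
   j%:R * ('X * (A ^+ i * B ^+ j.-1)).
Proof.
move=> EA EB i j; rewrite derivM !deriv_expX natrD.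
transitivity (i%:R * ('X * A^`()) * A ^+ i.-1 * B ^+ j +
  A ^+ i * (j%:R * ('X * B^`()) * B ^+ j.-1)); first by ring.
rewrite EA EB.
have P (D : {poly C}) k : k%:R * D ^+ k = k%:R * D * D ^+ k.-1.
  by case: k => [|k]; rewrite ?mul0r // exprS mulrA.
rewrite [(_ + _) * (A ^+ i * _)]mulrDl (mulrA i%:R (A ^+ i)) (mulrCA j%:R (A ^+ i)) !P.
by rewrite [B ^+ j.+1]exprS [A ^+ i.+1]exprS; ring.
Qed.

Lemma deriv_moment_pol i j :
  'X * (moment_pol i j)^`() = (i + j)%:R *: moment_pol i j +
    (if i is i'.+1 then j.+1%:R *: moment_pol i' j.+1 else 0) +
    (if j is j'.+1 then i.+1%:R *: moment_pol i.+1 j' else 0) +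
    (if j is j'.+1 then del *: ('X * moment_pol i j') else 0).
Proof.
have f0 n : n`!%:R != 0 :> C by rewrite pnatr_eq0 -lt0n fact_gt0.
have fS n : n.+1`!%:R = n.+1%:R * n`!%:R :> C by rewrite factS natrM.
have n0 n : n.+1%:R != 0 :> C by rewrite pnatr_eq0.
set A := cos_pol; set B := sin_pol.
have E := deriv_monomial (deriv_cos_pol : 'X * A^`() = A + B) deriv_sin_pol i j.
have natZ n (p : {poly C}) : n%:R * p = (n%:R : C) *: p by rewrite -mul_polyC polyC_natr.
rewrite /moment_pol -/A -/B derivZ -scalerAr E !natZ !scalerDr !scalerA.
congr (_ + _ + _ + _).
- by rewrite mulrC.
- case: i {E} => [|i]; first by rewrite mulr0 scale0r.
  rewrite scalerA; congr (_ *: _).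
  rewrite addnS addSn !fS; move: (i.+1%:R : C) (n0 i) (j.+1%:R : C) (n0 j) => a a0 b b0.
  by move: (i`!%:R : C) (f0 i) (j`!%:R : C) (f0 j) => c c0 d d0; field; rewrite ?a0 ?b0 ?c0 ?d0.
- case: j {E} => [|j]; first by rewrite mulr0 scale0r.
  rewrite scalerA; congr (_ *: _).
  rewrite addnS addSn !fS; move: (i.+1%:R : C) (n0 i) (j.+1%:R : C) (n0 j) => a a0 b b0.
  by move: (i`!%:R : C) (f0 i) (j`!%:R : C) (f0 j) => c c0 d d0; field; rewrite ?a0 ?b0 ?c0 ?d0.
- case: j {E} => [|j]; first by rewrite mulr0 scale0r.
  rewrite -scalerAr scalerA; congr (_ *: _).
  rewrite addnS exprS !fS; move: (j.+1%:R : C) (n0 j) => b b0.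
  by move: (i`!%:R : C) (f0 i) (j`!%:R : C) (f0 j) => c c0 d d0; field; rewrite ?b0 ?c0 ?d0.
Qed.

Lemma moment_coef0 i j : moment_coef 0 i j = ((i == 0%N) && (j == 0%N))%:R.
Proof.
rewrite /moment_coef euler_moment0 /moment_pol /cos_pol /sin_pol !hornerE.
case: i => [|i]; case: j => [|j]; rewrite ?expr1n ?subrr ?expr0n /= ?exprS ?(mulr0,mul0r,scaler0) //.
by rewrite !expr0 fact0 !mulr1 divr1.
Qed.

(** The Euler operator z d/dz acts on the polynomials moment_pol exactly as the
    dimension-two operator acts on coefficients (deriv_moment_pol); the
    exponent N - i - j accounts for the term N and for the division by
    z^{i+j}. *)
Lemma moment_coefS n i j : moment_coef n.+1 i j = moment_step del N (moment_coef n) i j.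
Proof.
have c0 e m : euler_moment e m (0 : {poly C}) = 0 by rewrite /euler_moment size_poly0 big_ord0.
rewrite /moment_coef euler_momentS deriv_moment_pol /moment_step.
rewrite rmorphB /= !rmorph_nat scalerBl.
set s := (i + j)%:R *: moment_pol i j.
have P (u v w x : {poly C}) : s + u + v + w + (x - s) = x + v + u + w by ring.
rewrite P {P}.
rewrite !euler_momentD euler_momentZ; congr (_ + _ + _ + _).
- by case: j {s} => [|j]; [by rewrite c0|rewrite euler_momentZ addnS addSn].
- by case: i {s} => [|i]; [by rewrite c0|by rewrite euler_momentZ addnS addSn].
- case: j {s} => [|j]; [by rewrite c0|rewrite euler_momentZ euler_momentX addnS -natr1].
  by congr (_ * euler_moment _ _ _); ring.
Qed.

Lemma moment_coef_eq0 n i j : (n < i + j)%N -> moment_coef n i j = 0.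
Proof.
elim: n i j => [|n IH] i j nij.
  by rewrite moment_coef0; case: i j nij => [|i] [|j].
rewrite moment_coefS /moment_step IH ?(ltnW nij) // mulr0 add0r.
case: j nij => [|j] nij; case: i nij => [|i] nij; rewrite ?(IH, mulr0, addr0, add0r) //.
all: by move: nij; rewrite ?(addnS, addSn, add0n, addn0) // => /ltnW.
Qed.

End MomentCoefficients.

(** * Exponential generating functions of Euler moments *)

Section ExponentialSums.
Variable R : realType.
Local Notation C := R[i].

Lemma expi0 : expi (0 : R) = 1 :> C.
Proof. by rewrite /expi cos0 sin0. Qed.

Lemma expiX (t : R) n : expi t ^+ n = expi (n%:R * t) :> C.
Proof.
elim: n => [|n IH]; first by rewrite mul0r expi0.
by rewrite exprS IH -expiD -natr1 mulrDl mul1r addrC.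
Qed.

Lemma expiN (t : R) : expi t * expi (- t) = 1 :> C.
Proof. by rewrite -expiD subrr expi0. Qed.

Lemma expi_cos (t : R) : expi t + expi (- t) = 2 * (cos t)%:C%C :> C.
Proof.
rewrite -(rmorph_nat (real_complex R)); apply/eqP; rewrite eq_complex /= cosN sinN.
by apply/andP; split; apply/eqP; ring.
Qed.

Lemma expi_sin (t : R) : expi t - expi (- t) = 2 * ('i%C * (sin t)%:C%C) :> C.
Proof.
rewrite -(rmorph_nat (real_complex R)); apply/eqP; rewrite eq_complex /= cosN sinN.
by apply/andP; split; apply/eqP; ring.
Qed.

Lemma euler_moment_partial (b e : R) (q : {poly C}) M :
  \sum_(0 <= n < M) (('i%C * b%:C%C) ^+ n / n`!%:R) * euler_moment e n q =
  \sum_(k < size q) q`_k *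
    \sum_(0 <= n < M) ('i%C * (b * (k%:R + e))%:C%C) ^+ n / n`!%:R.
Proof.
under eq_bigr do rewrite /euler_moment mulr_sumr.
rewrite exchange_big /=; apply: eq_bigr => k _; rewrite mulr_sumr.
apply: eq_bigr => n _.
have -> : 'i%C * (b * (k%:R + e))%:C%C = ('i%C * b%:C%C) * (k%:R + e)%:C%C :> C.
  by rewrite (rmorphM (real_complex R)) /= mulrA.
rewrite [in RHS]exprMn (rmorphXn (real_complex R)) /= mulrCA; congr (_ * _).
by rewrite mulrAC.
Qed.

(** Term by term, the sum over n of (i b)^n (k + e)^n / n! is e^{i b (k + e)}. *)
Lemma cvg_euler_moment (b e : R) (q : {poly C}) :
  ccvg (fun M => \sum_(0 <= n < M) (('i%C * b%:C%C) ^+ n / n`!%:R) * euler_moment e n q)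
    (expi (b * e) * q.[expi b]).
Proof.
have -> : expi (b * e) * q.[expi b] = \sum_(k < size q) q`_k * expi (b * (k%:R + e)).
  rewrite horner_coef mulr_sumr; apply: eq_bigr => k _.
  rewrite expiX mulrDr expiD [b * k%:R]mulrC mulrCA.
  by rewrite (mulrC (expi (b * e))).
apply: (eq_ccvg (fun M => esym (euler_moment_partial b e q M))).
by apply: ccvg_sum => k _; apply: ccvgMl; exact: cvg_expi.
Qed.

Lemma euler_moment_partial_bound (b e L : R) (q : {poly C}) M :
  (forall k, (k < size q)%N -> `|k%:R + e| <= L) ->
  normc (\sum_(0 <= n < M) (('i%C * b%:C%C) ^+ n / n`!%:R) * euler_moment e n q) <=
  pnorm q * expR (`|b| * L).
Proof.
move=> kL; rewrite euler_moment_partial; apply: le_trans (normc_sum _ _ _) _.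
rewrite /pnorm mulr_suml; apply: ler_sum => k _; rewrite normcM.
apply: ler_wpM2l; first exact: normc_ge0.
apply: le_trans (normc_exp_partial _ _) _.
by rewrite ler_expR normrM ler_wpM2l // kL.
Qed.

Variables (N : nat) (del : C) (b : R).

Lemma cvg_moment_coef i j :
  ccvg (fun M => \sum_(0 <= n < M) (('i%C * b%:C%C) ^+ n / n`!%:R) * moment_coef N del n i j)
    (expi (b * N%:R) * ((del * ((cos b)%:C%C - 1)) ^+ i / i`!%:R *
                       ((del * ('i%C * (sin b)%:C%C)) ^+ j / j`!%:R))).
Proof.
suff -> : expi (b * N%:R) * ((del * ((cos b)%:C%C - 1)) ^+ i / i`!%:R *
                       ((del * ('i%C * (sin b)%:C%C)) ^+ j / j`!%:R)) =
  expi (b * (N%:R - (i + j)%:R)) * (moment_pol del i j).[expi b] by exact: cvg_euler_moment.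
set X := expi b; set Y := expi (- b).
have -> : (moment_pol del i j).[X] = del ^+ (i + j) / (i`!%:R * j`!%:R) *
    ((2^-1 * (X - 1) ^+ 2) ^+ i * (2^-1 * (X ^+ 2 - 1)) ^+ j).
  by rewrite /moment_pol /cos_pol /sin_pol !hornerE.
have -> : expi (b * (N%:R - (i + j)%:R)) = expi (b * N%:R) * Y ^+ (i + j) :> C.
  by rewrite expiX -expiD; congr expi; ring.
have XY : X * Y = 1 by exact: expiN.
have n2 : 2 != 0 :> C by rewrite pnatr_eq0.
have A : (cos b)%:C%C - 1 = Y * (2^-1 * (X - 1) ^+ 2).
  apply: (mulfI n2); rewrite mulrBr -expi_cos -/X -/Y mulr1.
  transitivity (X * (X * Y) + Y - 2 * (X * Y)); first by rewrite XY; ring.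
  by field.
have B : 'i%C * (sin b)%:C%C = Y * (2^-1 * (X ^+ 2 - 1)).
  apply: (mulfI n2); rewrite -expi_sin -/X -/Y.
  transitivity (X * (X * Y) - Y); first by rewrite XY; ring.
  by field.
rewrite A B !exprMn !(exprD _ i j) invfM.
by ring.
Qed.

Lemma pnorm_cos_pol : pnorm (cos_pol R) <= 2.
Proof.
have p1 : pnorm ('X - 1 : {poly C}) <= 2.
  apply: le_trans (pnormD _ _) _; rewrite -polyCN -[X in pnorm X]mulr1 pnormX.
  by rewrite -polyC1 !pnormC (normc_nat _ 1) normcN (normc_nat _ 1).
rewrite /cos_pol pnormZ normcV normc_nat.
rewrite ler_pdivrMl //; apply: le_trans (pnormXn 2 p1) _.
by rewrite -natrX -natrM ler_nat.
Qed.

Lemma pnorm_sin_pol : pnorm (sin_pol R) <= 2.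
Proof.
have p1 : pnorm ('X^2 - 1 : {poly C}) <= 2.
  apply: le_trans (pnormD _ _) _; rewrite -polyCN expr2 pnormX -[X in pnorm X]mulr1 pnormX.
  by rewrite -polyC1 !pnormC (normc_nat _ 1) normcN (normc_nat _ 1).
rewrite /sin_pol pnormZ normcV normc_nat.
rewrite ler_pdivrMl //; apply: le_trans p1 _.
by rewrite -natrM ler_nat.
Qed.

Lemma size_moment_pol i j : (size (moment_pol del i j) <= ((i + j).*2).+1)%N.
Proof.
have sA : (size (cos_pol R) <= 3)%N.
  apply: leq_trans (size_scale_leq _ _) _.
  apply: leq_trans (size_poly_exp_leq _ _) _.
  by rewrite -polyC1 size_XsubC.
have sB : (size (sin_pol R) <= 3)%N.
  apply: leq_trans (size_scale_leq _ _) _.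
  apply: leq_trans (size_polyD _ _) _.
  by rewrite size_polyN size_poly1 size_polyXn.
have sX (p : {poly C}) n : (size p <= 3)%N -> (size (p ^+ n)%R <= n.*2.+1)%N.
  move=> sp; apply: leq_trans (size_poly_exp_leq _ _) _.
  by rewrite ltnS -mul2n leq_mul // -subn1 leq_subLR.
apply: leq_trans (size_scale_leq _ _) _.
apply: leq_trans (size_polyMleq _ _) _.
rewrite -subn1 leq_subLR add1n; apply: leq_trans (leq_add (sX _ i sA) (sX _ j sB)) _.
by rewrite doubleD addSn addnS.
Qed.

Definition moment_rate : R := 2 * normc del * expR (`|b| * 3).

(** The exponents k + N - i - j with k <= 2 (i + j) are at most N + 3 (i + j) in
    absolute value, and each partial sum of the exponential series is bounded
    by the exponential of the modulus. *)
Lemma moment_coef_partial_bound i j M :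
  normc (\sum_(0 <= n < M) (('i%C * b%:C%C) ^+ n / n`!%:R) * moment_coef N del n i j) <=
  expR (`|b| * N%:R) * (moment_rate ^+ i / i`!%:R * (moment_rate ^+ j / j`!%:R)).
Proof.
have d0 := normc_ge0 del.
apply: le_trans (@euler_moment_partial_bound _ _ (N%:R + 3 * (i + j)%:R) _ _ _) _.
  move=> k /leq_trans/(_ (size_moment_pol i j)); rewrite ltnS => kij.
  have h1 : k%:R <= 2 * (i + j)%:R :> R by rewrite -natrM ler_nat mul2n.
  have h2 : 0 <= N%:R :> R by [].
  have h3 : 0 <= (i + j)%:R :> R by [].
  have h4 : 0 <= k%:R :> R by [].
  rewrite ler_norml; apply/andP; split; lra.
have pq : pnorm (moment_pol del i j) <= normc del ^+ (i + j) / (i`!%:R * j`!%:R) * (2 ^+ i * 2 ^+ j).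
  rewrite /moment_pol pnormZ normcM normcX normcV normcM !normc_nat.
  apply: ler_wpM2l; first by rewrite mulr_ge0 ?invr_ge0 ?mulr_ge0 ?exprn_ge0.
  apply: le_trans (pnormM _ _) _.
  by apply: ler_pM; rewrite ?pnorm_ge0 //; apply: pnormXn; [exact: pnorm_cos_pol|exact: pnorm_sin_pol].
apply: (@le_trans _ _ (normc del ^+ (i + j) / (i`!%:R * j`!%:R) * (2 ^+ i * 2 ^+ j) *
   expR (`|b| * (N%:R + 3 * (i + j)%:R)))).
  by apply: ler_wpM2r => //; exact: expR_ge0.
rewrite /moment_rate !exprMn -!expRM_natl !exprD invfM mulrDr expRD.
rewrite (_ : `|b| * (3 * (i + j)%:R) = i%:R * (`|b| * 3) + j%:R * (`|b| * 3)); last first.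
  by rewrite natrD; ring.
rewrite expRD le_eqVlt; apply/orP; left; apply/eqP; ring.
Qed.

End ExponentialSums.

(** * Bessel functions of half-integer order *)

Section HalfIntegerBessel.
Variable R : realType.

(** The boolean b selects between the orders n + 1/2 and n + 3/2; through
    (2n)! and (2n+1)! they correspond to the cosine and sine series. *)
Lemma euler_gamma_half_parity (b : bool) n :
  euler_gamma (n%:R + 2^-1 + b%:R : R) =
  (n.*2 + b)`!%:R / (2 ^+ b * 4 ^+ n * n`!%:R) * Num.sqrt pi.
Proof.
case: b => /=; last by rewrite addr0 addn0 expr0 mul1r euler_gamma_half.
rewrite addrAC natr1 euler_gamma_half doubleS !factS addn1 factS !natrM expr1 exprS.
rewrite (_ : n.*2.+2%:R = 2 * n.+1%:R :> R); last by rewrite -natrM mul2n doubleS.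
have h1 : n`!%:R != 0 :> R by rewrite pnatr_eq0 -lt0n fact_gt0.
have h2 : 4 ^+ n != 0 :> R by rewrite expf_neq0 // pnatr_eq0.
have c0 : n.+1%:R != 0 :> R by rewrite pnatr_eq0.
move: (n.+1%:R : R) c0 => c c0; by field; rewrite h1 h2 c0.
Qed.

(** Coefficients of the m-th derivative, with respect to v, of the series
    sum_k v^k / (2k)! for b = false and sum_k v^k / (2k + 1)! for b = true,
    whose values at v = - t^2 are cos t and sin t / t. *)
Definition half_coeff (b : bool) m k : R :=
  (m + k)`!%:R / (k`!%:R * ((m + k).*2 + b)`!%:R).

Lemma half_coeff_cvg b m (x : R) : cvgn (series (fun k => half_coeff b m k * x ^+ k)).
Proof.
apply: normed_cvg; apply: (@series_le_cvg _ _ (exp_coeff `|x|)).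
- by move=> k; exact: normr_ge0.
- by move=> k; exact: exp_coeff_ge0.
- move=> k; rewrite /exp_coeff /= normrM normrX /half_coeff mulrC ler_wpM2l ?exprn_ge0 //.
  rewrite ger0_norm; last by rewrite divr_ge0 // mulr_ge0.
  rewrite invfM mulrCA ler_piMr ?invr_ge0 // ler_pdivrMr ?ltr0n ?fact_gt0 // mul1r ler_nat.
  by apply: leq_fact; rewrite -addnn -addnA leq_addr.
- exact: is_cvg_series_exp_coeff.
Qed.

(** By euler_gamma_half_parity, the Bessel series of order
    m - 1/2 + b and the m-th derivative of the series of cos t or sin t / t
    with respect to - t^2 have proportional coefficients. *)
Lemma half_bessel b m (t : R) :
  series (fun k => half_coeff b m k * (- t ^+ 2) ^+ k) @ \oo -->
  Num.sqrt (pi / 2) * 2^-1 ^+ m * tbesselJ (m%:R - 2^-1 + b%:R) t.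
Proof.
set c := 2 ^+ b * 4 ^+ m / Num.sqrt (pi : R).
have sp : Num.sqrt pi != 0 :> R by rewrite gt_eqF // sqrtr_gt0 pi_gt0.
have s2 : Num.sqrt 2 != 0 :> R by rewrite gt_eqF // sqrtr_gt0.
have cS := @half_coeff_cvg b m (- t ^+ 2).
have E : bessel_series (m%:R - 2^-1 + b%:R) t =
    c * limn (series (fun k => half_coeff b m k * (- t ^+ 2) ^+ k)).
  rewrite /bessel_series; apply/cvg_lim => //.
  rewrite (_ : series _ = fun M => c * series (fun k => half_coeff b m k * (- t ^+ 2) ^+ k) M).
    by apply: cvgM => //; exact: cvg_cst.
  apply/funext => M; rewrite /series /= mulr_sumr; apply: eq_bigr => k _.
  rewrite (_ : _ + k%:R + 1 = (m + k)%:R + 2^-1 + b%:R); last by rewrite natrD; field.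
  rewrite euler_gamma_half_parity /half_coeff /c exprD -[- t ^+ 2]mulN1r !exprMn exprVn.
  have h1 n : n`!%:R != 0 :> R by rewrite pnatr_eq0 -lt0n fact_gt0.
  have h2 n : 4 ^+ n != 0 :> R by rewrite expf_neq0 // pnatr_eq0.
  have h3 : 2 ^+ b != 0 :> R by rewrite expf_neq0 // pnatr_eq0.
  by field; rewrite ?h1 ?h2 ?h3 ?sp.
rewrite /tbesselJ E.
suff -> : Num.sqrt (pi / 2) * 2^-1 ^+ m * (2 `^ (- (m%:R - 2^-1 + b%:R)) *
  (c * limn (series (fun k => half_coeff b m k * (- t ^+ 2) ^+ k)))) =
  limn (series (fun k => half_coeff b m k * (- t ^+ 2) ^+ k)) by [].
set S := limn _; rewrite -[RHS]mul1r !mulrA; congr (_ * S).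
rewrite (_ : - (m%:R - 2^-1 + b%:R) = 2^-1 + - (m%:R + b%:R)); last by ring.
rewrite powRD ?pnatr_eq0 ?implybT // powR12_sqrt // powRN -natrD powR_mulrn // exprD /c.
rewrite sqrtrM ?pi_ge0 // sqrtrV // exprVn.
rewrite (_ : 4 = 2 ^+ 2); last by rewrite -natrX.
rewrite -exprM mulnC exprM expr2.
have h2 : 2 ^+ m != 0 :> R by rewrite expf_neq0 // pnatr_eq0.
have h3 : 2 ^+ b != 0 :> R by rewrite expf_neq0 // pnatr_eq0.
by field; rewrite h2 h3 sp s2.
Qed.

End HalfIntegerBessel.

(** * Higher derivatives of products and of powers of a quadratic polynomial *)

Section Jets.
Variable K : comNzRingType.
Implicit Types (p q : {poly K}).

Lemma derivnM n p q :
  (p * q)^`(n) = \sum_(i < n.+1) 'C(n, i)%:R * (p^`(i) * q^`(n - i)).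
Proof.
elim: n => [|n IH]; first by rewrite big_ord1 bin0 mul1r !derivn0.
rewrite derivnS IH linear_sum /=.
have D (i : 'I_n.+1) : ('C(n, i)%:R * (p^`(i) * q^`(n - i)))^`() =
   'C(n, i)%:R * (p^`(i.+1) * q^`(n - i)) + 'C(n, i)%:R * (p^`(i) * q^`((n - i).+1)).
  by rewrite -polyC_natr derivM derivC mul0r add0r derivM -!derivnS mulrDr.
under eq_bigr do rewrite D; rewrite big_split /=.
rewrite [RHS]big_ord_recl bin0 subn0.
under [in RHS]eq_bigr do rewrite lift0 binS natrD mulrDl subSS.
rewrite [in RHS]big_split /=.
rewrite (big_ord_recr n (fun i => 'C(n, i.+1)%:R * (p^`(i.+1) * q^`(n - i)))) /=.
rewrite bin_small // mul0r addr0 addrA [RHS]addrC; congr (_ + _).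
rewrite [LHS]big_ord_recl /= bin0 subn0; congr (_ + _).
by apply: eq_bigr => i _; rewrite /bump leq0n add1n add0n -(subnSK (ltn_ord i)) derivnS.
Qed.

Lemma sum_nat_widen0 (V : nmodType) (F : nat -> V) m n : (m <= n)%N ->
  (forall i, (m <= i)%N -> F i = 0) -> \sum_(i < n) F i = \sum_(i < m) F i.
Proof.
move=> mn F0; rewrite -!(big_mkord xpredT) (@big_cat_nat _ _ _ m) //= [X in _ + X]big1_seq ?addr0 //.
by move=> i; rewrite mem_index_iota => /andP[_ /andP[mi _]]; exact: F0.
Qed.

(** Expanding (a + X (b + X))^k, the power X^m (b + X)^m contributes to X^l only
    for m <= l. *)
Lemma coef_quadratic (a b : K) k l :
  ((a%:P + 'X * (b%:P + 'X)) ^+ k)`_l =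
  \sum_(m < l.+1) ('C(k, m) * 'C(m, l - m))%:R * (b ^+ (m.*2 - l) * a ^+ (k - m)).
Proof.
have cf m : ('X ^+ m * (b%:P + 'X) ^+ m)`_l =
    if (l < m)%N then 0 else 'C(m, l - m)%:R * b ^+ (m.*2 - l).
  rewrite mulrC coefMXn; case: ltnP => // ml.
  rewrite exprDn coef_sum.
  under eq_bigr do rewrite -polyC_exp -mulrnAr mul_polyC coefZ coefMn coefXn.
  have [lm|lm] := ltnP (l - m) m.+1; last first.
    rewrite bin_small // mul0r big1 // => i _.
    by rewrite gtn_eqF ?mul0rn ?mulr0 // (leq_trans (ltn_ord i)).
  rewrite (bigD1 (Ordinal lm)) //= eqxx big1 ?addr0.
    rewrite mulrC; congr (_ * b ^+ _).
    by rewrite -addnn subnBA.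
  by move=> i /negbTE ni; rewrite (_ : (_ == _) = false) ?mul0rn ?mulr0 // eq_sym; exact: ni.
rewrite exprDn coef_sum.
under eq_bigr do rewrite exprMn -polyC_exp mul_polyC coefMn coefZ cf.
pose F m := (a ^+ (k - m) * (if (l < m)%N then 0 else 'C(m, l - m)%:R * b ^+ (m.*2 - l)))
   *+ 'C(k, m).
rewrite -[LHS](@sum_nat_widen0 _ F _ (k + l).+1) ?ltnS ?leq_addr // => [|i ki]; last first.
  by rewrite /F (@bin_small k i) ?mulr0n.
rewrite (@sum_nat_widen0 _ F l.+1) ?ltnS ?leq_addl // => [|i li]; last first.
  by rewrite /F li mulr0 mul0rn.
apply: eq_bigr => m _; rewrite /F ltnNge -ltnS ltn_ord /= natrM -mulr_natl.
by ring.
Qed.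

(** Read off from the expansion of ((u + X)^2 - r2)^k =
    ((u^2 - r2) + X (2 u + X))^k in powers of X. *)
Lemma derivn_quadratic (r2 u : K) k l :
  (('X^2 - r2%:P) ^+ k)^`(l).[u] =
  \sum_(m < l.+1) (l`! * 'C(m, l - m) * 'C(k, m))%:R *
     ((2 * u) ^+ (m.*2 - l) * (u ^+ 2 - r2) ^+ (k - m)).
Proof.
set Q := 'X^2 - r2%:P; set q0 := u ^+ 2 - r2.
have T : (Q ^+ k)^`N(l).[u] = ((q0%:P + 'X * ((2 * u)%:P + 'X)) ^+ k)`_l.
  have -> : q0%:P + 'X * ((2 * u)%:P + 'X) = (map_poly (@polyC K) Q).[u%:P + 'X].
    rewrite /Q [in RHS]rmorphB [in RHS]rmorphXn /= map_polyX map_polyC /= !hornerE /q0.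
    by rewrite polyCB polyC_exp polyCM polyC_natr; ring.
  rewrite -horner_exp -rmorphXn nderiv_taylor; last exact: mulrC.
  set P := Q ^+ k; rewrite size_map_polyC.
  under eq_bigr do rewrite nderivn_map horner_map /=.
  rewrite coef_sum; under eq_bigr do rewrite mul_polyC coefZ coefXn.
  have [lP|Pl] := ltnP l (size P).
    rewrite (bigD1 (Ordinal lP)) //= eqxx mulr1 big1 ?addr0 // => i ni.
    by rewrite (_ : (_ == _) = false) ?mulr0 // eq_sym; apply/negbTE.
  rewrite nderivn_poly0 // horner0 big1 // => i _.
  by rewrite gtn_eqF ?mulr0 // (leq_trans (ltn_ord i)).
rewrite nderivn_def hornerMn T coef_quadratic -mulr_natl mulr_sumr.
apply: eq_bigr => m _; rewrite [LHS]mulrA -natrM; congr (_%:R * _).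
by rewrite -mulnA [('C(k, m) * _)%N]mulnC.
Qed.

End Jets.

(** * Passing to the limit in the exponential of Gamma *)

Section RaisingBound.
Variable R : realType.
Local Notation C := R[i].
Variables (eps r2 u : C) (rho : R).
Hypotheses (rho1 : 1 <= rho) (hu : normc u <= rho) (hq : normc (u ^+ 2 - r2) <= rho ^+ 2).

Lemma iter_id_plus_D_add (K : comNzRingType) (e : K) n (f g : {poly K}) :
  iter n (id_plus_D e) (f + g) = iter n (id_plus_D e) f + iter n (id_plus_D e) g.
Proof. by elim: n => //= n ->; rewrite id_plus_D_add. Qed.

Lemma iter_id_plus_D_scale (K : comNzRingType) (e : K) n c (f : {poly K}) :
  iter n (id_plus_D e) (c%:P * f) = c%:P * iter n (id_plus_D e) f.
Proof. by elim: n => //= n ->; rewrite id_plus_D_scale. Qed.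

(** On a polynomial of degree d, differentiation multiplies the bound rho^d by
    at most d, because rho >= 1 bounds u and the square root of u^2 - r2. *)
Lemma iter_id_plus_D_bound n i k :
  normc (iter n (id_plus_D eps) ('X^i * ('X^2 - r2%:P) ^+ k)).[u] <=
  (1 + normc eps * (i + k.*2)%:R) ^+ n * rho ^+ (i + k.*2).
Proof.
have rho0 : 0 <= rho by apply: le_trans rho1.
have e0 := normc_ge0 eps.
elim: n i k => [|n IH] i k.
  rewrite /= expr0 mul1r !hornerE normcM !normcX exprD -mul2n exprM.
  by apply: ler_pM; rewrite ?exprn_ge0 ?normc_ge0 ?lerXn2r ?nnegrE ?normc_ge0 ?exprn_ge0.
set d := (i + k.*2)%N; set W := (1 + normc eps * d%:R) ^+ n * rho ^+ d.
have W0 : 0 <= W by rewrite mulr_ge0 ?exprn_ge0 ?addr_ge0 ?mulr_ge0.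
have mono d' : (d' <= d)%N -> (1 + normc eps * d'%:R) ^+ n * rho ^+ d' <= W.
  move=> dd; apply: ler_pM; rewrite ?exprn_ge0 ?addr_ge0 ?mulr_ge0 //.
    by rewrite lerXn2r ?nnegrE ?addr_ge0 ?mulr_ge0 // lerD2l ler_wpM2l // ler_nat.
  by rewrite ler_weXn2l.
rewrite iterSr {2}/id_plus_D deriv_quadratic_mon !mulrDr -!polyC_natr !iter_id_plus_D_add !iter_id_plus_D_scale.
rewrite !hornerE.
apply: (@le_trans _ _ (W + normc eps * (i%:R * W + k.*2%:R * W))); last first.
  by rewrite exprS -mulrA -/W -mulrDl -natrD -/d mulrA mulrDl mul1r.
rewrite mulrDr addrA; apply: le_trans (le_normcD _ _) _; apply: lerD.
  apply: le_trans (le_normcD _ _) _; apply: lerD; first exact: IH.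
  rewrite !normcM normc_nat -mulrA; apply: ler_wpM2l => //.
  case: i @d W W0 mono => [|i] d W W0 mono; first by rewrite !mul0r.
  apply: ler_wpM2l => //; apply: le_trans (IH _ _) _; apply: mono.
  by rewrite /d /= addSn.
rewrite !normcM normc_nat -mulrA; apply: ler_wpM2l => //.
case: k @d W W0 mono => [|k] d W W0 mono; first by rewrite !mul0r.
apply: ler_wpM2l => //; apply: le_trans (IH _ _) _; apply: mono.
by rewrite /d /= doubleS !addnS addSn.
Qed.

Lemma expr_le_fact_exp (x : R) n : 0 <= x -> x ^+ n <= n`!%:R * expR x.
Proof.
move=> x0; rewrite -ler_pdivrMl ?ltr0n ?fact_gt0 // mulrC.
apply: le_trans (expR_partial_le n.+1 x0); rewrite big_nat_recr //= lerDr.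
by apply: sumr_ge0 => k _; rewrite divr_ge0 ?exprn_ge0.
Qed.

(** The polynomial factor (1 + |eps| d)^n is absorbed into e^{|eps| d}, at the
    cost of n! e, so that the bound becomes geometric in d. *)
Definition growth : R := expR (normc eps) * rho.

Lemma iter_id_plus_D_bound_exp n i k :
  normc (iter n (id_plus_D eps) ('X^i * ('X^2 - r2%:P) ^+ k)).[u] <=
  n`!%:R * expR 1 * growth ^+ (i + k.*2).
Proof.
apply: le_trans (iter_id_plus_D_bound _ _ _) _; rewrite /growth exprMn mulrA.
have e0 := normc_ge0 eps.
apply: ler_wpM2r; first by rewrite exprn_ge0 // (le_trans _ rho1).
apply: le_trans (expr_le_fact_exp _ _) _; first by rewrite addr_ge0 ?mulr_ge0.
by rewrite expRD -expRM_natl [_ * normc eps]mulrC mulrA.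
Qed.

Lemma growth_ge1 : 1 <= growth.
Proof.
rewrite -[1]mulr1 ler_pM // -expR0 ler_expR; exact: normc_ge0.
Qed.

Variable N : nat.

(** Scalar and bivector part, at the point u, of raise_dim^N applied to
    u^i X^j. *)
Definition raised1 i j := (iter N (raise_dim eps) (pair_mon r2 i j)).1.[u].
Definition raised2 i j := (iter N (raise_dim eps) (pair_mon r2 i j)).2.[u].

Definition raised_const : R := (1 + N%:R * normc eps) * N`!%:R * expR 1.

Lemma growth_half i j : growth ^+ (i + j./2.*2) <= growth ^+ i * growth ^+ j.
Proof.
rewrite -exprD ler_weXn2l ?growth_ge1 // leq_add2l.
by rewrite -{2}(odd_double_half j) leq_addl.
Qed.

Lemma raised2_bound i j : normc (raised2 i j) <= raised_const * (growth ^+ i * growth ^+ j).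
Proof.
have e0 := normc_ge0 eps.
have g0 : 0 <= growth by apply: le_trans growth_ge1.
rewrite /raised2 iter_raise_dim /pair_mon; case: (odd j) => /=; last first.
  by rewrite iter_id_plus_D0 horner0 (normc_nat _ 0) !mulr_ge0 ?addr_ge0 ?mulr_ge0 ?exprn_ge0 ?expR_ge0.
apply: le_trans (iter_id_plus_D_bound_exp _ _ _) _.
apply: ler_pM; rewrite ?mulr_ge0 ?expR_ge0 ?exprn_ge0 //; last exact: growth_half.
by rewrite /raised_const ler_wpM2r ?expR_ge0 // ler_peMl // lerDl mulr_ge0.
Qed.

Lemma raised1_bound i j : normc (raised1 i j) <= raised_const * (growth ^+ i * growth ^+ j).
Proof.
have e0 := normc_ge0 eps.
have g0 : 0 <= growth by apply: le_trans growth_ge1.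
rewrite /raised1 iter_raise_dim /pair_mon; case: (odd j) => /=; last first.
  rewrite iter_id_plus_D0 mulr0 subr0; apply: le_trans (iter_id_plus_D_bound_exp _ _ _) _.
  apply: ler_pM; rewrite ?mulr_ge0 ?expR_ge0 ?exprn_ge0 //; last exact: growth_half.
  by rewrite /raised_const ler_wpM2r ?expR_ge0 // ler_peMl // lerDl mulr_ge0.
rewrite iter_id_plus_D0 sub0r hornerN normcN -polyC_natr -polyCM hornerM hornerC !normcM normc_nat.
apply: (@le_trans _ _ (N%:R * normc eps * (N.-1`!%:R * expR 1 * growth ^+ (i + j./2.*2)))).
  by apply: ler_wpM2l; [rewrite mulr_ge0|exact: iter_id_plus_D_bound_exp].
rewrite /raised_const !mulrA -!(mulrA _ (growth ^+ i)).
apply: ler_pM; rewrite ?mulr_ge0 ?expR_ge0 ?exprn_ge0 //; last exact: growth_half.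
apply: ler_wpM2r; first exact: expR_ge0.
apply: ler_pM; rewrite ?mulr_ge0 //; first by rewrite lerDr.
by rewrite ler_nat leq_fact ?leq_pred.
Qed.

End RaisingBound.

Section Limit.
Variable R : realType.
Local Notation C := R[i].
Variables (eps del r2 u : C) (N : nat) (b : R).
Hypothesis epsdel : eps * del = 1.

Lemma iter_raise_dim_sum (I : Type) (s : seq I) (c : I -> C) (m : I -> {poly C} * {poly C}) :
  iter N (raise_dim eps) (\sum_(i <- s) c i *: m i) = \sum_(i <- s) c i *: iter N (raise_dim eps) (m i).
Proof.
have D p q : iter N (raise_dim eps) (p + q) = iter N (raise_dim eps) p + iter N (raise_dim eps) q.
  by elim: N => //= n ->; rewrite raise_dim_add.
have Z a p : iter N (raise_dim eps) (a *: p) = a *: iter N (raise_dim eps) p.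
  elim: N => //= n ->; case: (iter _ _ _) => f h.
  by rewrite /raise_dim /id_plus_D /= !derivZ -!mul_polyC; congr pair; rewrite /= -!mul_polyC; ring.
elim: s => [|i s IH]; last by rewrite !big_cons D Z IH.
by rewrite !big_nil -[X in iter _ _ X](scale0r (0 : {poly C} * {poly C})) Z scale0r.
Qed.

Lemma pair1_sum (I : Type) (s : seq I) (F : I -> {poly C} * {poly C}) :
  (\sum_(i <- s) F i).1 = \sum_(i <- s) (F i).1.
Proof. by elim/big_rec2: _ => // i x y _ <-. Qed.
Lemma pair2_sum (I : Type) (s : seq I) (F : I -> {poly C} * {poly C}) :
  (\sum_(i <- s) F i).2 = \sum_(i <- s) (F i).2.
Proof. by elim/big_rec2: _ => // i x y _ <-. Qed.

Lemma iter_Gamma_pair_raised1 n M : (n < M)%N ->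
  (iter n (Gamma_pair del r2 N) (1, 0)).1.[u] =
  \sum_(0 <= i < M) \sum_(0 <= j < M) moment_coef N del n i j * raised1 eps r2 u N i j.
Proof.
move=> nM; rewrite -(iter_raise_dim1 eps N) iter_Gamma_pair_raise //.
rewrite (@iter_Gamma_pair_sum _ _ _ _ n M (moment_coef N del)) //; first last.
- exact: moment_coef_eq0.
- exact: moment_coefS.
- exact: moment_coef0.
have -> : pair_sum r2 M (moment_coef N del n) = \sum_(0 <= i < M) 1 *: \sum_(0 <= j < M) moment_coef N del n i j *: pair_mon r2 i j.
  by apply: eq_bigr => i _; rewrite scale1r.
rewrite iter_raise_dim_sum; under eq_bigr do rewrite scale1r iter_raise_dim_sum.
rewrite pair1_sum horner_sum; apply: eq_bigr => i _.
by rewrite pair1_sum horner_sum; apply: eq_bigr => j _; rewrite /= hornerZ.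
Qed.

Lemma iter_Gamma_pair_raised2 n M : (n < M)%N ->
  (iter n (Gamma_pair del r2 N) (1, 0)).2.[u] =
  \sum_(0 <= i < M) \sum_(0 <= j < M) moment_coef N del n i j * raised2 eps r2 u N i j.
Proof.
move=> nM; rewrite -(iter_raise_dim1 eps N) iter_Gamma_pair_raise //.
rewrite (@iter_Gamma_pair_sum _ _ _ _ n M (moment_coef N del)) //; first last.
- exact: moment_coef_eq0.
- exact: moment_coefS.
- exact: moment_coef0.
have -> : pair_sum r2 M (moment_coef N del n) = \sum_(0 <= i < M) 1 *: \sum_(0 <= j < M) moment_coef N del n i j *: pair_mon r2 i j.
  by apply: eq_bigr => i _; rewrite scale1r.
rewrite iter_raise_dim_sum; under eq_bigr do rewrite scale1r iter_raise_dim_sum.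
rewrite pair2_sum horner_sum; apply: eq_bigr => i _.
by rewrite pair2_sum horner_sum; apply: eq_bigr => j _; rewrite /= hornerZ.
Qed.

(** The exponents of e^{kappa1 u} e^{kappa2 X}, the limit in dimension two up
    to the factor e^{i b N}. *)
Definition kappa1 : C := del * ((cos b)%:C%C - 1).
Definition kappa2 : C := del * ('i%C * (sin b)%:C%C).

(** The partial sums of the series in n are double sums over (i, j) whose
    coefficients converge (cvg_moment_coef) and are dominated by products of
    exponential series, so Tannery's theorem applies. *)
Lemma double_series_limit (ev : nat -> nat -> C) (w : nat -> C) (K g : R) (S : C) :
  0 <= K -> 0 <= g ->
  (forall i j, normc (ev i j) <= K * (g ^+ i * g ^+ j)) ->
  (forall n M, (n < M)%N -> w n =
     \sum_(0 <= i < M) \sum_(0 <= j < M) moment_coef N del n i j * ev i j) ->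
  ccvg (fun L => \sum_(0 <= i < L) \sum_(0 <= j < L)
     (kappa1 ^+ i / i`!%:R * (kappa2 ^+ j / j`!%:R)) * ev i j) S ->
  ccvg (fun M => \sum_(0 <= n < M) (('i%C * b%:C%C) ^+ n / n`!%:R) * w n)
    (expi (b * N%:R) * S).
Proof.
move=> K0 g0 evB wE SL.
pose cf M i j := \sum_(0 <= n < M) (('i%C * b%:C%C) ^+ n / n`!%:R : C) * moment_coef N del n i j.
apply: (@eq_ccvg _ (fun M => \sum_(0 <= i < M) \sum_(0 <= j < M) cf M i j * ev i j)).
  move=> M; rewrite /cf.
  under [RHS]eq_big_nat => n /andP[_ nM] do rewrite (wE n M nM) mulr_sumr.
  rewrite [RHS]exchange_big /=; apply: eq_bigr => i _.
  under [RHS]eq_bigr do rewrite mulr_sumr.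
  rewrite [RHS]exchange_big /=; apply: eq_bigr => j _.
  by rewrite mulr_suml; apply: eq_bigr => n _; rewrite mulrA.
set z := moment_rate del b.
have z0 : 0 <= z by rewrite /z /moment_rate mulr_ge0 ?expR_ge0 ?mulr_ge0 ?normc_ge0.
apply: (@ctannery _ (fun M i j => cf M i j * ev i j)
  (fun i j => expi (b * N%:R) * (kappa1 ^+ i / i`!%:R * (kappa2 ^+ j / j`!%:R)) * ev i j)
  (fun i => expR (`|b| * N%:R) * K * ((z * g) ^+ i / i`!%:R))
  (fun j => (z * g) ^+ j / j`!%:R)).
- by move=> i j; apply: ccvgM; [exact: cvg_moment_coef|exact: ccvg_cst].
- move=> M i j; rewrite normcM.
  apply: (@le_trans _ _ (expR (`|b| * N%:R) * (z ^+ i / i`!%:R * (z ^+ j / j`!%:R)) * (K * (g ^+ i * g ^+ j)))).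
    by apply: ler_pM; rewrite ?normc_ge0 //; exact: moment_coef_partial_bound.
  by rewrite le_eqVlt; apply/orP; left; apply/eqP; rewrite !exprMn; ring.
- apply: is_cvg_seriesZ; exact: is_cvg_series_exp_coeff.
- exact: is_cvg_series_exp_coeff.
apply: (@eq_ccvg _ (fun L => expi (b * N%:R) * \sum_(0 <= i < L) \sum_(0 <= j < L)
     (kappa1 ^+ i / i`!%:R * (kappa2 ^+ j / j`!%:R)) * ev i j)); last exact: ccvgMl.
move=> L; rewrite mulr_sumr; apply: eq_bigr => i _; rewrite mulr_sumr.
by apply: eq_bigr => j _; rewrite mulrA.
Qed.

End Limit.

(** * Derivatives of the exponential and trigonometric series *)

Section JetLimits.
Variable R : realType.
Local Notation C := R[i].

Lemma sum_nat_shift (F : nat -> C) l M :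
  \sum_(l <= i < l + M) F i = \sum_(0 <= i < M) F (i + l)%N.
Proof. by rewrite -{1}[l]add0n big_addn addKn. Qed.

Lemma ccvg_shift (k : nat) (f : nat -> C) l : ccvg (fun n => f (n + k)%N) l -> ccvg f l.
Proof.
by move=> [h1 h2]; split;
  [rewrite -(cvg_shiftn k (fun n => complex.Re (f n)))|rewrite -(cvg_shiftn k (fun n => complex.Im (f n)))].
Qed.

(** Both sides are the image of (1 + eps (X + k))^n under the linear
    functional X^l |-> g l: the Leibniz rule with an exponential factor is the
    substitution of X + k for X. *)
Lemma binomial_functional n (g : nat -> C) eps k :
  \sum_(l < n.+1) ('C(n, l)%:R * eps ^+ l) *
     (\sum_(i < l.+1) 'C(l, i)%:R * (k ^+ i * g (l - i)%N)) =
  \sum_(l < n.+1) 'C(n, l)%:R * (1 + eps * k) ^+ (n - l) * eps ^+ l * g l.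
Proof.
pose G (q : {poly C}) := \sum_(i < n.+1) q`_i * g i.
have GD : {morph G : p q / p + q}.
  by move=> p q; rewrite /G -big_split /=; apply: eq_bigr => i _; rewrite coefD mulrDl.
have MN j (p : {poly C}) : p *+ j = (j%:R : C) *: p by rewrite scaler_nat.
have GZ a p : G (a *: p) = a * G p.
  by rewrite /G mulr_sumr; apply: eq_bigr => i _; rewrite coefZ mulrA.
have Gs I (s : seq I) (F : I -> {poly C}) : G (\sum_(i <- s) F i) = \sum_(i <- s) G (F i).
  elim: s => [|i s IH]; last by rewrite !big_cons GD IH.
  by rewrite !big_nil -(scale0r (0 : {poly C})) GZ mul0r.
have GX l : (l < n.+1)%N -> G 'X^l = g l.
  move=> ln; rewrite /G (bigD1 (Ordinal ln)) //= coefXn eqxx mul1r big1 ?addr0 // => i ni.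
  by rewrite coefXn (_ : (_ == _) = false) ?mul0r //; apply/negbTE.
have E1 l : (l < n.+1)%N -> \sum_(i < l.+1) 'C(l, i)%:R * (k ^+ i * g (l - i)%N) =
    G (('X + k%:P) ^+ l).
  move=> ln; rewrite exprDn Gs; apply: eq_bigr => i _.
  rewrite -polyC_exp [_ * (k ^+ i)%:P]mulrC mul_polyC MN !GZ GX //.
  exact: leq_ltn_trans (leq_subr _ _) ln.
transitivity (G ((1 + eps%:P * ('X + k%:P)) ^+ n)).
  rewrite exprDn Gs; apply: eq_bigr => l _.
  by rewrite E1 // expr1n mul1r exprMn -polyC_exp mul_polyC MN !GZ mulrA.
have -> : 1 + eps%:P * ('X + k%:P) = (1 + eps * k)%:P + eps *: 'X :> {poly C}.
  by rewrite -mul_polyC polyCD polyCM; ring.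
rewrite exprDn Gs; apply: eq_bigr => l _.
rewrite -polyC_exp mul_polyC exprZn MN !GZ GX //.
by rewrite !mulrA.
Qed.

(** With P tending to e^{k1 u}, conjugation by P turns 1 + eps d/du into
    (1 + eps k1) + eps d/du. *)
Lemma jet_limit (P T : nat -> {poly C}) u eps k1 e1 (g : nat -> C) n :
  (forall l, ccvg (fun L => (P L)^`(l).[u]) (k1 ^+ l * e1)) ->
  (forall l, ccvg (fun L => (T L)^`(l).[u]) (g l)) ->
  ccvg (fun L => (iter n (id_plus_D eps) (P L * T L)).[u])
   (e1 * \sum_(l < n.+1) 'C(n, l)%:R * (1 + eps * k1) ^+ (n - l) * eps ^+ l * g l).
Proof.
move=> hP hT.
apply: (@eq_ccvg _ (fun L => \sum_(l < n.+1) ('C(n, l)%:R * eps ^+ l) *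
   \sum_(i < l.+1) 'C(l, i)%:R * ((P L)^`(i).[u] * (T L)^`(l - i).[u]))).
  move=> L; rewrite iter_id_plus_DE horner_sum; apply: eq_bigr => l _.
  rewrite hornerM hornerC; congr (_ * _).
  rewrite derivnM horner_sum; apply: eq_bigr => i _.
  by rewrite -polyC_natr !hornerM hornerC.
rewrite -binomial_functional mulr_sumr.
apply: ccvg_sum => l _; rewrite mulrCA; apply: ccvgMl; rewrite mulr_sumr.
apply: ccvg_sum => i _; rewrite mulrCA; apply: ccvgMl.
by rewrite mulrA [e1 * _]mulrC; apply: ccvgM.
Qed.

Lemma derivn_sumZ (I : Type) (s : seq I) (c : I -> C) (F : I -> {poly C}) l u :
  (\sum_(i <- s) c i *: F i)^`(l).[u] = \sum_(i <- s) c i * (F i)^`(l).[u].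
Proof.
elim: s => [|i s IH]; last by rewrite !big_cons derivnD derivnZ hornerD hornerZ IH.
by rewrite !big_nil (derivnC 0) if_same hornerC.
Qed.

Definition exp_poly k1 L : {poly C} := \sum_(0 <= i < L) (k1 ^+ i / i`!%:R) *: 'X^i.

Lemma exp_poly_jet k1 u e1 l :
  ccvg (fun M => \sum_(0 <= n < M) (k1 * u) ^+ n / n`!%:R) e1 ->
  ccvg (fun L => (exp_poly k1 L)^`(l).[u]) (k1 ^+ l * e1).
Proof.
move=> he; apply: (@ccvg_shift l).
apply: (@eq_ccvg _ (fun M => k1 ^+ l * \sum_(0 <= n < M) (k1 * u) ^+ n / n`!%:R));
  last exact: ccvgMl.
move=> M; rewrite /exp_poly derivn_sumZ addnC [RHS](@big_cat_nat _ _ _ l) ?leq_addr //=.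
rewrite [X in _ = X + _]big1_seq ?add0r => [|i]; last first.
  rewrite mem_index_iota => /andP[_ /andP[_ il]].
  by rewrite /= derivnXn ffact_small // mulr0n horner0 mulr0.
rewrite [RHS]sum_nat_shift mulr_sumr; apply: eq_bigr => n _.
rewrite /= derivnXn hornerMn hornerXn addnK exprMn exprD -mulr_natr.
have := ffact_fact (leq_addl n l); rewrite addnK => /(congr1 (fun k : nat => k%:R : C)).
rewrite natrM => <-.
have f0 k : k`!%:R != 0 :> C by rewrite pnatr_eq0 -lt0n fact_gt0.
have g0 : ((n + l) ^_ l)%:R != 0 :> C by rewrite pnatr_eq0 -lt0n ffact_gt0 leq_addl.
by field; rewrite f0 g0.
Qed.

(** Truncations of the even (s = false) and odd (s = true) parts in X of
    e^{k2 X}, the latter divided by X. *)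
Definition trig_poly (s : bool) k2 r2 L : {poly C} :=
  \sum_(0 <= j < L) (if odd j == s then k2 ^+ j / j`!%:R else 0) *: ('X^2 - r2%:P) ^+ j./2.

Definition trig_half (s : bool) k2 r2 M : {poly C} :=
  \sum_(0 <= k < M) (k2 ^+ (k.*2 + s) / (k.*2 + s)`!%:R) *: ('X^2 - r2%:P) ^+ k.

(** The truncation at j < L keeps the indices j = 2 k + s with
    k < (L + 1 - s) / 2. *)
Lemma trig_polyE s k2 r2 L : trig_poly s k2 r2 L = trig_half s k2 r2 ((L + ~~ s)./2).
Proof.
elim: L => [|L IH]; first by rewrite /trig_poly /trig_half !big_geq //; case: s.
rewrite /trig_poly big_nat_recr //= -/(trig_poly _ _ _ _) IH.
rewrite uphalf_half oddD oddb.
have [oL|oL] := eqVneq (odd L) s; last first.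
  have -> : odd L (+) ~~ s = false by case: s (odd L) oL {IH} => -[].
  by rewrite scale0r addr0.
have -> : odd L (+) ~~ s = true by rewrite oL; case: (s).
have -> : (L + ~~ s)./2 = L./2.
  rewrite halfD oL oddb; case: (s); first by rewrite addn0.
  by rewrite add0n addn0.
rewrite add1n /trig_half big_nat_recr //=.
by have -> : (L./2.*2 + s)%N = L by rewrite -oL addnC odd_double_half.
Qed.

Lemma cvg_half_index (s : bool) : (fun L => (L + ~~ s)./2) @ \oo --> \oo.
Proof.
apply/cvgnyPge => A; exists A.*2 => // L /= AL.
by rewrite -(doubleK A) half_leq // (leq_trans AL) // leq_addr.
Qed.

(** The binomial coefficient C(k, m) starts the sum at k = m and turns the
    series of cos or sinc into its m-th derivative, a Bessel series. *)
Lemma trig_half_binom (s : bool) k2 q0 m (t : R) : k2 ^+ 2 * q0 = (- t ^+ 2)%:C%C ->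
  ccvg (fun M => \sum_(0 <= k < M) k2 ^+ (k.*2 + s) / (k.*2 + s)`!%:R * 'C(k, m)%:R * q0 ^+ (k - m))
   (k2 ^+ (m.*2 + s) / m`!%:R *
    (Num.sqrt (pi / 2) * 2^-1 ^+ m * tbesselJ (m%:R - 2^-1 + s%:R) t)%:C%C).
Proof.
move=> kq; apply: (@ccvg_shift m).
apply: (@eq_ccvg _ (fun M => k2 ^+ (m.*2 + s) / m`!%:R *
   (series (fun k => half_coeff R s m k * (- t ^+ 2) ^+ k) M)%:C%C)); last first.
  by apply: ccvgMl; apply: ccvg_real; exact: half_bessel.
move=> M; rewrite (addnC M m) [RHS](@big_cat_nat _ _ _ m) ?leq_addr //=.
rewrite [X in _ = X + _]big1_seq ?add0r => [|i]; last first.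
  rewrite mem_index_iota => /andP[_ /andP[_ im]].
  by rewrite bin_small // mulr0 mul0r.
rewrite [RHS]sum_nat_shift /series /= rmorph_sum mulr_sumr; apply: eq_bigr => n _.
rewrite addnK (rmorphM (real_complex R)) (rmorphXn (real_complex R)) /= -kq exprMn.
rewrite /half_coeff fmorph_div (rmorphM (real_complex R)) !rmorph_nat.
have := bin_fact (leq_addl n m); rewrite addnK => /(congr1 (fun k : nat => k%:R : C)).
rewrite !natrM [(m + n)%N]addnC => <-.
have f0 k : k`!%:R != 0 :> C by rewrite pnatr_eq0 -lt0n fact_gt0.
rewrite (_ : ((n + m).*2 + s)%N = (n.*2 + (m.*2 + s))%N); last by rewrite doubleD addnA.
have -> : k2 ^+ (n.*2 + (m.*2 + s)) = (k2 ^+ 2) ^+ n * k2 ^+ (m.*2 + s).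
  by rewrite exprD -mul2n exprM.
move: (f0 n) (f0 m) (f0 (n.*2 + (m.*2 + s))%N) => a0 b0 c0.
by field; rewrite a0 b0 c0.
Qed.

(** The l-th derivative with respect to u of the limits of trig_poly, written
    in terms of Bessel functions. *)
Definition trig_jet (s : bool) k2 u (t : R) l : C :=
  \sum_(m < l.+1) (l`! * 'C(m, l - m))%:R * (2 * u) ^+ (m.*2 - l) *
    (k2 ^+ (m.*2 + s) / m`!%:R *
    (Num.sqrt (pi / 2) * 2^-1 ^+ m * tbesselJ (m%:R - 2^-1 + s%:R) t)%:C%C).

Lemma trig_poly_jet s k2 u r2 t l : k2 ^+ 2 * (u ^+ 2 - r2) = (- t ^+ 2)%:C%C ->
  ccvg (fun L => (trig_poly s k2 r2 L)^`(l).[u]) (trig_jet s k2 u t l).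
Proof.
move=> kq.
apply: (@eq_ccvg _ ((fun M => (trig_half s k2 r2 M)^`(l).[u]) \o (fun L => (L + ~~ s)./2))).
  by move=> L; rewrite /= trig_polyE.
apply: ccvg_subseq; first exact: cvg_half_index.
apply: (@eq_ccvg _ (fun M => \sum_(m < l.+1) (l`! * 'C(m, l - m))%:R * (2 * u) ^+ (m.*2 - l) *
  \sum_(0 <= k < M) k2 ^+ (k.*2 + s) / (k.*2 + s)`!%:R * 'C(k, m)%:R * (u ^+ 2 - r2) ^+ (k - m))).
  move=> M; rewrite /trig_half derivn_sumZ.
  under [RHS]eq_bigr do rewrite derivn_quadratic mulr_sumr.
  rewrite [RHS]exchange_big /=; apply: eq_bigr => m _; rewrite mulr_sumr.
  by apply: eq_bigr => k _; rewrite natrM; ring.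
by apply: ccvg_sum => m _; apply: ccvgMl; exact: trig_half_binom.
Qed.

End JetLimits.

(** * Identification with the functions of the kernel formula *)

Section RadialLimit.
Variable R : realType.
Local Notation C := R[i].

(** The two families differ by the parity that distinguishes cosine from
    sine, and are treated together. *)
Definition star (b : bool) l (s t : R) : R := if b then Cstar l s t else Bstar l s t.

Lemma starE (b : bool) l (s t : R) : star b l s t = - \sum_(0 <= j < (l./2).+1)
      s ^+ (l - j.*2) * (2 ^+ j * j`!%:R)^-1 * (l`!%:R / (l - j.*2)`!%:R) *
      tbesselJ ((l - j)%:R - 2^-1 + b%:R) t.
Proof.
have E j : (j < (l./2).+1)%N -> (l - j)%:R = l%:R - j%:R :> R.
  rewrite ltnS geq_half_double => j2l.
  by rewrite natrB // (leq_trans _ j2l) // -addnn leq_addr.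
have T (F G : nat -> R) (c : nat -> R) : (forall j, (j < (l./2).+1)%N -> F j = G j) ->
   - \sum_(0 <= j < (l./2).+1) c j * tbesselJ (F j) t =
   - \sum_(0 <= j < (l./2).+1) c j * tbesselJ (G j) t.
  by move=> FG; apply: congr1; apply: eq_big_nat => j /andP[_ jl]; rewrite FG.
by case: b => /=; apply: T => j jl; rewrite E //; [field|rewrite addr0].
Qed.

(** The index j of B_l^* and C_l^* is l - m, m being the order of derivation
    in half_bessel; the terms with 2 m < l vanish with C(m, l - m), which leaves
    j <= l / 2. *)
Lemma trig_jetE (b : bool) (k u t : R) l :
  trig_jet b k%:C%C u%:C%C t l =
  (- (Num.sqrt (pi / 2) * k ^+ (l + b) * star b l (k * u) t))%:C%C.
Proof.
have -> : trig_jet b k%:C%C u%:C%C t l =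
   (\sum_(m < l.+1) (l`! * 'C(m, l - m))%:R * (2 * u) ^+ (m.*2 - l) *
    (k ^+ (m.*2 + b) / m`!%:R *
    (Num.sqrt (pi / 2) * 2^-1 ^+ m * tbesselJ (m%:R - 2^-1 + b%:R) t)))%:C%C.
  rewrite /trig_jet rmorph_sum; apply: eq_bigr => m _.
  have c2 : (2 : C) = (2 : R)%:C%C by rewrite rmorph_nat.
  by rewrite c2 !rmorphM /= fmorphV !rmorphXn /= !rmorphM /= !rmorph_nat.
congr (_%:C)%C.
rewrite (reindex_inj rev_ord_inj) /=.
rewrite starE [in RHS]mulrN opprK mulr_sumr.
rewrite -(big_mkord xpredT (fun i => (l`! * 'C(l.+1 - i.+1, l - (l.+1 - i.+1)))%:R *
  (2 * u) ^+ ((l.+1 - i.+1).*2 - l) * (k ^+ ((l.+1 - i.+1).*2 + b) / (l.+1 - i.+1)`!%:R *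
  (Num.sqrt (pi / 2) * 2^-1 ^+ (l.+1 - i.+1) * tbesselJ ((l.+1 - i.+1)%:R - 2^-1 + b%:R) t)))).
rewrite (@big_cat_nat _ _ _ (l./2).+1) //=; last first.
  by rewrite ltnS -{2}(odd_double_half l) (leq_trans _ (leq_addl _ _)) // -addnn leq_addr.
rewrite [X in _ + X]big1_seq ?addr0; last first.
  move=> j; rewrite mem_index_iota => /andP[_ /andP[lj jl]].
  rewrite ltnS in jl; rewrite subSS subKn // bin_small ?muln0 ?mul0r //.
  by rewrite ltn_subLR // addnn -ltn_half_double.
apply: eq_big_nat => j /andP[_]; rewrite ltnS geq_half_double => j2l.
have jl : (j <= l)%N by rewrite (leq_trans _ j2l) // -addnn leq_addr.
have h1 : ((l - j).*2 - l)%N = (l - j.*2)%N.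
  by rewrite doubleB -subnDA addnC subnDA -addnn addnK.
rewrite subSS subKn // h1.
set J := tbesselJ _ t; set sq := Num.sqrt _.
have f0 n : n`!%:R != 0 :> R by rewrite pnatr_eq0 -lt0n fact_gt0.
have fE : 'C(l - j, j)%:R = (l - j)`!%:R / (j`!%:R * (l - j.*2)`!%:R) :> R.
  have := @bin_fact (l - j) j; rewrite leq_subRL // addnn => /(_ j2l).
  rewrite -subnDA addnn => /(congr1 (fun k : nat => k%:R : R)).
  rewrite !natrM => <-; field.
  by rewrite !f0.
have e1 : k ^+ ((l - j).*2 + b) = k ^+ (l + b) * k ^+ (l - j.*2).
  by rewrite doubleB -exprD -addnn -addnBA // addnAC.
have e2 : (2 : R) ^+ (l - j) = 2 ^+ (l - j.*2) * 2 ^+ j.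
  by rewrite -exprD -addnn subnDA subnK // leq_subRL // addnn.
rewrite natrM fE e1 exprVn e2 !exprMn.
have p0 n : (2 : R) ^+ n != 0 by rewrite expf_neq0 // pnatr_eq0.
move: (f0 (l - j)%N) (f0 j) (f0 (l - j.*2)%N) (p0 (l - j.*2)%N) (p0 j) => a0 b0 c0 d0 g0.
by field; rewrite ?a0 ?b0 ?c0 ?d0 ?g0.
Qed.

Variables (a b uu rr t : R) (N : nat).
Hypotheses (a0 : a != 0) (ht : t ^+ 2 = (a * sin b) ^+ 2 * (rr - uu ^+ 2)).

(** The plane wave is e^{wave_del u} with a = 1 / sin alpha. *)
Definition wave_del : C := - ('i%C * a%:C%C).
Definition wave_eps : C := 'i%C * (a^-1)%:C%C.

Lemma wave_eps_del : wave_eps * wave_del = 1.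
Proof.
rewrite /wave_eps /wave_del; transitivity (- ('i%C ^+ 2) * (a^-1 * a)%:C%C : C).
  by rewrite (rmorphM (real_complex R)) /=; ring.
by rewrite sqr_i opprK mulVf // mulr1.
Qed.

Lemma kappa2E : kappa2 wave_del b = (a * sin b)%:C%C.
Proof.
rewrite /kappa2 /wave_del; transitivity (- ('i%C ^+ 2) * (a * sin b)%:C%C : C).
  by rewrite (rmorphM (real_complex R)) /=; ring.
by rewrite sqr_i opprK mul1r.
Qed.

Lemma kappa1_eps : 1 + wave_eps * kappa1 wave_del b = (cos b)%:C%C.
Proof.
by rewrite /kappa1 mulrA wave_eps_del mul1r addrC subrK.
Qed.

Lemma wave_eps_pow l : wave_eps ^+ l * ((a * sin b) ^+ l)%:C%C = ('i%C * (sin b)%:C%C) ^+ l.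
Proof.
rewrite (rmorphXn (real_complex R)) /= -exprMn; congr (_ ^+ _).
transitivity ('i%C * (a^-1 * a * sin b)%:C%C : C).
  by rewrite /wave_eps !(rmorphM (real_complex R)) /=; ring.
by rewrite mulVf // mul1r.
Qed.

(** The common shape of the sums in the kernel formula, with the powers of
    cos b multiplied out. *)
Definition star_sum (s : bool) n : C :=
  \sum_(0 <= l < n.+1) 'C(n, l)%:R * ('i%C * (sin b)%:C%C) ^+ l *
    (cos b ^+ (n - l))%:C%C * (star s l (a * sin b * uu) t)%:C%C.

Lemma trig_sumE (s : bool) n :
  \sum_(l < n.+1) 'C(n, l)%:R * (1 + wave_eps * kappa1 wave_del b) ^+ (n - l) * wave_eps ^+ l *
    trig_jet s (kappa2 wave_del b) uu%:C%C t l =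
  - (Num.sqrt (pi / 2) * (a * sin b) ^+ s)%:C%C * star_sum s n.
Proof.
rewrite /star_sum big_mkord mulr_sumr; apply: eq_bigr => l _.
rewrite kappa1_eps kappa2E trig_jetE -wave_eps_pow exprD.
rewrite -(rmorphXn (real_complex R)) /= (rmorphN (real_complex R)) /=.
by rewrite !(rmorphM (real_complex R)) /=; ring.
Qed.

Lemma cvg_kappa1 : ccvg (fun M => \sum_(0 <= n < M) (kappa1 wave_del b * uu%:C%C) ^+ n / n`!%:R)
  (expi (- (a * (cos b - 1) * uu))).
Proof.
suff -> : kappa1 wave_del b * uu%:C%C = 'i%C * (- (a * (cos b - 1) * uu))%:C%C by exact: cvg_expi.
rewrite /kappa1 /wave_del (rmorphN (real_complex R)) !(rmorphM (real_complex R)) /=.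
by rewrite (rmorphB (real_complex R)) /=; ring.
Qed.

Lemma kappa2_quad : kappa2 wave_del b ^+ 2 * (uu%:C%C ^+ 2 - rr%:C%C) = (- t ^+ 2)%:C%C.
Proof.
rewrite kappa2E ht -!(rmorphXn (real_complex R)) /= -(rmorphB (real_complex R)) /=.
by rewrite -(rmorphM (real_complex R)) /=; congr (_%:C)%C; ring.
Qed.

Definition exp_factor L := exp_poly (kappa1 wave_del b) L.
Definition trig_factor s L := trig_poly s (kappa2 wave_del b) rr%:C%C L.

Lemma trig_limit (s : bool) n :
  ccvg (fun L => (iter n (id_plus_D wave_eps) (exp_factor L * trig_factor s L)).[uu%:C%C])
   (expi (- (a * (cos b - 1) * uu)) *
     (- (Num.sqrt (pi / 2) * (a * sin b) ^+ s)%:C%C * star_sum s n)).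
Proof.
rewrite -trig_sumE; apply: jet_limit.
  by move=> l; apply: exp_poly_jet; exact: cvg_kappa1.
by move=> l; apply: trig_poly_jet; exact: kappa2_quad.
Qed.

Lemma pair_mon_sum L :
  \sum_(0 <= i < L) \sum_(0 <= j < L)
    ((kappa1 wave_del b ^+ i / i`!%:R) * (kappa2 wave_del b ^+ j / j`!%:R)) *: pair_mon rr%:C%C i j =
  (exp_factor L * trig_factor false L, exp_factor L * trig_factor true L).
Proof.
rewrite /exp_factor /trig_factor /exp_poly /trig_poly !mulr_suml.
have E1 : forall F : nat -> {poly C} * {poly C}, \sum_(0 <= i < L) F i =
   (\sum_(0 <= i < L) (F i).1, \sum_(0 <= i < L) (F i).2).
  by move=> F; rewrite -pair1_sum -pair2_sum; case: (\sum_(0 <= i < L) F i).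
rewrite E1; congr pair; apply: eq_bigr => i _; rewrite E1 /= mulr_sumr;
  apply: eq_bigr => j _; rewrite /pair_mon; case: (odd j) => /=;
  rewrite ?scaler0 ?scale0r ?mulr0 //; by rewrite -!mul_polyC polyCM; ring.
Qed.

Let cf i j : C := kappa1 wave_del b ^+ i / i`!%:R * (kappa2 wave_del b ^+ j / j`!%:R).

Lemma iter_raise_dim_mon_sum L :
  iter N (raise_dim wave_eps) (exp_factor L * trig_factor false L, exp_factor L * trig_factor true L) =
  \sum_(0 <= i < L) \sum_(0 <= j < L) cf i j *: iter N (raise_dim wave_eps) (pair_mon rr%:C%C i j).
Proof.
rewrite -pair_mon_sum.
rewrite (_ : \sum_(0 <= i < L) _ = \sum_(0 <= i < L) 1 *: \sum_(0 <= j < L)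
    cf i j *: pair_mon rr%:C%C i j); last by apply: eq_bigr => i _; rewrite scale1r.
by rewrite iter_raise_dim_sum; apply: eq_bigr => i _; rewrite scale1r iter_raise_dim_sum.
Qed.

Lemma raised2_sum L :
  \sum_(0 <= i < L) \sum_(0 <= j < L) cf i j * raised2 wave_eps rr%:C%C uu%:C%C N i j =
  (iter N (id_plus_D wave_eps) (exp_factor L * trig_factor true L)).[uu%:C%C].
Proof.
have := congr1 (fun p => p.2.[uu%:C%C]) (iter_raise_dim_mon_sum L).
rewrite iter_raise_dim /= => ->; rewrite pair2_sum horner_sum; apply: eq_bigr => i _.
by rewrite pair2_sum horner_sum; apply: eq_bigr => j _; rewrite /= hornerZ.
Qed.

Lemma raised1_sum L :
  \sum_(0 <= i < L) \sum_(0 <= j < L) cf i j * raised1 wave_eps rr%:C%C uu%:C%C N i j =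
  (iter N (id_plus_D wave_eps) (exp_factor L * trig_factor false L)).[uu%:C%C] -
     N%:R * wave_eps * (iter N.-1 (id_plus_D wave_eps) (exp_factor L * trig_factor true L)).[uu%:C%C].
Proof.
have := congr1 (fun p => p.1.[uu%:C%C]) (iter_raise_dim_mon_sum L).
rewrite iter_raise_dim /= hornerD hornerN -polyC_natr -polyCM hornerM hornerC => ->.
rewrite pair1_sum horner_sum; apply: eq_bigr => i _.
by rewrite pair1_sum horner_sum; apply: eq_bigr => j _; rewrite /= hornerZ.
Qed.

Lemma rho_exists : exists rho : R,
  [/\ 1 <= rho, normc (uu%:C%C : C) <= rho & normc (uu%:C%C ^+ 2 - rr%:C%C : C) <= rho ^+ 2].
Proof.
set A := normc (uu%:C%C : C); set B := normc (uu%:C%C ^+ 2 - rr%:C%C : C).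
have A0 : 0 <= A by exact: normc_ge0.
have B0 : 0 <= B by exact: normc_ge0.
exists (1 + A + B); split; [lra|lra|].
by rewrite expr2; nra.
Qed.

(** The bivector part, which only involves the odd part of e^{kappa2 X}. *)
Lemma radial_limit2 :
  ccvg (fun M => \sum_(0 <= n < M) (('i%C * b%:C%C) ^+ n / n`!%:R) *
      (iter n (Gamma_pair wave_del rr%:C%C N) (1, 0)).2.[uu%:C%C])
   (expi (b * N%:R) * (expi (- (a * (cos b - 1) * uu)) *
     (- (Num.sqrt (pi / 2) * (a * sin b))%:C%C * star_sum true N))).
Proof.
have [rho [rho1 hu hq]] := rho_exists.
apply: (@double_series_limit _ wave_del N b (raised2 wave_eps rr%:C%C uu%:C%C N) _
   (raised_const wave_eps N) (growth wave_eps rho)).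
- by rewrite /raised_const !mulr_ge0 ?expR_ge0 ?addr_ge0 ?mulr_ge0 ?normc_ge0.
- by apply: (le_trans _ (growth_ge1 wave_eps rho1)).
- by move=> i j; exact: raised2_bound.
- by move=> n M nM; apply: iter_Gamma_pair_raised2 => //; exact: wave_eps_del.
have := trig_limit true N; rewrite expr1; apply: eq_ccvg => L.
by rewrite -raised2_sum.
Qed.

(** The scalar part: the even part of e^{kappa2 X} gives the sum B, and the
    off-diagonal part of raise_dim^N gives the sum A, with one power of
    id_plus_D less. *)
Lemma radial_limit1 :
  ccvg (fun M => \sum_(0 <= n < M) (('i%C * b%:C%C) ^+ n / n`!%:R) *
      (iter n (Gamma_pair wave_del rr%:C%C N) (1, 0)).1.[uu%:C%C])
   (expi (b * N%:R) * (expi (- (a * (cos b - 1) * uu)) *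
     (- (Num.sqrt (pi / 2))%:C%C * star_sum false N +
      N%:R * 'i%C * (Num.sqrt (pi / 2) * sin b)%:C%C * star_sum true N.-1))).
Proof.
have [rho [rho1 hu hq]] := rho_exists.
apply: (@double_series_limit _ wave_del N b (raised1 wave_eps rr%:C%C uu%:C%C N) _
   (raised_const wave_eps N) (growth wave_eps rho)).
- by rewrite /raised_const !mulr_ge0 ?expR_ge0 ?addr_ge0 ?mulr_ge0 ?normc_ge0.
- by apply: (le_trans _ (growth_ge1 wave_eps rho1)).
- by move=> i j; exact: raised1_bound.
- by move=> n M nM; apply: iter_Gamma_pair_raised1 => //; exact: wave_eps_del.
apply: (@eq_ccvg _ (fun L => (iter N (id_plus_D wave_eps) (exp_factor L * trig_factor false L)).[uu%:C%C] +
     - (N%:R * wave_eps) * (iter N.-1 (id_plus_D wave_eps) (exp_factor L * trig_factor true L)).[uu%:C%C])).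
  by move=> L; rewrite raised1_sum mulNr.
have h := ccvgD (trig_limit false N) (ccvgMl (- (N%:R * wave_eps)) (trig_limit true N.-1)).
rewrite expr0 mulr1 expr1 in h.
apply: (ccvg_eq h); rewrite [RHS]mulrDr; congr (_ + _).
have -> : Num.sqrt (pi / 2) * sin b = a^-1 * (Num.sqrt (pi / 2) * (a * sin b)).
  by field.
rewrite (rmorphM (real_complex R) a^-1) /wave_eps /=.
by ring.
Qed.

End RadialLimit.

(** * Vectors and bivectors in a Clifford algebra *)

Section CliffordVectors.
Variables (K : comNzRingType) (A : algType K) (m : nat) (e : 'I_m -> A).
Hypothesis e_sqr : forall j, e j * e j = -1.
Hypothesis e_anti : forall j k, j != k -> e j * e k + e k * e j = 0.
Implicit Types (x y : 'I_m -> K).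

(** The vector with coordinates x; avec x * avec y has scalar part
    - <x, y> and bivector part x /\ y. *)
Definition avec x : A := \sum_(j < m) x j *: e j.
Definition adot x y : K := \sum_(j < m) x j * y j.
Definition awedge x y : A :=
  \sum_(j < m) \sum_(k < m | (j < k)%N) (x j * y k - x k * y j) *: (e j * e k).

Lemma adotC x y : adot x y = adot y x.
Proof. by apply: eq_bigr => j _; rewrite mulrC. Qed.

Lemma sum_offdiag (V : zmodType) (F : 'I_m -> 'I_m -> V) :
  \sum_(j < m) \sum_(k < m) F j k =
  \sum_(j < m) \sum_(k < m | (j < k)%N) (F j k + F k j) + \sum_(j < m) F j j.
Proof.
have E j : \sum_(k < m) F j k = \sum_(k < m | (j < k)%N) F j k +
    \sum_(k < m | (k < j)%N) F j k + F j j.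
  rewrite (bigID (fun k : 'I_m => (j < k)%N)) /= -addrA; congr (_ + _).
  rewrite (bigID (fun k : 'I_m => (k < j)%N)) /=; congr (_ + _).
    by apply: eq_bigl => k; case: ltngtP.
  rewrite (bigD1 j) ?ltnn //= big1 ?addr0 // => k /andP[/andP[h1 h2] kj].
  by case/negP: kj; rewrite -val_eqE /= eqn_leq; apply/andP; split; rewrite leqNgt.
under eq_bigr do rewrite E; rewrite !big_split /=; congr (_ + _).
rewrite [in X in _ + X](exchange_big_dep xpredT) //= -big_split /=.
by apply: eq_bigr => j _; rewrite -big_split.
Qed.

Lemma avecM x y : avec x * avec y = \sum_(j < m) \sum_(k < m) (x j * y k) *: (e j * e k).
Proof.
rewrite /avec mulr_suml; apply: eq_bigr => j _; rewrite mulr_sumr; apply: eq_bigr => k _.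
by rewrite -scalerAl -scalerAr scalerA.
Qed.

Lemma e_swap (j k : 'I_m) : (j < k)%N -> e k * e j = - (e j * e k).
Proof.
move=> jk; apply/eqP; rewrite -addr_eq0 e_anti //.
by rewrite -val_eqE /= gtn_eqF.
Qed.

Lemma awedgeE x y : awedge x y = avec x * avec y + (adot x y)%:A.
Proof.
rewrite avecM sum_offdiag -addrA [X in _ + X](_ : _ = 0) ?addr0.
  apply: eq_bigr => j _; apply: eq_bigr => k jk.
  by rewrite (e_swap jk) scalerN -scalerBl.
rewrite /adot scaler_suml -big_split big1 //= => j _.
by rewrite e_sqr scalerN addNr.
Qed.

Lemma awedgeC x y : awedge x y = - awedge y x.
Proof.
rewrite /awedge -sumrN; apply: eq_bigr => j _; rewrite -sumrN; apply: eq_bigr => k _.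
by rewrite -[RHS]scaleNr; congr (_ *: _); ring.
Qed.

Lemma avec_swap x y : avec y * avec x = - awedge x y - (adot x y)%:A.
Proof. by rewrite awedgeC opprK awedgeE adotC addrK. Qed.

Lemma avec_sqr x : avec x * avec x = - (adot x x)%:A.
Proof.
have W0 : awedge x x = 0.
  rewrite /awedge big1 // => j _; rewrite big1 // => k _.
  by rewrite (_ : _ - _ = 0) ?scale0r //; ring.
by rewrite avec_swap W0 oppr0 add0r.
Qed.

Lemma awedge_sqr x y :
  awedge x y * awedge x y = (adot x y ^+ 2 - adot x x * adot y y)%:A.
Proof.
have yW : avec y * awedge x y = adot y y *: avec x - adot x y *: avec y.
  rewrite awedgeE mulrDr mulrA avec_swap awedgeE -scalerAr mulr1 !mulrBl mulNr mulrDl.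
  rewrite -!scalerAl !mul1r -mulrA avec_sqr mulrN -scalerAr mulr1 opprD opprK.
  by rewrite subrK.
rewrite {1}awedgeE mulrDl -mulrA yW mulrBr -!scalerAr avec_sqr -scalerAl mul1r.
rewrite awedgeE scalerDr addrA subrK scalerN !scalerA addrC -scalerBl.
by congr (_ *: _); ring.
Qed.

(** Moving e_k through x changes the sign except along e_k itself. *)
Lemma sum_avec_conj x : \sum_(k < m) e k * (avec x * e k) = (m%:R - 2) *: avec x.
Proof.
have E k : avec x * e k = - (e k * avec x) - (2 * x k)%:A.
  rewrite /avec mulr_suml mulr_sumr -sumrN.
  rewrite (bigD1 k) //= [X in _ = X - _](bigD1 k) //= -scalerAl -scalerAr e_sqr.
  rewrite addrAC; congr (_ + _).
    by rewrite mulrDl mul1r scalerDl scalerN opprK opprD addrA subrr add0r.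
  apply: eq_bigr => i ik; rewrite -scalerAl -scalerAr -scalerN; congr (_ *: _).
  by apply/eqP; rewrite -addr_eq0 e_anti.
under eq_bigr do rewrite E mulrBr mulrN mulrA e_sqr mulN1r opprK -scalerAr mulr1.
rewrite big_split /= sumr_const card_ord sumrN scalerBl scaler_nat; congr (_ - _).
by rewrite /avec scaler_sumr; apply: eq_bigr => k _; rewrite scalerA.
Qed.

(** The derivative of x /\ y with respect to y_k. *)
Definition dwedge x (k : 'I_m) : A := avec x * e k + (x k)%:A.

Lemma awedge_linear x y : awedge x y = \sum_(k < m) y k *: dwedge x k.
Proof.
rewrite awedgeE {2}/avec mulr_sumr /adot scaler_suml -big_split; apply: eq_bigr => k _.
by rewrite /dwedge scalerDr -scalerAr scalerA mulrC.
Qed.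

Lemma sum_dwedge x : \sum_(k < m) e k * dwedge x k = (m%:R - 1) *: avec x.
Proof.
under eq_bigr do rewrite /dwedge mulrDr -scalerAr mulr1.
rewrite big_split /= sum_avec_conj -/(avec x) -[X in _ + X]scale1r -scalerDl.
by congr (_ *: _); ring.
Qed.

(** Gamma is the bivector part of the product of y with the Dirac operator; the
    rest of that product is minus the Euler operator, which is added back. *)
Lemma tangential_sum y (c : 'I_m -> A) :
  \sum_(j < m) \sum_(k < m | (j < k)%N) e j * e k * (y j *: c k - y k *: c j) =
  avec y * (\sum_(k < m) e k * c k) + \sum_(j < m) y j *: c j.
Proof.
have -> : avec y * (\sum_(k < m) e k * c k) =
    \sum_(j < m) \sum_(k < m) e j * e k * (y j *: c k).
  rewrite /avec mulr_suml; apply: eq_bigr => j _; rewrite mulr_sumr; apply: eq_bigr => k _.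
  by rewrite -scalerAl -scalerAr mulrA.
rewrite sum_offdiag -addrA [X in _ + X](_ : _ = 0) ?addr0.
  apply: eq_bigr => j _; apply: eq_bigr => k jk.
  by rewrite (e_swap jk) mulNr mulrBr.
by rewrite -big_split big1 //= => j _; rewrite e_sqr mulN1r addNr.
Qed.

(** Here c k is the derivative with respect to y_k of f + W g, when f and g have
    gradients f' x + p y and g' x + q y. By tangential_sum the sum is computed
    inside the commutative algebra generated by W, where p and q cancel. *)
Lemma Gamma_algebra x y (f' g g' p q : K) :
  let W := awedge x y in let u := adot x y in
  let c k := (f' * x k + p * y k)%:A + ((g' * x k + q * y k) *: W + g *: dwedge x k) in
  - (\sum_(j < m) \sum_(k < m | (j < k)%N) e j * e k * (y j *: c k - y k *: c j)) =
  ((m%:R - 1) * u * g + (u ^+ 2 - adot x x * adot y y) * g')%:A +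
  (f' + (m%:R - 2) * g) *: W.
Proof.
move=> W u c; rewrite tangential_sum.
have S1 : \sum_(k < m) e k * c k =
    (f' *: avec x + p *: avec y) + ((g' *: avec x + q *: avec y) * W + (g * (m%:R - 1)) *: avec x).
  rewrite /c; under eq_bigr do rewrite !mulrDr -!scalerAr mulr1.
  rewrite !big_split /=; congr (_ + (_ + _)).
  - rewrite /avec !scaler_sumr -big_split; apply: eq_bigr => k _.
    by rewrite !scalerA scalerDl.
  - rewrite /avec !scaler_sumr -big_split /= mulr_suml; apply: eq_bigr => k _.
    by rewrite !scalerA -scalerDl -scalerAl.
  - by rewrite -scaler_sumr sum_dwedge scalerA.
have S2 : \sum_(j < m) y j *: c j =
   (f' * u + p * adot y y)%:A + ((g' * u + q * adot y y) *: W + g *: W).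
  rewrite /c; under eq_bigr do rewrite 2!scalerDr !scalerA.
  rewrite !big_split /=; congr (_ + (_ + _)).
  - rewrite -scaler_suml; congr (_ *: _).
    by rewrite /u /adot !mulr_sumr -big_split; apply: eq_bigr => k _ /=; ring.
  - rewrite -scaler_suml; congr (_ *: _).
    by rewrite /u /adot !mulr_sumr -big_split; apply: eq_bigr => k _ /=; ring.
  - by rewrite [in RHS]/W awedge_linear scaler_sumr; apply: eq_bigr => k _; rewrite scalerA mulrC.
have yx : avec y * avec x = - W - u%:A by exact: avec_swap.
have WW : W * W = (u ^+ 2 - adot x x * adot y y)%:A by exact: awedge_sqr.
pose Phi (a b : K) : A := a%:A + b *: W.
have PhiD a b a' b' : Phi a b + Phi a' b' = Phi (a + a') (b + b').
  by rewrite /Phi addrACA -!scalerDl.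
have PhiN a b : - Phi a b = Phi (- a) (- b) by rewrite /Phi opprD !scaleNr.
have PhiZ k a b : k *: Phi a b = Phi (k * a) (k * b) by rewrite /Phi scalerDr !scalerA.
have PhiW a b : Phi a b * W = Phi (b * (u ^+ 2 - adot x x * adot y y)) a.
  by rewrite /Phi mulrDl -!scalerAl mul1r WW scalerA addrC.
have yxE : avec y * avec x = Phi (- u) (- 1).
  by rewrite yx /Phi !scaleNr scale1r addrC.
have yyE : avec y * avec y = Phi (- adot y y) 0.
  by rewrite avec_sqr /Phi scale0r addr0 scaleNr.
rewrite S1 S2 !mulrDr mulrA !mulrDr -!scalerAr yxE yyE -/(Phi _ _) !PhiZ !PhiD PhiW.
rewrite (_ : g *: W = Phi 0 g); last by rewrite /Phi scale0r add0r.
rewrite (_ : (g' * u + q * adot y y) *: W = Phi 0 (g' * u + q * adot y y)); last first.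
  by rewrite /Phi scale0r add0r.
rewrite (_ : (f' * u + p * adot y y)%:A = Phi (f' * u + p * adot y y) 0); last first.
  by rewrite /Phi scale0r addr0.
rewrite !PhiD PhiN /Phi; congr (_ *: _ + _ *: _); ring.
Qed.

End CliffordVectors.

(** * Derivatives along spheres *)

Section LineDerivatives.
Variable R : realType.
Local Notation C := R[i].
Implicit Types (f g : R -> C) (a b : C).

(** Derivatives at 0, since they serve to compute partial derivatives along
    the coordinate lines h |-> h e_k + y. *)
Definition cder f a :=
  is_derive (0 : R) 1 (fun h => complex.Re (f h)) (complex.Re a) /\
  is_derive (0 : R) 1 (fun h => complex.Im (f h)) (complex.Im a).

Lemma is_derive_ext (V W : normedModType R) (x v : V) (f g : V -> W) (l l' : W) :
  f =1 g -> l = l' -> is_derive x v f l -> is_derive x v g l'.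
Proof. by move=> /funext -> ->. Qed.

Lemma cder_ext f g a b : f =1 g -> a = b -> cder f a -> cder g b.
Proof. by move=> /funext -> ->. Qed.

Lemma cder_cst a : cder (fun=> a) 0.
Proof. by split; exact: is_derive_cst. Qed.

Lemma cderD f g a b : cder f a -> cder g b -> cder (fun h => f h + g h) (a + b).
Proof.
move=> [f1 f2] [g1 g2]; split.
  by apply: is_derive_ext (is_deriveD f1 g1) => [h|]; rewrite ?fctE ReD.
by apply: is_derive_ext (is_deriveD f2 g2) => [h|]; rewrite ?fctE ImD.
Qed.

Lemma cderM f g a b : cder f a -> cder g b -> cder (fun h => f h * g h) (a * g 0 + f 0 * b).
Proof.
move=> [f1 f2] [g1 g2]; split.
  apply: is_derive_ext (is_deriveB (is_deriveM f1 g1) (is_deriveM f2 g2)) => [h|].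
    by rewrite !fctE ReM.
  by rewrite ReD !ReM /GRing.scale /=; ring.
apply: is_derive_ext (is_deriveD (is_deriveM f1 g2) (is_deriveM f2 g1)) => [h|].
  by rewrite !fctE ImM.
by rewrite ImD !ImM /GRing.scale /=; ring.
Qed.

Lemma cder_real (f : R -> R) (a : R) : is_derive (0 : R) 1 f a ->
  cder (fun h => (f h)%:C%C) a%:C%C.
Proof. by move=> fa; split => //=; exact: is_derive_cst. Qed.

Lemma cder_expi (f : R -> R) (a : R) : is_derive (0 : R) 1 f a ->
  cder (fun h => expi (f h)) (expi (f 0) * ('i%C * a%:C%C)).
Proof.
move=> fa; split.
  apply: is_derive_ext (@is_derive1_comp _ cos f 0 _ _ (is_derive_cos _) fa) => [h|] //.
  by rewrite /expi /=; ring.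
apply: is_derive_ext (@is_derive1_comp _ sin f 0 _ _ (is_derive_sin _) fa) => [h|] //.
by rewrite /expi /=; ring.
Qed.

Lemma cder_affine (c d : R) : is_derive (0 : R) 1 (fun h => h * c + d) c.
Proof.
by apply: is_derive_eq; rewrite /GRing.scale /= mulr0 mulr1 addr0 add0r.
Qed.

Lemma is_derive_line (V : normedModType R) (f : V -> R) (y v : V) (a : R) :
  is_derive (0 : R) 1 (fun h => f (h *: v + y)) a -> is_derive y v f a.
Proof.
move=> [d E].
have F : (fun h : R => h^-1 *: (((fun h => f (h *: v + y)) \o shift 0) (h *: (1 : R)) -
     (fun h => f (h *: v + y)) 0)) =
   (fun h => h^-1 *: ((f \o shift y) (h *: v) - f y)).
  by apply/funext => h; rewrite /= addr0 scale0r add0r /GRing.scale /= mulr1.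
split; first by move: d; rewrite /derivable F.
by move: E; rewrite /derive F.
Qed.

End LineDerivatives.

Section Tangential.
Variables (R : realType) (m : nat) (x : 'rV[R]_m).
Local Notation C := R[i].
Local Notation line y k h := (h *: delta_mx 0 k + y).
Implicit Types (phi : 'rV[R]_m -> C) (y : 'rV[R]_m).

(** The gradient of phi at y is phi'(y) x + psi(y) y. The radial component psi
    is left unspecified, because Gamma does not see it. *)
Definition tangential phi phi' := exists psi : 'rV[R]_m -> C, forall y (k : 'I_m),
  cder (fun h : R => phi (line y k h)) (phi' y * (x 0 k)%:C%C + psi y * (y 0 k)%:C%C).

Lemma line0 y (k : 'I_m) : line y k 0 = y.
Proof. by rewrite scale0r add0r. Qed.

Lemma lineE y (k j : 'I_m) (h : R) : (line y k h) 0 j = h * (j == k)%:R + y 0 j.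
Proof. by rewrite !mxE eqxx. Qed.

Lemma dot_line y (k : 'I_m) (h : R) : dot x (line y k h) = h * x 0 k + dot x y.
Proof.
rewrite /dot; under eq_bigr do rewrite lineE mulrDr.
rewrite big_split /= (bigD1 k) //= eqxx mulr1 big1 ?addr0 => [|j /negbTE ->].
  by rewrite mulrC.
by rewrite !mulr0.
Qed.

Lemma dot_line_sqr y (k : 'I_m) (h : R) :
  dot (line y k h) (line y k h) = h * (h + 2 * y 0 k) + dot y y.
Proof.
rewrite /dot; under eq_bigr do rewrite !lineE.
rewrite (bigD1 k) //= [in RHS](bigD1 k) //= eqxx.
rewrite (eq_bigr (fun j => y 0 j * y 0 j)) => [|j /negbTE ->]; first by rewrite mulr1n; ring.
by rewrite mulr0n mulr0 add0r.
Qed.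

Lemma tangential_ext phi psi phi' psi' : phi =1 psi -> phi' =1 psi' -> tangential phi phi' -> tangential psi psi'.
Proof. by move=> /funext -> /funext ->. Qed.

Lemma tangential_cst a : tangential (fun=> a) (fun=> 0).
Proof.
exists (fun=> 0) => y k; apply: cder_ext (cder_cst a) => //.
by rewrite !mul0r addr0.
Qed.

Lemma tangentialD phi phi' psi psi' : tangential phi phi' -> tangential psi psi' ->
  tangential (fun y => phi y + psi y) (fun y => phi' y + psi' y).
Proof.
move=> [p hp] [q hq]; exists (fun y => p y + q y) => y k.
by apply: cder_ext (cderD (hp y k) (hq y k)) => //; ring.
Qed.

Lemma tangentialM phi phi' psi psi' : tangential phi phi' -> tangential psi psi' ->
  tangential (fun y => phi y * psi y) (fun y => phi' y * psi y + phi y * psi' y).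
Proof.
move=> [p hp] [q hq]; exists (fun y => p y * psi y + phi y * q y) => y k.
apply: cder_ext (cderM (hp y k) (hq y k)) => //; rewrite !line0; ring.
Qed.

Lemma tangential_dot : tangential (fun y => (dot x y)%:C%C) (fun=> 1).
Proof.
exists (fun=> 0) => y k.
apply: cder_ext (cder_real (cder_affine (x 0 k) (dot x y))) => [h|].
  by rewrite dot_line.
by rewrite mul1r mul0r addr0.
Qed.

Lemma tangential_radius : tangential (fun y => (dot x x * dot y y)%:C%C) (fun=> 0).
Proof.
exists (fun=> (2 * dot x x)%:C%C) => y k.
have d : is_derive (0 : R) 1
    (fun h : R => dot x x * (h * (h + 2 * y 0 k) + dot y y)) (2 * dot x x * y 0 k).
  by apply: is_derive_eq; rewrite /GRing.scale /=; ring.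
apply: cder_ext (cder_real d) => [h|]; first by rewrite dot_line_sqr.
by rewrite mul0r add0r (rmorphM (real_complex R)).
Qed.

Lemma tangential_expi (c : R) :
  tangential (fun y => expi (c * dot x y)) (fun y => 'i%C * c%:C%C * expi (c * dot x y)).
Proof.
exists (fun=> 0) => y k.
have d : is_derive (0 : R) 1 (fun h : R => c * (h * x 0 k + dot x y)) (c * x 0 k).
  by apply: is_derive_eq; rewrite /GRing.scale /=; ring.
apply: cder_ext (cder_expi d) => [h|]; first by rewrite dot_line.
by rewrite mul0r add0r mul0r addr0 (rmorphM (real_complex R)) /=; ring.
Qed.

(** Polynomials in <x, y> whose coefficients are polynomials in
    |x|^2 |y|^2. *)
Definition eval_dots (F : {poly {poly C}}) y : C :=
  F.[((dot x y)%:C%C)%:P].[(dot x x * dot y y)%:C%C].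

Lemma tangential_poly_radius (p : {poly C}) : tangential (fun y => p.[(dot x x * dot y y)%:C%C]) (fun=> 0).
Proof.
elim/poly_ind: p => [|p c IH].
  by apply: tangential_ext (tangential_cst 0) => y; rewrite ?horner0.
apply: tangential_ext (tangentialD (tangentialM IH tangential_radius) (tangential_cst c)) => y.
  by rewrite hornerMXaddC.
by rewrite /= mulr0 mul0r !addr0.
Qed.

Lemma tangential_poly (F : {poly {poly C}}) : tangential (eval_dots F) (eval_dots F^`()).
Proof.
elim/poly_ind: F => [|F c IH].
  by apply: tangential_ext (tangential_cst 0) => y; rewrite /eval_dots ?deriv0 !horner0.
apply: tangential_ext (tangentialD (tangentialM IH tangential_dot) (tangential_poly_radius c)) => y.
  by rewrite /eval_dots hornerMXaddC hornerD hornerM hornerC.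
rewrite /eval_dots derivMXaddC addr0 mulr1 hornerD hornerM hornerX hornerD hornerM hornerC addrC.
by [].
Qed.

End Tangential.

(** * Gamma on radial functions *)

Section GammaOperator.
Variables (R : realType) (m : nat).
Local Notation C := R[i].
Local Notation cl := (cliffordC R m).
Implicit Types (x y : 'rV[R]_m).

Definition cx x : 'I_m -> C := fun j => (x 0 j)%:C%C.

Lemma wedge_awedge x y : wedge x y = awedge (@cgen C m) (cx x) (cx y).
Proof.
apply: eq_bigr => j _; apply: eq_bigr => k _; congr (_ *: _).
by rewrite (rmorphB (real_complex R)) !(rmorphM (real_complex R)).
Qed.

Lemma dot_adot x y : (dot x y)%:C%C = adot (cx x) (cx y).
Proof.
rewrite /dot (rmorph_sum (real_complex R)); apply: eq_bigr => j _.
by rewrite (rmorphM (real_complex R)).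
Qed.

Definition cdwedge x (k : 'I_m) : cl := dwedge (@cgen C m) (cx x) k.

Lemma wedge_line x y (k : 'I_m) (h : R) :
  wedge x (h *: delta_mx 0 k + y) = h%:C%C *: cdwedge x k + wedge x y.
Proof.
have sq := @cgen_sqr C m; have an := @cgen_anticomm C m.
rewrite !wedge_awedge !(awedge_linear sq an).
rewrite (bigD1 k) //= [X in _ = _ + X](bigD1 k) //= addrA; congr (_ + _).
  rewrite -scalerDl; congr (_ *: _).
  by rewrite /cx lineE eqxx mulr1 (rmorphD (real_complex R)).
apply: eq_bigr => j /negbTE jk; congr (_ *: _).
by rewrite /cx lineE jk mulr0 add0r.
Qed.

Lemma cl_partial_cder (f : 'rV[R]_m -> cl) y (k : 'I_m) (c : cl) :
  (forall A : {set 'I_m}, cder (fun h : R => f (h *: delta_mx 0 k + y) A) (c A)) ->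
  cl_partial k f y = c.
Proof.
move=> H; apply/ffunP => A; rewrite ffunE; have [h1 h2] := H A.
apply/eqP; rewrite eq_complex /=; apply/andP; split; apply/eqP.
  by case: (@is_derive_line R _ (fun z => complex.Re (f z A)) y (delta_mx 0 k) _ h1).
by case: (@is_derive_line R _ (fun z => complex.Im (f z A)) y (delta_mx 0 k) _ h2).
Qed.

Lemma clD (a b : cl) A : (a + b) A = a A + b A.
Proof. exact: ffunE. Qed.

Lemma clZ (c : C) (a : cl) A : (c *: a) A = c * a A.
Proof. exact: ffunE. Qed.

Lemma clDZ (c : C) (a b : cl) A : (c *: a + b) A = c * a A + b A.
Proof. by rewrite clD clZ. Qed.

Lemma clZDZ (c d : C) (a b : cl) A : (c *: a + d *: b) A = c * a A + d * b A.
Proof. by rewrite clD !clZ. Qed.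

Lemma wedge_line_coef x y (k : 'I_m) (h : R) A :
  wedge x (h *: delta_mx 0 k + y) A = h%:C%C * cdwedge x k A + wedge x y A.
Proof. by rewrite wedge_line; exact: clDZ. Qed.

Definition radial x (phi chi : 'rV[R]_m -> C) : 'rV[R]_m -> cl :=
  fun y => (phi y)%:A + chi y *: wedge x y.

Lemma radialE x phi chi y A :
  radial x phi chi y A = phi y * (1 : cl) A + chi y * wedge x y A.
Proof. exact: clZDZ. Qed.

Lemma cder_comb (phi chi : R -> C) (one w d p c : C) :
  cder phi p -> cder chi c ->
  cder (fun h => phi h * one + chi h * (h%:C%C * d + w)) (p * one + (c * w + chi 0 * d)).
Proof.
move=> hp hc.
have dh : cder (fun h : R => h%:C%C * d + w) d.
  have d1 : is_derive (0 : R) 1 (fun h : R => h) 1 by exact: is_derive_id.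
  apply: cder_ext (cderD (cderM (cder_real d1) (cder_cst d)) (cder_cst w)) => //.
  by rewrite mulr0 !addr0 mul1r.
apply: cder_ext (cderD (cderM hp (cder_cst one)) (cderM hc dh)) => //.
by rewrite mulr0 addr0 mul0r add0r.
Qed.

Lemma clD3 (a b c : C) (u v w : cl) A :
  (a *: u + (b *: v + c *: w)) A = a * u A + (b * v A + c * w A).
Proof. by rewrite clDZ clZDZ. Qed.

Lemma radial_cder x phi phi' chi chi' y (k : 'I_m) A :
  cder (fun h : R => phi (h *: delta_mx 0 k + y)) phi' ->
  cder (fun h : R => chi (h *: delta_mx 0 k + y)) chi' ->
  cder (fun h : R => radial x phi chi (h *: delta_mx 0 k + y) A)
   ((phi'%:A + (chi' *: wedge x y + chi y *: cdwedge x k) : cl) A).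
Proof.
move=> hp hq.
have H := cder_comb ((1 : cl) A) (wedge x y A) (cdwedge x k A) hp hq.
apply: cder_ext H => [h|].
  exact: (esym (etrans (radialE x phi chi _ A)
    (congr1 (fun z => phi (h *: delta_mx 0 k + y) * (1 : cl) A +
        chi (h *: delta_mx 0 k + y) * z) (wedge_line_coef x y k h A)))).
rewrite line0; exact: esym (clD3 _ _ _ _ _ _ _).
Qed.

(** Transcription of Gamma_algebra to functions, the generators of the
    Clifford algebra being cgen. *)
Lemma Gamma_radial x phi phi' chi chi' y :
  tangential x phi phi' -> tangential x chi chi' ->
  Gamma_op (radial x phi chi) y = radial x
    (fun y => (m%:R - 1) * (dot x y)%:C%C * chi y +
       ((dot x y)%:C%C ^+ 2 - (dot x x * dot y y)%:C%C) * chi' y)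
    (fun y => phi' y + (m%:R - 2) * chi y) y.
Proof.
move=> [p hp] [q hq].
have sq := @cgen_sqr C m; have an := @cgen_anticomm C m.
pose c k : cl := (phi' y * cx x k + p y * cx y k)%:A +
   ((chi' y * cx x k + q y * cx y k) *: wedge x y + chi y *: cdwedge x k).
have E k : cl_partial k (radial x phi chi) y = c k.
  by apply: cl_partial_cder => A; apply: radial_cder; [exact: hp|exact: hq].
rewrite /Gamma_op.
under eq_bigr do under eq_bigr do rewrite !E.
have := Gamma_algebra sq an (cx x) (cx y) (phi' y) (chi y) (chi' y) (p y) (q y).
by rewrite /= -!dot_adot -!wedge_awedge -(rmorphM (real_complex R)).
Qed.

End GammaOperator.

(** * Iterates of Gamma on a plane wave *)

Section PlaneWave.
Variables (R : realType) (m N : nat) (alpha beta : R) (x y : 'rV[R]_m).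
Local Notation C := R[i].
Local Notation cl := (cliffordC R m).
Hypothesis mN : m = N.*2.+2.
Local Notation a := (sin alpha)^-1.

Definition wave_pair n := iter n (Gamma_pair (wave_del a)%:P 'X N) ((1, 0) : {poly {poly C}} * {poly {poly C}}).

Lemma wave_pairS n : wave_pair n.+1 = Gamma_pair (wave_del a)%:P 'X N (wave_pair n).
Proof. by []. Qed.

Lemma tangential_wave (F : {poly {poly C}}) :
  tangential x (fun y => expi (- a * dot x y) * eval_dots x F y)
    (fun y => expi (- a * dot x y) * (eval_dots x F^`() y + wave_del a * eval_dots x F y)).
Proof.
apply: tangential_ext (tangentialM (tangential_expi x (- a)) (tangential_poly x F)) => // z.
by rewrite /wave_del (rmorphN (real_complex R)) /=; ring.
Qed.

Lemma eval_dots_Gamma_pair1 p z : eval_dots x (Gamma_pair (wave_del a)%:P 'X N p).1 z =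
  N.*2.+1%:R * (dot x z)%:C%C * eval_dots x p.2 z +
  ((dot x z)%:C%C ^+ 2 - (dot x x * dot z z)%:C%C) *
    (eval_dots x p.2^`() z + wave_del a * eval_dots x p.2 z).
Proof.
rewrite /eval_dots /Gamma_pair /= -!(polyC_natr _ N.*2.+1).
by rewrite !(hornerE, hornerD, hornerM, hornerN) /=; ring.
Qed.

Lemma eval_dots_Gamma_pair2 p z : eval_dots x (Gamma_pair (wave_del a)%:P 'X N p).2 z =
  eval_dots x p.1^`() z + wave_del a * eval_dots x p.1 z + N.*2%:R * eval_dots x p.2 z.
Proof.
rewrite /eval_dots /Gamma_pair /= -!(polyC_natr _ N.*2).
by rewrite !(hornerE, hornerD, hornerM, hornerN) /=; ring.
Qed.

Lemma eval_dots0 z : eval_dots x 0 z = 0.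
Proof. by rewrite /eval_dots !horner0. Qed.

Lemma eval_dots1 z : eval_dots x 1 z = 1.
Proof. by rewrite /eval_dots !hornerC. Qed.

Lemma radial0 phi : radial x phi (fun=> 0) = fun z => (phi z)%:A.
Proof.
apply/funext => z; rewrite /radial; move: (wedge x z) => w.
by rewrite scale0r addr0.
Qed.

Lemma radial_ext phi phi' chi chi' z :
  phi z = phi' z -> chi z = chi' z -> radial x phi chi z = radial x phi' chi' z.
Proof. by rewrite /radial => -> ->. Qed.

(** By induction: Gamma_radial is Gamma_pair for m = 2 N + 2, once the
    derivative of the exponential factor is included. *)
Lemma Gamma_iter_wave n :
  iter n (@Gamma_op R m) (plane_wave alpha x) =
  radial x (fun z => expi (- a * dot x z) * eval_dots x (wave_pair n).1 z)
           (fun z => expi (- a * dot x z) * eval_dots x (wave_pair n).2 z).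
Proof.
elim: n => [|n IH].
  rewrite /wave_pair -[LHS]/(plane_wave alpha x); apply/funext => z.
  transitivity (radial x (fun z => expi (- dot x z / sin alpha)) (fun=> 0) z).
    by rewrite radial0.
  apply: radial_ext; last by rewrite eval_dots0 mulr0.
  by rewrite eval_dots1 mulr1 mulNr mulrC -mulNr mulrC.
rewrite [LHS]/= IH; apply/funext => z.
rewrite (Gamma_radial _ (tangential_wave _) (tangential_wave _)); apply: radial_ext.
  have mE : m%:R = N.*2.+1%:R + 1 :> C by rewrite [in LHS]mN natr1.
  by rewrite wave_pairS eval_dots_Gamma_pair1 mE; ring.
have mE : m%:R = N.*2%:R + 2 :> C by rewrite [in LHS]mN -natrD addn2.
by rewrite wave_pairS eval_dots_Gamma_pair2 mE; ring.
Qed.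

Definition radius_pair n (z : 'rV[R]_m) := iter n (Gamma_pair (wave_del a) (dot x x * dot z z)%:C%C N) (1, 0).

Lemma eval_dots_wave_pair n z :
  eval_dots x (wave_pair n).1 z = (radius_pair n z).1.[(dot x z)%:C%C] /\
  eval_dots x (wave_pair n).2 z = (radius_pair n z).2.[(dot x z)%:C%C].
Proof. exact: iter_Gamma_pair_horner. Qed.

Lemma exp_Gamma_term n (A : {set 'I_m}) :
  iter n (@Gamma_op R m) (plane_wave alpha x) y A =
  expi (- a * dot x y) * ((radius_pair n y).1.[(dot x y)%:C%C] * (1 : cl) A +
     (radius_pair n y).2.[(dot x y)%:C%C] * wedge x y A).
Proof.
have [<- <-] := eval_dots_wave_pair n y.
rewrite Gamma_iter_wave radialE mulrDr.
move: ((1 : cl) A) (wedge x y A) => v w; by rewrite !mulrA.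
Qed.

Lemma exp_Gamma_coef M (A : {set 'I_m}) :
  exp_Gamma_series beta (plane_wave alpha x) y M A =
  \sum_(0 <= n < M) ('i%C * beta%:C%C) ^+ n / n`!%:R *
    iter n (@Gamma_op R m) (plane_wave alpha x) y A.
Proof.
rewrite /exp_Gamma_series /series /=.
elim: M => [|M IH]; first by rewrite !big_geq // /GRing.zero /= ffunE.
by rewrite !big_nat_recr //= clD clZ IH.
Qed.

Lemma exp_Gamma_limit (S1 S2 : C) :
  ccvg (fun M => \sum_(0 <= n < M) (('i%C * beta%:C%C) ^+ n / n`!%:R) *
     (radius_pair n y).1.[(dot x y)%:C%C]) S1 ->
  ccvg (fun M => \sum_(0 <= n < M) (('i%C * beta%:C%C) ^+ n / n`!%:R) *
     (radius_pair n y).2.[(dot x y)%:C%C]) S2 ->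
  forall A, ccvg (fun M => exp_Gamma_series beta (plane_wave alpha x) y M A)
    ((expi (- a * dot x y) *: (S1%:A + S2 *: wedge x y) : cl) A).
Proof.
move=> h1 h2 A.
have h := ccvgMl (expi (- a * dot x y))
  (ccvgD (ccvgM h1 (ccvg_cst ((1 : cl) A))) (ccvgM h2 (ccvg_cst (wedge x y A)))).
apply: ccvg_eq; last by symmetry; rewrite clZ clZDZ; reflexivity.
apply: (eq_ccvg _ h) => M; rewrite exp_Gamma_coef.
under [RHS]eq_bigr do rewrite exp_Gamma_term.
move: ((1 : cl) A) (wedge x y A) => v w.
rewrite !mulr_suml -big_split mulr_sumr; apply: eq_bigr => n _ /=; ring.
Qed.

End PlaneWave.

(** * The kernel formula *)

Section KernelFormula.
Variables (R : realType) (m N : nat).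
Local Notation C := R[i].
Local Notation cl := (cliffordC R m).
Implicit Types (x y : 'rV[R]_m) (alpha beta : R).

(** Makes the square root in |x /\ y| a genuine one, whence t_star_sqr. *)
Lemma cauchy_schwarz x y : dot x y ^+ 2 <= dot x x * dot y y.
Proof.
have pos z : 0 <= dot z z by apply: sumr_ge0 => j _; rewrite -expr2 sqr_ge0.
have [y0|y0] := eqVneq (dot y y) 0.
  have yj j : y 0 j = 0.
    have := y0; rewrite /dot => /eqP; rewrite psumr_eq0 => [|i _]; last by rewrite -expr2 sqr_ge0.
    by move=> /allP/(_ j (mem_index_enum j)); rewrite /= mulf_eq0 orbb => /eqP.
  rewrite y0 mulr0 (_ : dot x y = 0) ?expr0n //.
  by rewrite /dot big1 // => j _; rewrite yj mulr0.
have yp : 0 < dot y y by rewrite lt_def y0 pos.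
have : 0 <= \sum_j (dot y y * x 0 j - dot x y * y 0 j) ^+ 2.
  by apply: sumr_ge0 => j _; exact: sqr_ge0.
have S b c : \sum_j (b * x 0 j - c * y 0 j) ^+ 2 =
    b ^+ 2 * dot x x - 2 * b * c * dot x y + c ^+ 2 * dot y y.
  rewrite /dot !mulr_sumr -sumrB -big_split /=.
  by apply: eq_bigr => j _; ring.
rewrite S (_ : _ + _ = dot y y * (dot x x * dot y y - dot x y ^+ 2)); last by ring.
by rewrite pmulr_rge0 // subr_ge0.
Qed.

Lemma t_star_sqr alpha beta x y :
  t_star alpha beta x y ^+ 2 =
  ((sin alpha)^-1 * sin beta) ^+ 2 * (dot x x * dot y y - dot x y ^+ 2).
Proof.
by rewrite /t_star exprMn /wedge_norm sqr_sqrtr ?subr_ge0 ?cauchy_schwarz // [sin beta / _]mulrC.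
Qed.

Lemma cl_lim_ccvg (u : nat -> cl) (l : cl) :
  (forall A, ccvg (fun n => u n A) (l A)) -> cl_cvg u /\ cl_lim u = l.
Proof.
move=> H; split=> [A|].
  by have [h1 h2] := H A; split; [apply: cvgP h1|apply: cvgP h2].
apply/ffunP => A; rewrite ffunE; have [h1 h2] := H A.
apply/eqP; rewrite eq_complex /=; apply/andP; split; apply/eqP; exact: cvg_lim.
Qed.

Lemma cl_scale_eq (c1 c2 c3 p q p' q' : C) (w : cl) :
  c1 * c2 * p = c3 * p' -> c1 * c2 * q = c3 * q' ->
  c1 *: (c2 *: (p%:A + q *: w)) = c3 *: (p'%:A + q' *: w).
Proof. by move=> E1 E2; rewrite scalerA !scalerDr !scalerA E1 E2. Qed.

Lemma sin_neq0_range alpha : - pi <= alpha <= pi ->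
  alpha != 0 -> alpha != pi -> alpha != - pi -> sin alpha != 0.
Proof.
move=> /andP[lo hi] a0 api aNpi.
have [an|ap|e] := ltgtP alpha 0; last by rewrite e eqxx in a0.
  rewrite -oppr_eq0 -sinN gt_eqF // sin_gt0_pi // oppr_gt0 an /=.
  by rewrite ltrNl lt_def eq_sym lo andbT eq_sym.
by rewrite gt_eqF // sin_gt0_pi // ap /= lt_def eq_sym api.
Qed.

Hypothesis mN : m = N.*2.+2.

Lemma half_m : (m - 2)./2 = N.
Proof. by rewrite mN subSS subSS subn0 doubleK. Qed.
Lemma half_m1 : (m./2 - 1)%N = N.
Proof. by rewrite mN /= doubleK subn1. Qed.
Lemma half_m2 : (m./2 - 2)%N = N.-1.
Proof. by rewrite mN /= doubleK subSS subn1. Qed.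
Lemma half_mR : (m - 2)%:R / 2 = N%:R :> R.
Proof. by rewrite mN subSS subSS subn0 -muln2 natrM mulfK // pnatr_eq0. Qed.

Lemma star_sum_C alpha beta x y n :
  \sum_(0 <= l < n.+1)
    'C(n, l)%:R * ('i%C * (sin beta)%:C%C) ^+ l * (cos beta ^+ (n - l))%:C%C *
      (Cstar l (s_star alpha beta x y) (t_star alpha beta x y))%:C%C =
  star_sum (sin alpha)^-1 beta (dot x y) (t_star alpha beta x y) true n :> C.
Proof. by rewrite /star_sum /s_star [sin beta / _]mulrC. Qed.

Lemma star_sum_B alpha beta x y n :
  \sum_(0 <= l < n.+1)
    'C(n, l)%:R * ('i%C * (sin beta)%:C%C) ^+ l * (cos beta ^+ (n - l))%:C%C *
      (Bstar l (s_star alpha beta x y) (t_star alpha beta x y))%:C%C =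
  star_sum (sin alpha)^-1 beta (dot x y) (t_star alpha beta x y) false n :> C.
Proof. by rewrite /star_sum /s_star [sin beta / _]mulrC. Qed.

(** The two components of the kernel are compared with those of the formula
    in this lemma and the next: the three exponential factors are merged, and
    the constant sqrt (pi / 2) = k is collected in front. *)
Lemma scalar_part (g e1 e2 e3 f B S n : C) (k sb : R) : e1 * e2 = e3 ->
  g * e1 * (f * (e2 * (- k%:C%C * B + n * 'i%C * (k * sb)%:C%C * S))) =
  k%:C%C * f * e3 * g * ('i%C * n * sb%:C%C * S + - B).
Proof. by move=> <-; rewrite (rmorphM (real_complex R)) /=; ring. Qed.

Lemma bivector_part (g e1 e2 e3 f S : C) (k sb a : R) : e1 * e2 = e3 ->
  g * e1 * (f * (e2 * (- (k * (a * sb))%:C%C * S))) =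
  k%:C%C * f * e3 * g * (- (sb * a)%:C%C * S).
Proof. by move=> <-; rewrite !(rmorphM (real_complex R)) /=; ring. Qed.

Lemma Asum_regE alpha beta x y :
  Asum_reg m beta (s_star alpha beta x y) (t_star alpha beta x y) =
  'i%C * N%:R * (sin beta)%:C%C *
    star_sum (sin alpha)^-1 beta (dot x y) (t_star alpha beta x y) true N.-1.
Proof.
have nR : (m - 2)%:R / 2 = N%:R :> C.
  by rewrite mN subSS subSS subn0 -muln2 natrM mulfK // pnatr_eq0.
by rewrite /Asum_reg half_m2 star_sum_C nR.
Qed.

Lemma Bsum_regE alpha beta x y :
  Bsum_reg m beta (s_star alpha beta x y) (t_star alpha beta x y) =
  - star_sum (sin alpha)^-1 beta (dot x y) (t_star alpha beta x y) false N.
Proof. by rewrite /Bsum_reg half_m1 star_sum_B. Qed.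

Lemma Csum_regE alpha beta x y :
  Csum_reg m alpha beta (s_star alpha beta x y) (t_star alpha beta x y) =
  - (sin beta / sin alpha)%:C%C *
    star_sum (sin alpha)^-1 beta (dot x y) (t_star alpha beta x y) true N.
Proof. by rewrite /Csum_reg half_m1 star_sum_C. Qed.

(** radial_limit1 and radial_limit2 at a = 1 / sin alpha, multiplied by the
    plane wave. *)
Lemma kernel_reg alpha beta x y : sin alpha != 0 ->
  cl_cvg (exp_Gamma_series beta (plane_wave alpha x) y) /\
  fcft_kernel alpha beta x y = kernel_formula_reg alpha beta x y.
Proof.
move=> sa.
have a0 : (sin alpha)^-1 != 0 by rewrite invr_eq0.
have ht := t_star_sqr alpha beta x y.
have h1 := radial_limit1 N a0 ht.
have h2 := radial_limit2 N a0 ht.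
have [cv lm] := cl_lim_ccvg (exp_Gamma_limit mN h1 h2).
split; first exact: cv.
rewrite /fcft_kernel /exp_Gamma lm /kernel_formula_reg.
have E : expi (- (sin alpha)^-1 * dot x y) * expi (- ((sin alpha)^-1 * (cos beta - 1) * dot x y)) =
    expi (- (cos beta / sin alpha * dot x y)) :> C.
  by rewrite -expiD; congr expi; ring.
have hb : beta * (m - 2)%:R / 2 = beta * N%:R by rewrite -mulrA half_mR.
rewrite Asum_regE Bsum_regE Csum_regE hb.
apply: cl_scale_eq; [exact: scalar_part E|exact: bivector_part E].
Qed.

(** Multiplying out (cos beta)^n with the powers of tan beta. *)
Lemma mul_cos_tan n l (c t : R) (X : C) : (l < n.+1)%N ->
  (c ^+ n)%:C%C * ('C(n, l)%:R * ('i%C * t%:C%C) ^+ l * X) =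
  'C(n, l)%:R * ('i%C * (c * t)%:C%C) ^+ l * (c ^+ (n - l))%:C%C * X.
Proof.
rewrite ltnS => ln.
rewrite -{1}(subnK ln) exprD (rmorphM (real_complex R) (c ^+ (n - l))) /=.
rewrite (rmorphXn (real_complex R) l c) (rmorphM (real_complex R) c t) /= !exprMn.
by ring.
Qed.

Lemma mul_cosS_tan n (c t : R) (A X : C) :
  (c ^+ n.+1)%:C%C * (A * t%:C%C * X) = A * (c * t)%:C%C * ((c ^+ n)%:C%C * X).
Proof. by rewrite exprS !(rmorphM (real_complex R)) /=; ring. Qed.

Lemma kernel_formula_regE alpha beta x y : (0 < N)%N -> sin alpha != 0 ->
  cos beta != 0 -> sin beta != 0 ->
  kernel_formula alpha beta x y = kernel_formula_reg alpha beta x y.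
Proof.
move=> N0 sa cb sb; rewrite /kernel_formula /kernel_formula_reg.
set s := s_star _ _ _ _; set t := t_star _ _ _ _.
have E : s * cot beta = cos beta / sin alpha * dot x y.
  by rewrite /s /s_star /cot; field; rewrite sb sa.
have sE : sin beta = cos beta * tan beta by rewrite /tan mulrCA divff ?mulr1.
have sums n (F : nat -> R) : (cos beta ^+ n)%:C%C *
    (\sum_(0 <= l < n.+1) 'C(n, l)%:R * ('i%C * (tan beta)%:C%C) ^+ l * (F l)%:C%C) =
    \sum_(0 <= l < n.+1) 'C(n, l)%:R * ('i%C * (sin beta)%:C%C) ^+ l *
      (cos beta ^+ (n - l))%:C%C * (F l)%:C%C :> C.
  rewrite mulr_sumr; apply: eq_big_nat => l /andP[_ ln].
  by rewrite sE; exact: mul_cos_tan.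
have EB : (cos beta ^+ N)%:C%C * Bsum m beta s t = Bsum_reg m beta s t.
  by rewrite /Bsum /Bsum_reg half_m1 mulrN sums.
have EC : (cos beta ^+ N)%:C%C * Csum m alpha beta s t = Csum_reg m alpha beta s t.
  by rewrite /Csum /Csum_reg half_m1 mulrCA sums.
have EA : (cos beta ^+ N)%:C%C * Asum m beta s t = Asum_reg m beta s t.
  rewrite /Asum /Asum_reg half_m2 -sums.
  rewrite sE -{1}(prednK N0); exact: mul_cosS_tan.
rewrite E half_m -EA -EB -EC.
rewrite -mulrDr; set w := wedge x y; set P := _%:C%C; set D := (_ ^+ N)%:C%C.
set F := expi _; set G := expi (- _); set H := expi _.
have V (c1 p q : C) : (c1 * D) *: (p%:A + q *: w) = c1 *: ((D * p)%:A + (D * q) *: w).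
  by rewrite !scalerDr !scalerA !mulrA.
by rewrite -V; congr (_ *: _); ring.
Qed.

End KernelFormula.

Theorem theorem4p2 (R : realType) (m : nat) (alpha beta : R)
    (x y : 'rV[R]_m)
    (m_gt2 : (2 < m)%N) (m_even : ~~ odd m)
    (alpha_range : - pi <= alpha <= pi) (beta_range : - pi <= beta <= pi)
    (alpha_neq0 : alpha != 0) (alpha_neqpi : alpha != pi)
    (alpha_neqNpi : alpha != - pi) :
  [/\ cl_cvg (exp_Gamma_series beta (plane_wave alpha x) y),
      cos beta != 0 -> sin beta != 0 ->
        fcft_kernel alpha beta x y = kernel_formula alpha beta x y
    & fcft_kernel alpha beta x y = kernel_formula_reg alpha beta x y].
Proof.
have sa := sin_neq0_range alpha_range alpha_neq0 alpha_neqpi alpha_neqNpi.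
have mN : m = (m./2.-1).*2.+2.
  by rewrite -doubleS prednK ?even_halfK // half_gt0 ltnW.
have N0 : (0 < m./2.-1)%N.
  by rewrite -double_gt0 -ltnS -ltnS -mN.
have [cv E] := kernel_reg mN beta x y sa.
split; [exact: cv| |exact: E].
by move=> cb sb; rewrite E; symmetry; exact: (kernel_formula_regE mN x y N0 sa cb sb).
Qed.
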